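(* Let $P_n(z)=\sum_{k=0}^n \eta_k \sqrt{\frac{k+1}{\pi}}\,z^k$, where $\{\eta_k\}$ are complex-valued i.i.d. standard Gaussian random variables. For a set $\Omega\subset\mathbb{C}$ let $N_n(\Omega)$ denote the number of zeros of $P_n$ in $\Omega$, let $\rho_n$ be the intensity function of the zeros of $P_n$, let $D(0,r)$ be the disk of radius $r$ centered at the origin, and let $\mathbb{D}$ be the unit disk. Then the following hold. (i) The intensity function can be written as $$\rho_n(z)=\frac{1}{\pi}\left( \frac{2}{(1-|z|^2)^2}-\frac{(n+1)(n+2)|z|^{2n}\left(|z|^{2n+4}-(n+2)|z|^2+n+1\right)}{\left(1+|z|^{2n+2}\left((n+1)|z|^2-(n+2)\right)\right)^2} \right).$$ (ii) For $r\in (0,1)$, $$\mathbb{E}[N_n(D(0,r))]=\frac{2r^2}{1-r^2}-\frac{(n+1)(n+2)(1-r^2)r^{2n+2}}{1+r^{2n+2}\left((n+1)r^2-(n+2)\right)}.$$ (iii) For $r\in (0,1)$, $$\lim_{n\rightarrow \infty}\mathbb{E}[N_n(D(0,r))]=\frac{2r^2}{1-r^2}.$$ (iv) The expected number of zeros in the expanding disk $D(0,e^{-t/(2n)})$ satisfies $$\lim_{n\rightarrow \infty}\frac{\mathbb{E}[N_n(D(0,e^{-t/(2n)}))]}{n}=\frac{2}{t}+\frac{t}{1-e^{t}+t},\quad t>0.$$ (v) Over the whole unit disk, $$\mathbb{E}[N_n(\mathbb{D})]=\frac{2n}{3}.$$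
   Context: Complex-valued i.i.d. standard Gaussian means $\eta_j=\alpha_j+i\beta_j$, where the $\alpha_j$ and $\beta_j$ are i.i.d. real-valued standard Gaussian random variables for all $j\in\{0,1,\dots,n\}$. $\mathbb{E}$ denotes expectation. The intensity function $\rho_n$ of the random polynomial $P_n$ is the density function for the expected number of zeros, i.e. the function satisfying $\mathbb{E}[N_n(\Omega)]=\int_{\Omega}\rho_n(z)\,dA(z)$ for $\Omega\subset\mathbb{C}$, where $dA$ is planar Lebesgue measure. *)

(* Defs.v *)
From mathcomp Require Export all_boot all_order all_algebra finmap complex.
From mathcomp Require Export all_classical all_reals all_analysis.

Set Implicit Arguments.
Unset Strict Implicit.
Unset Printing Implicit Defensive.

Export Order.TTheory GRing.Theory Num.Theory.
Export numFieldNormedType.Exports.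
Export ComplexField.Normc.

Local Open Scope classical_set_scope.
Local Open Scope ring_scope.
Local Open Scope complex_scope.

Section Gaussian.
Context d (T : measurableType d) (R : realType) (P : probability T R).

Definition mutually_independent (I : choiceType) (X : I -> {RV P >-> R}) : Prop :=
  forall (J : {fset I}) (A : I -> set R), (forall i, measurable (A i)) ->
    (P (\bigcap_(i in [set` J]) (X i @^-1` A i)) =
     \prod_(i <- J) P (X i @^-1` A i))%E.

Definition standard_gaussian (X : {RV P >-> R}) : Prop :=
  forall A : set R, measurable A -> distribution P X A = normal_prob 0 1 A.

(* The sequences of real parts and of imaginary parts are merged into a single
   family, so that they are also independent of each other. *)
Definition iid_standard_gaussian (alpha beta : nat -> {RV P >-> R}) : Prop :=
  let X := fun i : (nat + nat)%type =>
    match i with inl k => alpha k | inr k => beta k end in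
  mutually_independent X /\ (forall i, standard_gaussian (X i)).

Definition random_poly (alpha beta : nat -> {RV P >-> R}) (n : nat) (w : T) :
    {poly R[i]} :=
  \poly_(k < n.+1)
    ((alpha k w +i* beta k w) * (Num.sqrt (k.+1%:R / pi))%:C).

End Gaussian.

Section Zeros.
Context {R : realType}.

(* Zeros are counted with multiplicity. The sum has finite support, and it is 0
   for p = 0, because [mup] vanishes there. *)
Definition nb_zeros (p : {poly R[i]}) (Omega : set R[i]) : R :=
  \sum_(z \in Omega) ((mup z p)%:R : R).

Definition disk (r : R) : set R[i] := [set z | normc z < r].

(* [R[i]] carries no measurable structure in the library: Borel sets and the
   planar Lebesgue measure are those of the real plane, transported along this
   bijection. *)
Definition cplx (u : measurableTypeR R * measurableTypeR R) : R[i] :=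
  (u.1 : R) +i* (u.2 : R).

Definition area :
    {measure set (measurableTypeR R * measurableTypeR R) -> \bar R} :=
  (@lebesgue_measure R \x @lebesgue_measure R)%E.

Context d (T : measurableType d) (P : probability T R).

Definition expected_zeros (Q : T -> {poly R[i]}) (Omega : set R[i]) : \bar R :=
  ('E_P[fun w => nb_zeros (Q w) Omega])%E.

Definition is_intensity (Q : T -> {poly R[i]}) (rho : R[i] -> R) : Prop :=
  [/\ measurable_fun setT (rho \o cplx),
      forall z, 0 <= rho z &
      forall Omega : set R[i], measurable (cplx @^-1` Omega) ->
        expected_zeros Q Omega =
          (\int[area]_(u in cplx @^-1` Omega) (rho (cplx u))%:E)%E].

End Zeros.

(* Main.v *)
From HB Require Import structures.
Require Import Defs.
From mathcomp Require Import ring lra zify measurable_realfun.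

(* The argument principle over the boundary of a rectangle, together with the
   Gaussian identity E[P'/P (z)] = conj(z) K'(|z|^2) / K(|z|^2), where
   K(t) = sum_k (k+1) t^k / pi is E|P|^2 / 2 at |z|^2 = t, turns the expected
   number of zeros in a rectangle into an integral over its boundary. Green's
   formula makes it the integral over the rectangle of (1/pi) g'(|z|^2), with
   g(t) = t K'(t) / K(t), and the pi-lambda theorem extends this to Borel sets.
   In polar coordinates the expected number of zeros in D(0,r) is g(r^2), and
   K has a closed form because it is the derivative of a geometric sum. *)

Set Implicit Arguments.
Unset Strict Implicit.
Unset Printing Implicit Defensive.

Local Open Scope classical_set_scope.
Local Open Scope ring_scope.

Local Notation Re := complex.Re.
Local Notation Im := complex.Im.

(** * Integration by parts for the Gaussian density *)

Section Stein.
Context {R : realType}.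
Local Notation mu := (@lebesgue_measure R).
Implicit Types (f g : R -> R).

(** [P'/P] is singular at the random zeros, which obstructs both Fubini and Gaussian integration by
    parts. Fubini is rescued by a bound uniform in the sample: along a straight edge each zero
    contributes a multiple of a Poisson kernel, of absolute integral at most [pi], hence at most
    [n * pi] in all. This holds for the component of [P'/P dz] that measures the change of argument;
    the other one need not be integrable when a zero lies on the edge. Integration by parts is
    rescued by the factor [q / (q + eps)] with [q = |P|^2]: the expectation of this factor appears
    on both sides of the resulting identity, so letting [eps] tend to 0 takes dominated convergence
    and no explicit Gaussian integral. Zeros on the boundary are not discarded as a null event. They
    count one half, or one quarter at a corner, and disappear when an open rectangle is exhausted by
    closed ones. Up to the closed forms the coefficients [s k] are arbitrary with [s 0 != 0], which
    makes [K] positive on the nonnegative reals. *)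

Lemma integral_normal_prob (m s : R) (f : R -> \bar R) :
  (normal_prob m s).-integrable setT f ->
  (\int[normal_prob m s]_x f x = \int[mu]_x (f x * (normal_pdf m s x)%:E))%E.
Proof.
move=> fi; have mf := measurable_int _ fi.
have dom := normal_prob_dominates m s.
rewrite -(Radon_Nikodym_change_of_variables dom)//=.
apply: ae_eq_integral => //.
- exact: emeasurable_funM.
- apply: emeasurable_funM => //; apply/measurable_EFinP.
  exact: measurable_normal_pdf.
- apply: ae_eqe_mul2l => /=.
  rewrite Radon_NikodymE//=.
  case: cid => /= h [h1 h2 h3].
  apply: integral_ae_eq => //=.
  + by apply/measurableT_comp => //; exact: measurable_normal_pdf.
  + by move=> E _ mE; rewrite -h3.
Qed.

Lemma ge0_integral_normal_prob (m s : R) (f : R -> \bar R) :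
  measurable_fun setT f -> (forall x, 0 <= f x)%E ->
  (\int[normal_prob m s]_x f x = \int[mu]_x (f x * (normal_pdf m s x)%:E))%E.
Proof.
move=> mf f0; have dom := normal_prob_dominates m s.
rewrite -(Radon_Nikodym_SigmaFinite.change_of_variables dom)//.
have mRN := measurable_int _ (Radon_Nikodym_SigmaFinite.f_integrable dom).
apply: ae_eq_integral => //.
- exact: emeasurable_funM.
- apply: emeasurable_funM => //; apply/measurable_EFinP.
  exact: measurable_normal_pdf.
- apply: ae_eqe_mul2l => /=; apply: integral_ae_eq => //=.
  + exact: Radon_Nikodym_SigmaFinite.f_integrable.
  + by apply/measurableT_comp => //; exact: measurable_normal_pdf.
  + by move=> E _ mE; rewrite -Radon_Nikodym_SigmaFinite.f_integral.
Qed.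

Lemma integrable_normal_prob (m s : R) (g : R -> R) : measurable_fun setT g ->
  mu.-integrable setT (fun x => (g x * normal_pdf m s x)%:E) ->
  (normal_prob m s).-integrable setT (EFin \o g).
Proof.
move=> mg /integrableP[_ ig]; apply/integrableP; split.
  exact/measurable_EFinP.
rewrite ge0_integral_normal_prob//; last first.
  by apply: measurableT_comp => //; exact/measurable_EFinP.
apply: le_lt_trans ig; rewrite le_eqVlt; apply/orP; left; apply/eqP.
apply: eq_integral => x _.
by rewrite /= normrM EFinM (ger0_norm (normal_pdf_ge0 _ _ _)).
Qed.

Lemma normal_pdf01 (x : R) :
  normal_pdf 0 1 x = normal_peak 1 * expR (- (x ^+ 2 / 2)).
Proof.
rewrite normal_pdfE ?oner_neq0//= /normal_fun subr0 expr1n.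
by rewrite mulNr -(mulr_natr 1 2) mul1r.
Qed.

Lemma derive_normal_pdf (x : R) :
  is_derive x 1 (normal_pdf 0 1) (- x * normal_pdf 0 1 x).
Proof.
rewrite (_ : normal_pdf 0 1 = fun x : R => normal_peak 1 * expR (- (x ^+ 2 / 2))); last first.
  by apply/funext => y; exact: normal_pdf01.
apply: is_derive_eq.
rewrite /GRing.scale/=. lra.
Qed.

(** The density of standard deviation 2 decays more slowly than [x] times the standard one, so a
    multiple of it serves as an integrable majorant. *)
Lemma integrable_normal_moment1 :
  mu.-integrable setT (fun x : R => (x * normal_pdf 0 1 x)%:E).
Proof.
have p1 : 0 < normal_peak (1 : R) by rewrite normal_peak_gt0// oner_neq0.
have p2 : 0 < normal_peak (2 : R) by rewrite normal_peak_gt0.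
have := @integrable_normal_pdf R 0 2.
move/(integrableZl measurableT (normal_peak 1 / normal_peak 2)).
apply: le_integrable => //.
  apply/measurable_EFinP; apply: measurable_funM => //.
  exact: measurable_normal_pdf.
move=> x _ /=; rewrite lee_fin normrM [X in _ * X]ger0_norm ?normal_pdf_ge0//.
rewrite [leRHS]ger0_norm; last first.
  by rewrite !mulr_ge0 ?invr_ge0 ?normal_pdf_ge0// ltW.
rewrite normal_pdf01 normal_pdfE// /normal_fun subr0 mulrCA -[leRHS]mulrA.
apply: ler_wpM2l; first exact: ltW.
rewrite mulKf ?gt_eqF//.
(* The exponents differ by 1/2 - 1/8 = 3/8, and |x| <= 1 + 3/8 x^2 <= exp (3/8 x^2). *)
have -> : - x ^+ 2 / (2 ^+ 2 *+ 2) = - (x ^+ 2 / 2) + 3 / 8 * x ^+ 2 by field.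
rewrite expRD mulrC; apply: ler_wpM2l; first exact: expR_ge0.
apply: le_trans (expR_ge1Dx _); rewrite ler_norml.
have := sqr_ge0 (x - 1); have := sqr_ge0 (x + 1).
have := sqr_ge0 (x - 4/3); have := sqr_ge0 (x + 4/3).
by move=> ? ? ? ?; apply/andP; split; nra.
Qed.

(** The sign [e] treats both ends of the line at once. The squeeze rests on exp (- n^2 / 2) <= 2 /
    (n + 1). *)
Lemma cvg_normal_pdf (e : R) : `|e| = 1 ->
  normal_pdf 0 1 (e * n%:R) @[n --> \oo] --> (0 : R).
Proof.
move=> e1; apply/(@squeeze_cvgr _ _ _ _ (fun=> 0) (fun n => normal_peak 1 * (2 * harmonic n))).
- near=> n; rewrite normal_pdf_ge0 normal_pdf01 /=.
  apply: ler_wpM2l; first exact: normal_peak_ge0.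
  have -> : (e * n%:R) ^+ 2 = n%:R ^+ 2 by rewrite exprMn -(real_normK (num_real e)) e1 expr1n mul1r.
  have n0 : (0 : R) <= n%:R by [].
  have nn : (n%:R : R) <= n%:R ^+ 2.
    by rewrite -natrX ler_nat; case: (n) => // m; rewrite expnS expn1 leq_pmulr.
  rewrite expRN -[2 * _]invrK lef_pV2 ?posrE ?invr_gt0 ?mulr_gt0 ?expR_gt0//.
  rewrite invfM invrK; apply: le_trans (expR_ge1Dx _).
  rewrite -(natr1 n); lra.
- exact: cvg_cst.
- rewrite -[X in _ --> X](mulr0 (normal_peak 1)) -[X in _ * X](mulr0 2).
  by apply: cvgMr; apply: cvgMr; exact: cvg_harmonic.
Unshelve. all: end_near. Qed.

Lemma integral_itv_derive (F G : R -> R) (a b : R) : a <= b ->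
  continuous G -> (forall x : R, is_derive x 1 F (G x)) ->
  (\int[mu]_(x in `[a, b]) (G x)%:E = (F b - F a)%:E)%E.
Proof.
move=> + cG dF; rewrite le_eqVlt => /predU1P[->|ab].
  by rewrite set_itv1 integral_set1 subrr.
have cF x : {for x, continuous F}.
  by apply: differentiable_continuous; apply/derivable1_diffP.
rewrite (continuous_FTC2 ab (F := F)).
- by rewrite EFinB.
- by apply: continuous_subspaceT => x; exact: cG.
- split=> [x _||]; first by [].
  + by apply: cvg_at_right_filter; exact: cF.
  + by apply: cvg_at_left_filter; exact: cF.
- by move=> x _; rewrite derive1E; apply: derive_val.
Qed.

Lemma integral_derive_eq0 (F G : R -> R) :
  continuous G -> (forall x : R, is_derive x 1 F (G x)) ->
  mu.-integrable setT (EFin \o G) ->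
  F n%:R @[n --> \oo] --> (0 : R) -> F (- n%:R) @[n --> \oo] --> (0 : R) ->
  (\int[mu]_x (G x)%:E = 0)%E.
Proof.
move=> cG dF iG F0 FN0.
pose E n : set R := `[(- n%:R), n%:R]%classic.
have mE n : measurable (E n) by exact: measurable_itv.
have [|||_ _ cvgI] := @dominated_convergence _ _ _ mu setT measurableT
  (fun n => (EFin \o G) \_ (E n)) (EFin \o G) (abse \o (EFin \o G)) _
  (measurable_int _ iG) _ (integrable_abse iG) _.
- move=> n; apply/(measurable_restrictT _ (mE n)); apply: measurable_funTS.
  exact: measurable_int iG.
- apply: aeW => x _; apply: cvg_near_cst.
  near=> n; rewrite patchE mem_set// /E /= in_itv/=.
  rewrite -ler_norml; near: n; exact: nbhs_infty_ger.
- apply: aeW => x n _; rewrite patchE; case: ifP => // _.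
  by rewrite abse0 abse_ge0.
have {}cvgI : (F n%:R - F (- n%:R))%:E @[n --> \oo] --> (\int[mu]_x (G x)%:E)%E.
  apply: cvg_trans cvgI; apply: near_eq_cvg; near=> n.
  rewrite /= -integral_mkcond /E -(integral_itv_derive (F := F))//.
  by rewrite ge0_cp// oppr_le0.
apply: cvg_unique cvgI _ => //; apply: cvg_EFin; first by near=> n.
by rewrite -[X in _ --> X](subrr 0); exact: cvgB.
Unshelve. all: end_near. Qed.

(** The density [phi] satisfies phi' = - x phi, so f' phi - x f phi is the derivative of f phi,
    which vanishes at both ends because [f] is bounded. *)
Lemma gaussian_stein (f f' : R -> R) (M : R) :
  continuous f' -> (forall x : R, is_derive x 1 f (f' x)) ->
  (forall x, `|f x| <= M) -> (forall x, `|f' x| <= M) ->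
  (\int[normal_prob 0 1]_x (x * f x)%:E = \int[normal_prob 0 1]_x (f' x)%:E)%E.
Proof.
move=> cf' df fM f'M.
have cf : continuous f.
  by move=> x; apply: differentiable_continuous; apply/derivable1_diffP.
have cp : continuous (normal_pdf 0 1 : R -> R).
  by apply: continuous_normal_pdf; exact: oner_neq0.
have mf : measurable_fun setT f by exact: continuous_measurable_fun.
have mf' : measurable_fun setT f' by exact: continuous_measurable_fun.
have mp := @measurable_normal_pdf R 0 1.
have M0 : 0 <= M by apply: le_trans (fM 0).
have ixf : mu.-integrable setT (fun x => (x * f x * normal_pdf 0 1 x)%:E).
  have := integrableZl measurableT M integrable_normal_moment1.
  apply: le_integrable => //.
    by apply/measurable_EFinP; do 2 apply: measurable_funM => //.
  move=> x _ /=; rewrite lee_fin !normrM (ger0_norm M0) mulrA.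
  apply: ler_wpM2r => //; rewrite mulrC; exact: ler_wpM2r.
have if' : mu.-integrable setT (fun x => (f' x * normal_pdf 0 1 x)%:E).
  have := integrableZl measurableT M (integrable_normal_pdf (0:R) 1).
  apply: le_integrable => //.
    by apply/measurable_EFinP; apply: measurable_funM => //.
  move=> x _ /=; rewrite lee_fin !normrM (ger0_norm M0).
  exact: ler_wpM2r.
rewrite !integral_normal_prob//; last 2 first.
- exact: integrable_normal_prob.
- by apply: integrable_normal_prob => //; apply: measurable_funM.
under eq_integral do rewrite -EFinM.
under [RHS]eq_integral do rewrite -EFinM.
apply/esym/eqP; rewrite -[eqbRHS]add0e -sube_eq//; last first.
  exact: integrable_fin_num.
have ig := integrableB measurableT if' ixf.
rewrite -integralB//; apply/eqP.
pose G x := f' x * normal_pdf 0 1 x - x * f x * normal_pdf 0 1 x.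
transitivity (\int[mu]_x (G x)%:E)%E; first by apply: eq_integral => x _.
have Fcvg (e : R) : `|e| = 1 -> f (e * n%:R) * normal_pdf 0 1 (e * n%:R) @[n --> \oo] --> (0 : R).
  move=> e1; apply/norm_cvg0P.
  apply: (@squeeze_cvgr _ _ _ _ (fun=> 0) (fun n => M * normal_pdf 0 1 (e * n%:R))).
  - near=> n; rewrite normr_ge0 normrM (ger0_norm (normal_pdf_ge0 _ _ _)) /=.
    by apply: ler_wpM2r => //; exact: normal_pdf_ge0.
  - exact: cvg_cst.
  - by rewrite -[X in _ --> X](mulr0 M); apply: cvgMr; exact: cvg_normal_pdf.
apply: (@integral_derive_eq0 (fun x => f x * normal_pdf 0 1 x) G).
- move=> x; apply: cvgB; apply: cvgM.
  + exact: cf'.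
  + exact: cp.
  + by apply: cvgM => //; exact: cf.
  + exact: cp.
- move=> x; have dn := derive_normal_pdf x; rewrite /G.
  by apply: is_derive_eq; rewrite /GRing.scale/=; ring.
- exact: ig.
- by under eq_fun do rewrite -[_%:R]mul1r; apply: Fcvg; rewrite normr1.
- by under eq_fun do rewrite -mulN1r; apply: Fcvg; rewrite normrN1.
Unshelve. all: end_near. Qed.

End Stein.

(** * Integration of an independent coordinate *)

Section Independence.
Context d (T : measurableType d) (R : realType) (P : probability T R).
Context (K : choiceType) (X : K -> {RV P >-> R}).

(** A pi-system that generates the events depending on the coordinates in [J]; its members are the
    events for which mutual independence is stated. *)
Definition cylinders (J : {fset K}) : set (set T) :=
  [set E | exists2 A : K -> set R, (forall i, measurable (A i)) &
    E = \bigcap_(i in [set` J]) (X i @^-1` A i)].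

Lemma cylindersI J : setI_closed (cylinders J).
Proof.
move=> _ _ [A mA ->] [B mB ->]; exists (fun i => A i `&` B i).
  by move=> i; exact: measurableI.
by rewrite -bigcapI; apply: eq_bigcapr => i _.
Qed.

Lemma cylindersT J : cylinders J setT.
Proof.
exists (fun=> setT) => //; apply/esym.
by rewrite -subTset => w _ i _.
Qed.

Lemma measurable_preimage_RV i (A : set R) :
  measurable A -> measurable (X i @^-1` A).
Proof. by move=> mA; rewrite -[X in measurable X]setTI; exact: measurable_funP. Qed.

Lemma cylinders_measurable J : cylinders J `<=` measurable.
Proof.
move=> _ [A mA ->]; apply: fin_bigcap_measurable => // i _.
exact: measurable_preimage_RV.
Qed.

Lemma sigma_cylinders_measurable J : <<s cylinders J >> `<=` measurable.
Proof.
by apply: smallest_sub; [exact: sigma_algebra_measurable|exact: cylinders_measurable].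
Qed.

Lemma measurable_fun_cylinders J i : i \in J ->
  measurable_fun (setT : set (g_sigma_algebraType (cylinders J))) (X i).
Proof.
move=> iJ _ A mA; rewrite setTI; apply: sub_sigma_algebra.
exists (fun j => if j == i then A else setT).
  by move=> j; case: ifP.
apply/seteqP; split=> [w Aw j /= _|w /(_ i iJ)]; last by rewrite eqxx.
by case: eqP => // ->.
Qed.

Hypothesis indX : mutually_independent X.

(** As functions of [B] both sides are finite measures, a restriction and a multiple of [P]. They
    agree on the pi-system of cylinders, by mutual independence over [J] enlarged by [i]. *)
Lemma independent_cylinders (J : {fset K}) i (A : set R) (B : set T) : i \notin J ->
  measurable A -> <<s cylinders J >> B ->
  (P (X i @^-1` A `&` B) = P (X i @^-1` A) * P B)%E.
Proof.
move=> iJ mA sB.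
have mXA := measurable_preimage_RV i mA.
have p0 : 0 <= fine (P (X i @^-1` A)) by exact: fine_ge0.
have pE : ((NngNum p0)%:num%:E = P (X i @^-1` A))%E.
  by rewrite /= fineK// fin_num_measure.
rewrite setIC -pE -[LHS]/(mrestr P mXA B) -[RHS]/(mscale (NngNum p0) P B).
apply: (g_sigma_algebra_measure_unique (cylinders J) _ (fun=> setT)) => //.
- exact: cylinders_measurable.
- by move=> _; exact: cylindersT.
- by rewrite bigcup_const.
- exact: cylindersI.
- move=> _ [A' mA' ->].
  rewrite -[RHS]/((NngNum p0)%:num%:E * _)%E pE -[LHS]/(P (_ `&` _)).
  pose B' j := if j == i then A else A' j.
  have mB' j : measurable (B' j) by rewrite /B'; case: ifP.
  have B'J j : j \in J -> B' j = A' j.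
    by move=> jJ; rewrite /B'; case: eqP => // ji; rewrite -ji jJ in iJ.
  have := indX (i |` J)%fset mB'.
  have B'i : B' i = A by rewrite /B' eqxx.
  rewrite big_fsetU1//= set_fsetU1 bigcap_setU1 B'i setIC.
  rewrite (eq_bigcapr (fun j jJ => congr1 (preimage (X j)) (B'J j jJ))) => ->.
  rewrite (indX J mA'); congr (_ * _)%E; rewrite !big_seq.
  by apply: eq_bigr => j jJ; rewrite B'J.
- move=> _; rewrite -[X in (X < _)%E]/(P (_ `&` _)) setTI.
  exact: le_lt_trans (probability_le1 P mXA) (ltry 1).
Qed.

(** Since [Y] depends on the coordinates in [J] alone, the joint law of [Y] and [X i] is the product
    of their laws, and Fubini integrates [X i] out first. *)
Lemma independent_integral d' (E : measurableType d') (J : {fset K}) i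
    (Y : {mfun T >-> E}) (H : E * R -> \bar R) : i \notin J ->
  measurable_fun (setT : set (g_sigma_algebraType (cylinders J))) Y ->
  measurable_fun setT H -> P.-integrable setT (fun w => H (Y w, X i w)) ->
  (\int[P]_w H (Y w, X i w) = \int[P]_w \int[distribution P (X i)]_x H (Y w, x))%E.
Proof.
move=> iJ mY mH iH.
pose XY w := (Y w, X i w).
have mXY : measurable_fun setT XY by exact/measurable_fun_pair.
have prodE A : measurable A ->
    (distribution P Y \x distribution P (X i))%E A = pushforward P XY A.
  pose XYm : {mfun T >-> _} := HB.pack XY (isMeasurableFun.Build _ _ _ _ _ mXY).
  move=> mA; rewrite -[RHS]/(distribution P XYm A).
  apply: product_measure_unique => // {A mA} B A mB mA.
  rewrite [RHS]muleC -[LHS]/(P (Y @^-1` B `&` X i @^-1` A)) setIC.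
  apply: (independent_cylinders iJ mA).
  by have := mY measurableT B mB; rewrite setTI.
have iH' : (distribution P Y \x distribution P (X i))%E.-integrable setT H.
  apply/integrableP; split => //.
  rewrite (eq_measure_integral (pushforward P XY)); last by move=> A mA _; exact: prodE.
  rewrite ge0_integral_pushforward//; last exact: measurableT_comp.
  by case/integrableP: iH.
transitivity (\int[pushforward P XY]_z H z)%E.
  by rewrite integral_pushforward.
rewrite (eq_measure_integral (distribution P Y \x distribution P (X i))%E); last first.
  by move=> A mA _; exact/esym/prodE.
rewrite -integral12_prod_meas1//.
have iG := integrable_fubini_F iH'.
rewrite integral_pushforward//; first exact: measurable_int iG.
case/integrableP: iG => mG; rewrite ge0_integral_pushforward//; last first.
  exact: measurableT_comp.
move=> oo; apply/integrableP; split; last exact: oo.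
by apply: measurable_funTS; apply: (measurableT_comp mG).
Qed.

End Independence.

(** * Expectations of ratios of Gaussian linear forms *)

Lemma Rintegral_sum d (T : measurableType d) (R : realType)
    (mu : {measure set T -> \bar R}) (D : set T) (I : Type) (r : seq I)
    (f : I -> T -> R) : measurable D ->
  (forall i, mu.-integrable D (EFin \o f i)) ->
  \int[mu]_(x in D) (\sum_(i <- r) f i x) = \sum_(i <- r) \int[mu]_(x in D) f i x.
Proof.
move=> mD fi; rewrite /Rintegral sum_fine; last first.
  by move=> i _; exact: (integrable_fin_num mD (fi i)).
congr fine; rewrite -integral_sum//; apply: eq_integral => x _.
by rewrite /= sumEFin.
Qed.

Lemma integrable_bounded d (T : measurableType d) (R : realType)
    (P : probability T R) (f : T -> R) (M : R) : measurable_fun setT f ->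
  (forall w, `|f w| <= M) -> P.-integrable setT (EFin \o f).
Proof.
move=> mf fM; apply: measurable_bounded_integrable => //.
  by apply: le_lt_trans (ltry 1); exact: probability_le1.
by exists M; split; [exact: num_real|move=> y My x _ /=; apply: le_trans (ltW My)].
Qed.

Lemma measurable_inv (R : realType) : measurable_fun setT (@GRing.inv R).
Proof.
have <- : ~` [set (0 : R)] `|` [set 0] = setT by rewrite setUC setUv.
have m0 : measurable (~` [set (0 : R)]) by exact: measurableC.
apply/measurable_funU => //; split; last exact: measurable_fun_set1.
apply: open_continuous_measurable_fun.
  exact/closed_openC/closed_eq.
by move=> x /set_mem /eqP x0; exact: inv_continuous.
Qed.

Lemma measurable_funV d (T : measurableType d) (R : realType) (f : T -> R) :
  measurable_fun setT f -> measurable_fun setT (fun x => (f x)^-1).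
Proof. exact: measurableT_comp (@measurable_inv R). Qed.

Section GaussianForms.
Context d (T : measurableType d) (R : realType) (P : probability T R).
Context (K : choiceType) (X : K -> {RV P >-> R}).
Hypothesis indX : mutually_independent X.
Hypothesis gaussX : forall i, standard_gaussian (X i).

(** The law of [X i] lives on [R] and [normal_prob] on [measurableTypeR R]; pushing forward along
    the identity passes from one to the other. *)
Let idR : measurableTypeR R -> R := idfun.

Let measurable_idR : measurable_fun setT idR.
Proof. by move=> _ A mA; rewrite setTI. Qed.

Lemma ge0_integral_gaussian i (f : R -> \bar R) :
  measurable_fun setT f -> (forall x, 0 <= f x)%E ->
  (\int[distribution P (X i)]_x f x = \int[normal_prob 0 1]_x f x)%E.
Proof.
move=> mf f0; rewrite (eq_measure_integral (pushforward (normal_prob 0 1) idR)).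
  by rewrite ge0_integral_pushforward.
by move=> A mA _; exact: gaussX.
Qed.

Lemma integral_gaussian i (f : R -> \bar R) : measurable_fun setT f ->
  (normal_prob 0 1).-integrable setT f ->
  (\int[distribution P (X i)]_x f x = \int[normal_prob 0 1]_x f x)%E.
Proof.
move=> mf intf; rewrite (eq_measure_integral (pushforward (normal_prob 0 1) idR)).
  by rewrite integral_pushforward.
by move=> A mA _; exact: gaussX.
Qed.

Lemma integrable_gaussian i : P.-integrable setT (EFin \o X i).
Proof.
have := integrable_normal_prob (@measurable_id _ R setT) (@integrable_normal_moment1 R).
case/integrableP => mi; rewrite -(ge0_integral_gaussian i)//.
  rewrite ge0_integral_pushforward//.
    by move=> oo; apply/integrableP; split => //; exact/measurable_EFinP.
  exact: measurableT_comp.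
exact: measurableT_comp.
Qed.

Definition lin_form (J : {fset K}) (u : K -> R) (w : T) : R :=
  \sum_(i <- J) u i * X i w.

Lemma lin_formM (J : {fset K}) u w c :
  \sum_(i <- J) u i * (X i w * c) = lin_form J u w * c.
Proof. by rewrite mulr_suml; apply: eq_bigr => i _; rewrite mulrA. Qed.

Lemma measurable_lin_form J u : measurable_fun setT (lin_form J u).
Proof. by apply: measurable_sum => i; apply: measurable_funM. Qed.

HB.instance Definition _ J u :=
  isMeasurableFun.Build _ _ _ _ (lin_form J u) (measurable_lin_form J u).

Lemma lin_form_cylinders (J : {fset K}) u :
  measurable_fun (setT : set (g_sigma_algebraType (cylinders X J))) (lin_form J u).
Proof.
(* [measurable_sum] asks for the measurability of the term at every index, so the terms outside [J]
   are replaced by 0. *)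
rewrite (_ : lin_form J u = fun w => \sum_(i <- J) if i \in J then u i * X i w else 0).
  apply: measurable_sum => i; case: (boolP (i \in J)) => [iJ|_]; last exact: measurable_cst.
  by apply: measurable_funM => //; exact: measurable_fun_cylinders.
by apply/funext => w; rewrite /lin_form !big_seq; apply: eq_bigr => i ->.
Qed.

Section regularized.
Variable eps : R.
Hypothesis eps0 : 0 < eps.
Let q (x y : R) := x ^+ 2 + y ^+ 2 + eps.

Let q_gt0 x y : 0 < q x y.
Proof. by apply: ltr_wpDl => //; rewrite addr_ge0 ?sqr_ge0. Qed.

Let q_neq0 x y : q x y != 0. Proof. by rewrite gt_eqF. Qed.

Let le_q x y : `|x| <= (1 + eps^-1) * q x y.
Proof.
have e1 : eps^-1 * eps = 1 by rewrite mulVf// gt_eqF.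
have e2 : 0 < eps^-1 by rewrite invr_gt0.
rewrite /q ler_norml mulrDl mul1r (mulrDr eps^-1) e1.
have := sqr_ge0 (x - 1); have := sqr_ge0 (x + 1); have := sqr_ge0 y.
have : 0 <= eps^-1 * (x ^+ 2 + y ^+ 2).
  by rewrite mulr_ge0 ?addr_ge0 ?sqr_ge0// ltW.
by move=> ? ? ? ?; apply/andP; split; nra.
Qed.

(** The partial derivatives of x / q(x, y) are [dq1] in [x] and the opposite of [dq2] in [y]. *)
Let dq1 x y := (y ^+ 2 - x ^+ 2 + eps) / q x y ^+ 2.
Let dq2 x y := 2 * x * y / q x y ^+ 2.

Let dq1_le x y : `|dq1 x y| <= eps^-1.
Proof.
rewrite /dq1 normrM normfV (ger0_norm (sqr_ge0 _)) ler_pdivrMr ?exprn_gt0//.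
rewrite [leRHS]mulrC ler_pdivlMr//.
have qe : eps <= q x y by rewrite /q lerDr addr_ge0 ?sqr_ge0.
apply: (@le_trans _ _ (q x y * eps)).
  apply: ler_wpM2r; first exact: ltW.
  rewrite ler_norml /q.
  have x0 := sqr_ge0 x; have y0 := sqr_ge0 y; have e0 := eps0.
  by apply/andP; split; lra.
by rewrite expr2; apply: ler_wpM2l => //; exact: ltW.
Qed.

Let dq2_le x y : `|dq2 x y| <= eps^-1.
Proof.
rewrite /dq2 normrM normfV (ger0_norm (sqr_ge0 _)) ler_pdivrMr ?exprn_gt0//.
rewrite [leRHS]mulrC ler_pdivlMr//.
have qe : eps <= q x y by rewrite /q lerDr addr_ge0 ?sqr_ge0.
apply: (@le_trans _ _ (q x y * eps)).
  apply: ler_wpM2r; first exact: ltW.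
  rewrite ler_norml /q.
  have := sqr_ge0 (x + y); have := sqr_ge0 (x - y).
  by have e0 := eps0; move=> ? ?; apply/andP; split; nra.
by rewrite expr2; apply: ler_wpM2l => //; exact: ltW.
Qed.

Let derive_q a b s t (x : R) :
  is_derive x 1 (fun x => (s + a * x) / q (s + a * x) (t + b * x))
    (a * dq1 (s + a * x) (t + b * x) - b * dq2 (s + a * x) (t + b * x)).
Proof.
have qn := q_neq0 (s + a * x) (t + b * x).
rewrite /q in qn *.
apply: is_derive_eq; rewrite /GRing.scale/= /dq1 /dq2 /q.
by field.
Qed.

Let measurable_q d' (E : measurableType d') (f g : E -> R) :
  measurable_fun setT f -> measurable_fun setT g ->
  measurable_fun setT (fun x => q (f x) (g x)).
Proof.
move=> mf mg; apply: measurable_funD; last exact: measurable_cst.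
by apply: measurable_funD; apply: measurable_funX.
Qed.

Let derivable_continuous (f : R -> R) :
  (forall x, derivable f x 1) -> continuous f.
Proof.
by move=> df x; apply: differentiable_continuous; exact/derivable1_diffP.
Qed.

Let continuous_dq a b s t : continuous (fun x : R =>
  a * dq1 (s + a * x) (t + b * x) - b * dq2 (s + a * x) (t + b * x)).
Proof.
apply: derivable_continuous => x.
have qn : q (s + a * x) (t + b * x) ^+ 2 != 0 by rewrite expf_neq0.
rewrite /dq1 /dq2 /q in qn *.
exact: ex_derive.
Qed.

Variables (J : {fset K}) (u v : K -> R).
Local Notation U := (lin_form J u).
Local Notation V := (lin_form J v).

Let integrable_dq1 : P.-integrable setT (EFin \o (fun w => dq1 (U w) (V w))).
Proof.
apply: (@integrable_bounded _ _ _ _ _ eps^-1); last by move=> w; exact: dq1_le.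
apply: measurable_funM; last first.
  by apply: measurable_funV; apply: measurable_funX; exact: measurable_q.
apply: measurable_funD => //; apply: measurable_funB; exact: measurable_funX.
Qed.

Let integrable_dq2 : P.-integrable setT (EFin \o (fun w => dq2 (U w) (V w))).
Proof.
apply: (@integrable_bounded _ _ _ _ _ eps^-1); last by move=> w; exact: dq2_le.
apply: measurable_funM; last first.
  by apply: measurable_funV; apply: measurable_funX; exact: measurable_q.
by do 2 apply: measurable_funM => //.
Qed.

Lemma integrable_ibp i :
  P.-integrable setT (EFin \o (fun w => X i w * (U w / q (U w) (V w)))).
Proof.
have := integrableZl measurableT (1 + eps^-1) (integrable_gaussian i).
apply: le_integrable => //.
  apply/measurable_EFinP; apply: measurable_funM => //; apply: measurable_funM => //.
  by apply: measurable_funV; exact: measurable_q.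
move=> w _ /=; rewrite lee_fin normrM mulrC [leRHS]normrM; apply: ler_wpM2r => //.
rewrite normrM normfV (gtr0_norm (q_gt0 _ _)) ler_pdivrMr//.
by rewrite (gtr0_norm (addr_gt0 _ _)) ?invr_gt0// le_q.
Qed.

Lemma gaussian_ibp i : i \in J ->
  \int[P]_w (X i w * (U w / q (U w) (V w))) =
  u i * \int[P]_w (dq1 (U w) (V w)) - v i * \int[P]_w (dq2 (U w) (V w)).
Proof.
move=> iJ; rewrite -!RintegralZl// -RintegralB//; last 2 first.
- exact: (integrableZl measurableT (u i) integrable_dq1).
- exact: (integrableZl measurableT (v i) integrable_dq2).
rewrite /Rintegral; congr fine.
pose J' := (J `\ i)%fset.
pose Y w := (lin_form J' u w, lin_form J' v w).
have mY : measurable_fun setT Y by exact: measurable_fun_pair.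
pose Ym : {mfun T >-> _} := HB.pack Y (isMeasurableFun.Build _ _ _ _ _ mY).
have UE w : U w = lin_form J' u w + u i * X i w.
  by rewrite /lin_form (big_fsetD1 i iJ)/= addrC.
have VE w : V w = lin_form J' v w + v i * X i w.
  by rewrite /lin_form (big_fsetD1 i iJ)/= addrC.
pose s (z : R * R * R) := z.1.1 + u i * z.2.
pose t (z : R * R * R) := z.1.2 + v i * z.2.
have ms : measurable_fun setT s.
  by apply: measurable_funD; [exact: measurableT_comp|exact: measurable_funM].
have mt : measurable_fun setT t.
  by apply: measurable_funD; [exact: measurableT_comp|exact: measurable_funM].
pose H z := (z.2 * (s z / q (s z) (t z)))%:E.
pose H'r z := u i * dq1 (s z) (t z) - v i * dq2 (s z) (t z).
pose H' z := (H'r z)%:E.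
transitivity (\int[P]_w H (Ym w, X i w))%E.
  by apply: eq_integral => w _; rewrite /H /s /t/= -UE -VE.
transitivity (\int[P]_w H' (Ym w, X i w))%E; last first.
  by apply: eq_integral => w _; rewrite /H' /H'r /s /t/= -UE -VE.
have iJ' : i \notin J' by rewrite in_fsetD1 eqxx.
have cY : measurable_fun (setT : set (g_sigma_algebraType (cylinders X J'))) Ym.
  apply: measurable_fun_pair; exact: lin_form_cylinders.
have mH : measurable_fun setT H.
  apply/measurable_EFinP; apply: measurable_funM => //; apply: measurable_funM => //.
  by apply: measurable_funV; exact: measurable_q.
have mH' : measurable_fun setT H'.
  apply/measurable_EFinP; apply: measurable_funB; apply: measurable_funM => //.
    apply: measurable_funM; last first.
      by apply: measurable_funV; apply: measurable_funX; exact: measurable_q.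
    by apply: measurable_funD => //; apply: measurable_funB; exact: measurable_funX.
  apply: measurable_funM; last first.
    by apply: measurable_funV; apply: measurable_funX; exact: measurable_q.
  by do 2 apply: measurable_funM => //.
have M0 : 0 < 1 + eps^-1 by rewrite addr_gt0// invr_gt0.
have HM : forall y x, `|x * (s (y, x) / q (s (y, x)) (t (y, x)))| <= `|(1 + eps^-1) * x|.
  move=> y x; rewrite normrM mulrC [leRHS]normrM; apply: ler_wpM2r => //.
  rewrite normrM normfV (gtr0_norm (q_gt0 _ _)) ler_pdivrMr//.
  by rewrite (gtr0_norm M0) le_q.
pose M' := (`|u i| + `|v i|) * eps^-1.
have H'M z : `|u i * dq1 (s z) (t z) - v i * dq2 (s z) (t z)| <= M'.
  apply: le_trans (ler_normB _ _) _; rewrite (normrM (u i)) (normrM (v i)) /M' mulrDl.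
  by apply: lerD; apply: ler_wpM2l.
rewrite (independent_integral indX iJ' cY mH); last first.
  have := integrableZl measurableT (1 + eps^-1) (integrable_gaussian i).
  apply: le_integrable => //.
    by apply: (measurableT_comp mH); exact: measurable_fun_pair.
  by move=> w _ /=; rewrite lee_fin; exact: HM.
rewrite (independent_integral indX iJ' cY mH'); last first.
  apply: (@integrable_bounded _ _ _ _ _ M'); last by move=> w; exact: H'M.
  have mH'r : measurable_fun setT H'r by exact/measurable_EFinP.
  by apply: (measurableT_comp mH'r); exact: measurable_fun_pair.
apply: eq_integral => w _.
have mHw : measurable_fun setT (fun x => H (Y w, x)) by exact: (measurableT_comp mH).
have mH'w : measurable_fun setT (fun x => H' (Y w, x)) by exact: (measurableT_comp mH').
rewrite !integral_gaussian//; last 2 first.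
- apply: (@integrable_bounded _ _ _ (normal_prob 0 1) (fun x => H'r (Y w, x)) M').
    exact/measurable_EFinP.
  by move=> x; exact: H'M.
- have := integrable_normal_prob (@measurable_id _ R setT) (@integrable_normal_moment1 R).
  move=> /(integrableZl measurableT (1 + eps^-1)).
  apply: le_integrable => //.
  by move=> x _ /=; rewrite lee_fin; exact: HM.
apply: (@gaussian_stein _ (fun x => s (Y w, x) / q (s (Y w, x)) (t (Y w, x)))
  (fun x => u i * dq1 (s (Y w, x)) (t (Y w, x)) - v i * dq2 (s (Y w, x)) (t (Y w, x))) (1 + eps^-1 + M')).
- exact: continuous_dq.
- move=> x; exact: derive_q.
- move=> x; rewrite normrM normfV (gtr0_norm (q_gt0 _ _)) ler_pdivrMr//.
  apply: le_trans (le_q _ (t (Y w, x))) _; apply: ler_wpM2r; first exact: ltW.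
  by rewrite lerDl; apply: le_trans (H'M (Y w, x)).
- move=> x; apply: le_trans (H'M _) _.
  by rewrite lerDr ltW.
Qed.

End regularized.

Definition dot (J : {fset K}) (a b : K -> R) : R := \sum_(i <- J) a i * b i.

(** The conditions on [dot] express the circular symmetry of the complex Gaussian pair Z = U + iV, W
    = A + iB. The quotient is the regularized real part of W / Z, and the identity says that its
    mean is (a.u) / (u.u) times the mean of |Z|^2 / (|Z|^2 + eps). *)
Lemma gaussian_ratio (eps : R) (J : {fset K}) (u v a b : K -> R) : 0 < eps ->
  dot J u v = 0 -> dot J v v = dot J u u ->
  dot J b v = dot J a u -> dot J b u = - dot J a v ->
  dot J u u * \int[P]_w ((lin_form J a w * lin_form J u w +
      lin_form J b w * lin_form J v w) /
    (lin_form J u w ^+ 2 + lin_form J v w ^+ 2 + eps)) =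
  dot J a u * \int[P]_w ((lin_form J u w ^+ 2 + lin_form J v w ^+ 2) /
    (lin_form J u w ^+ 2 + lin_form J v w ^+ 2 + eps)).
Proof.
move=> eps0 uv vv bv bu.
set I1 := \int[P]_w ((lin_form J v w ^+ 2 - lin_form J u w ^+ 2 + eps) /
    (lin_form J u w ^+ 2 + lin_form J v w ^+ 2 + eps) ^+ 2).
set I1' := \int[P]_w ((lin_form J u w ^+ 2 - lin_form J v w ^+ 2 + eps) /
    (lin_form J v w ^+ 2 + lin_form J u w ^+ 2 + eps) ^+ 2).
set I2 := \int[P]_w (2 * lin_form J u w * lin_form J v w /
    (lin_form J u w ^+ 2 + lin_form J v w ^+ 2 + eps) ^+ 2).
have qC w : lin_form J v w ^+ 2 + lin_form J u w ^+ 2 + eps =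
    lin_form J u w ^+ 2 + lin_form J v w ^+ 2 + eps.
  by rewrite [X in X + _]addrC.
have ibpV i : i \in J -> \int[P]_w (X i w * (lin_form J v w /
    (lin_form J u w ^+ 2 + lin_form J v w ^+ 2 + eps))) = v i * I1' - u i * I2.
  move=> iJ; have := gaussian_ibp eps0 v u iJ.
  under eq_Rintegral do rewrite qC; move=> ->; congr (_ * _ - _ * _).
  by apply: eq_Rintegral => w _; rewrite qC; congr (_ / _); rewrite mulrAC.
have intV i : P.-integrable setT (EFin \o (fun w => X i w * (lin_form J v w /
    (lin_form J u w ^+ 2 + lin_form J v w ^+ 2 + eps)))).
  have := @integrable_ibp eps eps0 J v u i; apply: eq_integrable => // w _ /=.
  by rewrite qC.
(* Summing [gaussian_ibp] over the coordinates, the two occurrences of [I2] cancel by the condition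
   on [b'] and [u]. The unknown [I1 + I1'] is then eliminated by a second use with [u] and [v] in
   place of [a'] and [b'], where the numerator is |Z|^2. *)
have ibp a' b' : dot J b' v = dot J a' u -> dot J b' u = - dot J a' v ->
  \int[P]_w ((lin_form J a' w * lin_form J u w +
      lin_form J b' w * lin_form J v w) /
    (lin_form J u w ^+ 2 + lin_form J v w ^+ 2 + eps)) = dot J a' u * (I1 + I1').
  move=> b'v b'u.
  have ints (c : R) f : P.-integrable setT (EFin \o f) ->
      P.-integrable setT (EFin \o (fun w => c * f w)).
    by move=> h; exact: (integrableZl measurableT c h).
  transitivity (\sum_(i <- J) (a' i * (u i * I1 - v i * I2) + b' i * (v i * I1' - u i * I2))).
    transitivity (\sum_(i <- J) \int[P]_w (
        a' i * (X i w * (lin_form J u w / (lin_form J u w ^+ 2 + lin_form J v w ^+ 2 + eps))) +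
        b' i * (X i w * (lin_form J v w / (lin_form J u w ^+ 2 + lin_form J v w ^+ 2 + eps))))).
      rewrite -Rintegral_sum//.
        apply: eq_Rintegral => w _; rewrite big_split/= !lin_formM mulrDl.
        by rewrite !mulrA.
      move=> i; exact: (integrableD measurableT (ints _ _ (@integrable_ibp eps eps0 J u v i)) (ints _ _ (intV i))).
    rewrite big_seq [RHS]big_seq; apply: eq_bigr => i iJ.
    rewrite RintegralD//; last 2 first.
    - exact/ints/(@integrable_ibp eps eps0 J u v i).
    - exact/ints/intV.
    rewrite !RintegralZl//; last exact: (@integrable_ibp eps eps0 J u v i).
    by rewrite (gaussian_ibp eps0 u v iJ) ibpV.
  rewrite (eq_bigr (fun i => a' i * u i * I1 - a' i * v i * I2 + (b' i * v i * I1' - b' i * u i * I2))); last first.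
    by move=> i _; ring.
  rewrite big_split/= !sumrB -!mulr_suml -!/(dot _ _ _).
  by rewrite b'v b'u; ring.
rewrite ibp//.
rewrite [X in _ = _ * X](_ : _ = dot J u u * (I1 + I1')); first by rewrite mulrCA.
rewrite -(ibp u v)//.
  by rewrite uv oppr0 -uv /dot; apply: eq_bigr => i _; rewrite mulrC.
Qed.

Lemma integrable_ratio (eps : R) (J : {fset K}) (u v a b : K -> R) : 0 < eps ->
  P.-integrable setT (EFin \o (fun w => (lin_form J a w * lin_form J u w +
      lin_form J b w * lin_form J v w) /
    (lin_form J u w ^+ 2 + lin_form J v w ^+ 2 + eps))).
Proof.
move=> eps0.
have iU (a' u' v' : K -> R) : P.-integrable setT (EFin \o (fun w => lin_form J a' w * (lin_form J u' w /
    (lin_form J u' w ^+ 2 + lin_form J v' w ^+ 2 + eps)))).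
  rewrite (_ : EFin \o _ = fun w => (\sum_(i <- J) (a' i)%:E * (X i w * (lin_form J u' w /
    (lin_form J u' w ^+ 2 + lin_form J v' w ^+ 2 + eps)))%:E)%E).
    apply: integrable_sum => // i _.
    exact: (integrableZl measurableT (a' i) (@integrable_ibp eps eps0 J u' v' i)).
  by apply/funext => w; rewrite /= -lin_formM -sumEFin.
have := integrableD measurableT (iU a u v) (iU b v u).
apply: eq_integrable => // w _ /=; congr EFin.
by rewrite [lin_form J v w ^+ 2 + _]addrC !mulrA -mulrDl.
Qed.

(** Once the other coordinates are fixed, the form vanishes for a single value of [X i], and the
    Gaussian law has no atoms. *)
Lemma lin_form_neq0 (J : {fset K}) (u : K -> R) i : i \in J -> u i != 0 ->
  {ae P, forall w, lin_form J u w != 0}.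
Proof.
move=> iJ ui.
pose J' := (J `\ i)%fset.
have UE w : lin_form J u w = lin_form J' u w + u i * X i w.
  by rewrite /lin_form (big_fsetD1 i iJ)/= addrC.
pose N := [set w | lin_form J u w = 0].
have mN : measurable N.
  rewrite -[N]setTI; exact: (measurable_lin_form J u measurableT (measurable_set1 0)).
suff PN : P N = 0%E.
  exists N; split => // w /= /negP; rewrite negbK => /eqP.
  by [].
pose s (z : R * R) := z.1 + u i * z.2.
have ms : measurable_fun setT s.
  by apply: measurable_funD => //; exact: measurable_funM.
pose H z := (\1_[set (0 : R)] (s z) : R)%:E.
have mHr : measurable_fun setT (fun z => \1_[set (0 : R)] (s z) : R).
  by apply: (measurableT_comp _ ms); exact: measurable_indic.
have mH : measurable_fun setT H by exact/measurable_EFinP.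
have iJ' : i \notin J' by rewrite in_fsetD1 eqxx.
transitivity (\int[P]_w H (lin_form J' u w, X i w))%E.
  rewrite -[N]setIT -integral_indic//; apply: eq_integral => w _.
  by rewrite /H /s /= -UE !indicE; congr (_%:R%:E); apply/idP/idP; rewrite !inE.
rewrite (independent_integral indX iJ' (@lin_form_cylinders J' u) mH); last first.
  apply: (@integrable_bounded _ _ _ P (fun w => \1_[set (0 : R)] (s (lin_form J' u w, X i w))) 1).
    by apply: (measurableT_comp mHr); exact: measurable_fun_pair.
  by move=> w; rewrite indicE ger0_norm// lern1 leq_b1.
rewrite integral0_eq// => w _.
have mHw : measurable_fun setT (fun x => H (lin_form J' u w, x)) by exact: (measurableT_comp mH).
rewrite ge0_integral_gaussian//; last first.
  by move=> x; rewrite lee_fin indicE.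
pose c := - lin_form J' u w / u i.
transitivity (\int[normal_prob 0 1]_x (\1_[set c] x)%:E)%E.
  apply: eq_integral => x _; rewrite /H /s/= !indicE; congr ((nat_of_bool _)%:R%:E); apply/idP/idP; rewrite !inE/=.
    by rewrite /c => /eqP; rewrite addrC addr_eq0 => /eqP <-; rewrite mulrC mulKf.
  by rewrite /c => ->; rewrite mulrC divfK// addrN.
rewrite integral_indic// setIT -[LHS]/(\int[lebesgue_measure]_(x in [set c]) _)%E.
exact: integral_set1.
Qed.

End GaussianForms.

(** * Winding numbers of rectangles and logarithmic derivatives *)

Section Winding.
Local Open Scope complex_scope.
Context {R : realType}.
Local Notation mu := (@lebesgue_measure R).
Implicit Types (x y c h : R).

Lemma derivable_continuous (f : R -> R) :
  (forall x : R, derivable f x 1) -> continuous f.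
Proof.
by move=> df x; apply: differentiable_continuous; exact/derivable1_diffP.
Qed.

(** This is - Im of 1 / (x - c + ih), that is [pi] times the Poisson kernel for h > 0. At [h = 0] it
    is identically 0, including the pole [x = c] where it reads 0 / 0. *)
Definition kern h x c : R := h / ((x - c) ^+ 2 + h ^+ 2).

Lemma kern_den_gt0 h x c : h != 0 -> 0 < (x - c) ^+ 2 + h ^+ 2.
Proof. by move=> h0; rewrite ltr_wpDl ?sqr_ge0// exprn_even_gt0. Qed.

Lemma derive_atan_kern h x c : h != 0 ->
  is_derive x 1 (fun x : R => atan ((x - c) / h)) (kern h x c).
Proof.
move=> h0; apply: is_derive_eq; rewrite /GRing.scale/= /kern.
have := kern_den_gt0 x c h0 => /lt0r_neq0 k0.
by field; rewrite k0 h0.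
Qed.

Lemma continuous_kern h c : continuous (kern h ^~ c).
Proof.
have [->|h0] := eqVneq h 0.
  by rewrite (_ : kern _ ^~ _ = fun=> 0); [exact: cst_continuous|apply/funext=> x; rewrite /kern mul0r].
apply: derivable_continuous => x; rewrite /kern.
have := kern_den_gt0 x c h0 => /lt0r_neq0 k0.
exact: ex_derive.
Qed.

Lemma integral_kern h c x1 x2 : x1 <= x2 ->
  (\int[mu]_(x in `[x1, x2]) (kern h x c)%:E =
   (atan ((x2 - c) / h) - atan ((x1 - c) / h))%:E)%E.
Proof.
move=> x12; have [->|h0] := eqVneq h 0.
  rewrite invr0 !mulr0 subrr integral0_eq// => x _.
  by rewrite /kern mul0r.
exact: (@integral_itv_derive R (fun x : R => atan ((x - c) / h)) (kern h ^~ c) x1 x2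
  x12 (@continuous_kern h c) (fun x => derive_atan_kern x c h0)).
Qed.

(** The kernel has the constant sign of [h], so the integral of its absolute value is an increment
    of [atan]. The bound stays uniform as the zero approaches the edge, which Fubini will need. *)
Lemma integral_abs_kern h c x1 x2 : x1 <= x2 ->
  (\int[mu]_(x in `[x1, x2]) `|kern h x c|%:E <= pi%:E)%E.
Proof.
move=> x12.
rewrite (eq_integral (fun x : measurableTypeR R => (kern `|h| x c)%:E)); last first.
  move=> x _; congr EFin; rewrite /kern normrM normfV real_normK ?num_real//.
  by congr (_ / _); rewrite ger0_norm ?addr_ge0 ?sqr_ge0.
rewrite integral_kern// lee_fin.
have := atan_ltpi2 ((x2 - c) / `|h|); have := atan_gtNpi2 ((x1 - c) / `|h|).
lra.
Qed.

Lemma atanV x : 0 < x -> atan x^-1 = pi / 2 - atan x.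
Proof.
move=> x0; have ax : 0 < atan x by rewrite -atan0 lt_atan.
have ax2 := atan_ltpi2 x.
have s0 : 0 < sin (atan x) by rewrite sin_gt0_pihalf// ax.
have c0 : 0 < cos (atan x).
  by rewrite cos_gt0_pihalf// ax2 andbT (lt_trans _ ax)// oppr_lt0 divr_gt0 ?pi_gt0.
rewrite -[RHS]tanK; last by rewrite in_itv/=; apply/andP; split; lra.
rewrite -[in LHS](atanK x) /tan; congr atan.
rewrite -opprB sinN cosN sinBpihalf opprK.
rewrite cosB cos_pihalf mulr0 add0r sin_pihalf mulr1.
by rewrite invf_div.
Qed.

(** For positive [x] and [y] this is [atanV], and oddness reaches the other quadrants. On the axes
    both sides vanish because x / 0 = 0 and the sign of 0 is 0. *)
Lemma atan_quadrant x y :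
  atan (x / y) + atan (y / x) = pi / 2 * (Num.sg x * Num.sg y).
Proof.
wlog x0 : x y / 0 <= x.
  move=> H; have [|x0] := leP 0 x; first exact: H.
  have /H : 0 <= - x by rewrite oppr_ge0 ltW.
  move=> /(_ (- y)); rewrite !sgrN mulrNN => <-.
  by rewrite !invrN !mulrNN.
wlog y0 : y / 0 <= y.
  move=> H; have [|y0] := leP 0 y; first exact: H.
  have /H : 0 <= - y by rewrite oppr_ge0 ltW.
  rewrite sgrN mulrN mulrN => /eqP; rewrite eq_sym eqr_oppLR => /eqP ->.
  by rewrite invrN mulrN mulNr !atanN; ring.
have [->|xn] := eqVneq x 0; first by rewrite invr0 mulr0 !mul0r atan0 sgr0; ring.
have [->|yn] := eqVneq y 0; first by rewrite invr0 mulr0 !mul0r atan0 sgr0; ring.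
have xp : 0 < x by rewrite lt_def xn.
have yp : 0 < y by rewrite lt_def yn.
rewrite -[y / x]invf_div atanV ?divr_gt0// !gtr0_sg//; lra.
Qed.

(** A symmetrized indicator: for x1 < x2 it is 1 inside the interval, 0 outside and 1/2 at an end
    point. *)
Definition halfsg x1 x2 c : R := (Num.sg (x2 - c) - Num.sg (x1 - c)) / 2.

(** Each corner collects one pair atan (x / y) + atan (y / x), which [atan_quadrant] turns into
    signs; the product of the two half differences of signs results, wherever the point (a, b)
    lies. *)
Lemma winding_kern (x1 x2 y1 y2 a b : R) :
  (atan ((x2 - a) / (y2 - b)) - atan ((x1 - a) / (y2 - b))) -
  (atan ((x2 - a) / (y1 - b)) - atan ((x1 - a) / (y1 - b))) +
  (atan ((y2 - b) / (x2 - a)) - atan ((y1 - b) / (x2 - a))) -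
  (atan ((y2 - b) / (x1 - a)) - atan ((y1 - b) / (x1 - a))) =
  2 * pi * (halfsg x1 x2 a * halfsg y1 y2 b).
Proof.
have q22 := atan_quadrant (x2 - a) (y2 - b).
have q12 := atan_quadrant (x1 - a) (y2 - b).
have q21 := atan_quadrant (x2 - a) (y1 - b).
have q11 := atan_quadrant (x1 - a) (y1 - b).
rewrite /halfsg; lra.
Qed.

End Winding.

(** * Zeros of a complex polynomial and its logarithmic derivative *)

Section Zeros.
Local Open Scope complex_scope.
Context {R : realType}.
Implicit Types (p : {poly R[i]}) (z : R[i]).

(** A list with repetitions, so that counting with multiplicity is a plain sum. The empty list for
    [p = 0] agrees with the value 0 of [nb_zeros]. *)
Definition zeros p : seq R[i] :=
  if p == 0 then [::] else sval (closed_field_poly_normal p).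

Lemma zeros_prod p : p = lead_coef p *: \prod_(a <- zeros p) ('X - a%:P).
Proof.
rewrite /zeros; case: eqP => [->|_]; first by rewrite lead_coef0 scale0r.
by case: closed_field_poly_normal.
Qed.

Lemma size_zeros p : (size (zeros p) <= (size p).-1)%N.
Proof.
have [->|p0] := eqVneq p 0; first by rewrite /zeros eqxx.
by rewrite [in leqRHS](zeros_prod p) size_scale ?lead_coef_eq0// size_prod_XsubC.
Qed.

Lemma mup_zeros p z : p != 0 -> mup z p = count_mem z (zeros p).
Proof.
move=> p0; rewrite {1}(zeros_prod p) -mul_polyC mupMr ?mu_prod_XsubC//.
by rewrite rootC lead_coef_eq0.
Qed.

Lemma nb_zerosE p (Om : set R[i]) : nb_zeros p Om = \sum_(a <- zeros p) \1_Om a.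
Proof.
have [->|p0] := eqVneq p 0.
  rewrite /zeros eqxx big_nil /nb_zeros fsbig1// => z _.
  have -> // : mup z (0 : {poly R[i]}) = 0%N.
  (* [mup] is an ordinal below [(size p).+1], which is 1 here. *)
  have : (mup z (0%R : {poly R[i]}) < (size (0%R : {poly R[i]})).+1)%N by exact: ltn_ord.
  by rewrite size_poly0 ltnS leqn0 => /eqP.
rewrite /nb_zeros.
transitivity (\sum_(z \in Om `&` [set` zeros p]) ((mup z p)%:R : R)).
  apply/esym; apply: fsbig_widen => [z []//|z [Omz /not_andP[//|/= zz]]].
  by rewrite mup_zeros// (count_memPn _)//; apply/negP.
rewrite fsbig_mkcondl (_ : [set` zeros p] = [set` undup (zeros p)]); last first.
  by apply/seteqP; split => z /=; rewrite mem_undup.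
rewrite -fsbig_seq ?undup_uniq// -[RHS]big_undup_iterop_count.
apply: eq_bigr => z _; rewrite mup_zeros// indicE -[RHS]/(_ *+ _).
by case: ifP => _; rewrite ?mul0rn.
Qed.

Lemma logderiv_zeros p z : z \notin zeros p ->
  p^`().[z] / p.[z] = \sum_(a <- zeros p) (z - a)^-1.
Proof.
move=> zp; have [->|p0] := eqVneq p 0.
  by rewrite deriv0 horner0 mul0r /zeros eqxx big_nil.
rewrite {1 2}(zeros_prod p) derivZ !hornerZ invfM mulrACA divff ?lead_coef_eq0// mul1r.
elim: (zeros p) zp => [_|a s IH]; first by rewrite !big_nil derivC horner0 mul0r.
rewrite in_cons negb_or => /andP[za zs]; rewrite !big_cons -IH//.
rewrite derivM derivXsubC mul1r hornerD !hornerM !hornerXsubC.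
have za0 : z - a != 0 by rewrite subr_eq0.
have P0 : (\prod_(j <- s) ('X - j%:P)).[z] != 0.
  rewrite horner_prod prodf_seq_neq0; apply/allP => j js /=.
  rewrite hornerXsubC subr_eq0; apply: contraNneq zs => ->; exact: js.
by field; rewrite P0.
Qed.

End Zeros.

(** * Exchange of expectation and edge integral *)

Section RegularizedFubini.
Context d (T : measurableType d) (R : realType) (P : probability T R).
Local Notation mu := (@lebesgue_measure R).

Lemma cvg_regularized (q : R) : 0 < q ->
  q / (q + n.+1%:R^-1) @[n --> \oo] --> (1 : R).
Proof.
move=> q0; rewrite -[X in _ --> X](@divff _ q) ?gt_eqF//.
apply: cvgM; first exact: cvg_cst.
apply: cvgV; first by rewrite gt_eqF.
rewrite -[X in _ --> X]addr0; apply: cvgD; first exact: cvg_cst.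
exact: cvg_harmonic.
Qed.

Lemma regularized_le1 (q e : R) : 0 <= q -> 0 < e -> 0 <= q / (q + e) <= 1.
Proof.
move=> q0 e0; have qe : 0 < q + e by rewrite ltr_wpDl.
apply/andP; split; first by apply: divr_ge0 => //; exact: ltW.
by rewrite ler_pdivrMr// mul1r lerDl ltW.
Qed.

Variables (f q : T * measurableTypeR R -> R) (g : R -> R) (a b C M : R).
Hypotheses (mf : measurable_fun setT f) (mq : measurable_fun setT q).
Hypothesis mg : measurable_fun setT g.
Hypothesis q0 : forall z, 0 <= q z.
Hypothesis qf : forall z, q z = 0 -> f z = 0.
Hypothesis fC : forall w, (\int[mu]_(x in `[a, b]) `|f (w, x)|%:E <= C%:E)%E.
Hypothesis gM : forall x, x \in `[a, b] -> `|g x| <= M.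
Hypothesis q_neq0 : forall x, {ae P, forall w, q (w, x) != 0}.
Hypothesis fg : forall (e : R) x, 0 < e -> \int[P]_w (f (w, x) * (q (w, x) / (q (w, x) + e))) =
  g x * \int[P]_w (q (w, x) / (q (w, x) + e)).

Hypothesis ifq : forall (e : R) x, 0 < e ->
  P.-integrable setT (fun w => (f (w, x) * (q (w, x) / (q (w, x) + e)))%:E).

Let E : set (measurableTypeR R) := `[a, b]%classic.
Let mE : measurable E. Proof. exact: measurable_itv. Qed.
Let reg n z := q z / (q z + n.+1%:R^-1).
Let F z := (f z * \1_E z.2)%:E.
Let F_ n z := (f z * reg n z * \1_E z.2)%:E.

Let reg01 n z : 0 <= reg n z <= 1.
Proof. by apply: regularized_le1 => //; rewrite invr_gt0. Qed.

Let mreg n : measurable_fun setT (reg n).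
Proof. by apply: measurable_funM => //; apply: measurable_funV; exact: measurable_funD. Qed.

Let mI : measurable_fun setT (fun z : T * measurableTypeR R => \1_E z.2 : R).
Proof. by apply: (measurableT_comp (f := \1_E : measurableTypeR R -> R)). Qed.

Let mF : measurable_fun setT F.
Proof. by apply/measurable_EFinP; exact: measurable_funM. Qed.

Let mF_ n : measurable_fun setT (F_ n).
Proof. by apply/measurable_EFinP; apply: measurable_funM => //; exact: measurable_funM. Qed.

Let iF : (P \x mu)%E.-integrable setT F.
Proof.
apply/integrable12ltyP => //.
apply: (@le_lt_trans _ _ (\int[P]_w C%:E)%E); last first.
  by rewrite integral_cst// ltey_eq fin_numM//; exact: fin_num_measure.
apply: ge0_le_integral => //.
- by move=> w _; exact: integral_ge0.
- by apply: (measurable_fun_fubini_tonelli_F (abse \o F)) => //=; exact: measurableT_comp.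
move=> w _; apply: le_trans (fC w); rewrite [leRHS]integral_mkcond.
rewrite le_eqVlt; apply/orP; left; apply/eqP; apply: eq_integral => x _.
rewrite /F /= patchE indicE -/E; case: ifP => _; first by rewrite mulr1.
by rewrite mulr0 normr0.
Qed.

Let F_le n z : (`|F_ n z| <= `|F z|)%E.
Proof.
have /andP[r0 r1] := reg01 n z.
rewrite lee_fin (normrM (f z * reg n z)) (normrM (f z) (\1_E z.2)).
apply: ler_wpM2r => //; rewrite (normrM (f z) (reg n z)) (ger0_norm r0).
exact: ler_piMr.
Qed.

Let F_cvg z : F_ n z @[n --> \oo] --> F z.
Proof.
(* Where [q] vanishes so does [f], hence the regularized integrands converge at every point of the
   product space. *)
have [qz|qz] := eqVneq (q z) 0.
  by rewrite /F_ /F qf//; under eq_fun do rewrite mul0r; exact: cvg_cst.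
apply: cvg_EFin; first by near=> n.
apply: cvgM; last exact: cvg_cst.
rewrite -[X in _ --> X]mulr1; apply: cvgM; first exact: cvg_cst.
by apply: cvg_regularized; rewrite lt_def qz q0.
Unshelve. all: end_near. Qed.

Let iF_ n : (P \x mu)%E.-integrable setT (F_ n).
Proof.
by apply: le_integrable iF => // z _; exact: F_le.
Qed.

Let r n x := \int[P]_w reg n (w, x).

Let ireg n x : P.-integrable setT (EFin \o (fun w => reg n (w, x))).
Proof.
apply: (@integrable_bounded _ _ _ _ _ 1).
  by apply: (measurableT_comp (mreg n)); exact: pair2_measurable.
by move=> w; have /andP[r0 r1] := reg01 n (w, x); rewrite ger0_norm.
Qed.

Let r_cvg x : r n x @[n --> \oo] --> (1 : R).
Proof.
have mregx n : measurable_fun setT (fun w => reg n (w, x)).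
  by apply: (measurableT_comp (mreg n)); exact: pair2_measurable.
have [|||||_ _ h] := @dominated_convergence _ _ _ P setT measurableT
  (fun n w => (reg n (w, x))%:E) (cst 1%E) (cst 1%E).
- by move=> n; exact/measurable_EFinP.
- exact: measurable_cst.
- apply: filterS (q_neq0 x) => w qw _; apply: cvg_EFin; first by near=> n.
  by apply: cvg_regularized; rewrite lt_def qw q0.
- exact: finite_measure_integrable_cst.
- apply: aeW => w n _; have /andP[r0 r1] := reg01 n (w, x).
  by rewrite lee_fin ger0_norm.
move: h; rewrite [X in _ --> X](_ : _ = 1%E); last first.
  by rewrite integral_cst// mul1e; exact: probability_setT.
by move=> /fine_cvg.
Unshelve. all: end_near. Qed.

(** Here [f] is the singular edge integrand, [q] is |P|^2 and [g] the expected integrand. The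
    pathwise bound [fC] makes [f] integrable for the product measure, so [f] dominates its own
    regularizations on the left. On the right the mean of [q / (q + eps)] lies between 0 and 1 and
    tends to 1, and the bound [M] on [g] dominates. *)
Lemma regularized_fubini :
  (\int[P]_w \int[mu]_(x in `[a, b]) (f (w, x))%:E =
   \int[mu]_(x in `[a, b]) (g x)%:E)%E.
Proof.
have restrictE (h : measurableTypeR R -> R) :
    (\int[mu]_(x in `[a, b]) (h x)%:E = \int[mu]_x (h x * \1_E x)%:E)%E.
  rewrite [LHS]integral_mkcond; apply: eq_integral => x _.
  by rewrite patchE indicE -/E; case: ifP => _; rewrite ?mulr1 ?mulr0.
transitivity (\int[(P \x mu)%E]_z F z)%E.
  rewrite -integral12_prod_meas1//; apply: eq_integral => w _.
  by rewrite (restrictE (fun x => f (w, x))).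
have G_E n x : (\int[P]_w F_ n (w, x) = (g x * r n x * \1_E x)%:E)%E.
  have e0 : 0 < (n.+1%:R : R)^-1 by rewrite invr_gt0.
  rewrite /r -(fg x e0) EFinM /Rintegral fineK; last first.
    exact: integrable_fin_num (ifq x e0).
  by rewrite -integralZr//; exact: (ifq x e0).
have [|||||_ _ cvgF] := @dominated_convergence _ _ _ (P \x mu)%E setT measurableT
  F_ F (abse \o F).
- by [].
- by [].
- by apply: aeW => z _; exact: F_cvg.
- exact: integrable_abse iF.
- by apply: aeW => z n _; exact: F_le.
rewrite restrictE.
have [|||||_ _ cvgG] := @dominated_convergence _ _ _ mu setT measurableT
  (fun n x => (g x * r n x * \1_E x)%:E) (fun x => (g x * \1_E x)%:E)
  (fun x => (`|M| * \1_E x)%:E).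
- move=> n; under eq_fun do rewrite -G_E; exact: measurable_fubini_G (iF_ n).
- apply/measurable_EFinP; apply: measurable_funM => //; exact: measurable_indic.
- apply: aeW => x _; apply: cvg_EFin; first by near=> n.
  apply: cvgM; last exact: cvg_cst.
  rewrite -[X in _ --> X]mulr1; apply: cvgM; first exact: cvg_cst.
  exact: r_cvg.
- under eq_fun do rewrite EFinM; apply: integrableZl => //.
  exact: integrable_indic_itv.
- apply: aeW => x n _; rewrite lee_fin !normrM indicE.
  case: (boolP (x \in E)) => [xE|_]; last by rewrite normr0 !mulr0.
  rewrite normr1 !mulr1 -[leRHS]mulr1; apply: ler_pM => //.
    by apply: le_trans (ler_norm M); apply: gM; move: xE; rewrite inE.
  rewrite ger0_norm; last by apply: Rintegral_ge0 => w _; have /andP[] := reg01 n (w, x).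
  have -> : (1 : R) = \int[P]_w (cst 1 w).
    rewrite Rintegral_cst// mul1r.
    by rewrite -[LHS]/(fine 1%E); congr fine; apply/esym/probability_setT.
  apply: le_Rintegral => //.
    exact: finite_measure_integrable_cst.
  by move=> w _; have /andP[] := reg01 n (w, x).
apply: cvg_unique cvgF _ => //.
apply: cvg_trans cvgG; apply: near_eq_cvg; near=> n.
rewrite /= -integral21_prod_meas1//; apply: eq_integral => x _.
by rewrite /fubini_G G_E.
Unshelve. all: end_near. Qed.

End RegularizedFubini.

(** * Real and imaginary parts of powers, quotients and sums *)

Section ComplexPowers.
Local Open Scope complex_scope.
Context {R : realType}.
Implicit Types (x y : R) (k : nat).

Lemma Re_exprS x y k : Re ((x +i* y) ^+ k.+1) =
  x * Re ((x +i* y) ^+ k) - y * Im ((x +i* y) ^+ k).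
Proof. by rewrite exprS; case: (_ ^+ k). Qed.

Lemma Im_exprS x y k : Im ((x +i* y) ^+ k.+1) =
  x * Im ((x +i* y) ^+ k) + y * Re ((x +i* y) ^+ k).
Proof. by rewrite exprS; case: (_ ^+ k). Qed.

Lemma Re2Im2_expr x y k :
  Re ((x +i* y) ^+ k) ^+ 2 + Im ((x +i* y) ^+ k) ^+ 2 = (x ^+ 2 + y ^+ 2) ^+ k.
Proof.
elim: k => [|k IH]; first by rewrite !expr0 /=; ring.
by rewrite Re_exprS Im_exprS [RHS]exprS -IH; ring.
Qed.

Lemma measurable_Re_Im_expr d (E : measurableType d) (f g : E -> R) k :
  measurable_fun setT f -> measurable_fun setT g ->
  measurable_fun setT (fun e => Re ((f e +i* g e) ^+ k)) /\
  measurable_fun setT (fun e => Im ((f e +i* g e) ^+ k)).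
Proof.
move=> mf mg; elim: k => [|k [IHr IHi]].
  by split; under eq_fun do rewrite expr0; exact: measurable_cst.
split; under eq_fun do rewrite (Re_exprS, Im_exprS).
  by apply: measurable_funB; exact: measurable_funM.
by apply: measurable_funD; exact: measurable_funM.
Qed.

Lemma Re_div (a b c d : R) :
  Re ((a +i* b) / (c +i* d)) = (a * c + b * d) / (c ^+ 2 + d ^+ 2).
Proof. by rewrite /=; ring. Qed.

Lemma Im_div (a b c d : R) :
  Im ((a +i* b) / (c +i* d)) = (b * c - a * d) / (c ^+ 2 + d ^+ 2).
Proof. by rewrite /=; ring. Qed.

Lemma sum_complex (I : Type) (r : seq I) (f g : I -> R) :
  \sum_(i <- r) (f i +i* g i) = (\sum_(i <- r) f i) +i* (\sum_(i <- r) g i).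
Proof. by elim/big_rec3: _ => // i a b c _ ->. Qed.

Lemma sum_complexE (I : Type) (r : seq I) (f : I -> R[i]) :
  \sum_(i <- r) f i = (\sum_(i <- r) Re (f i)) +i* (\sum_(i <- r) Im (f i)).
Proof. by rewrite -sum_complex; apply: eq_bigr => i _; case: (f i). Qed.

End ComplexPowers.

Section LogDerivative.
Local Open Scope complex_scope.
Context {R : realType}.
Local Notation mu := (@lebesgue_measure R).
Implicit Types (p : {poly R[i]}) (x y : R).

(** On a horizontal edge dz = dx and on a vertical edge dz = i dy, so Im (p'/p dz) is [- hker] dx
    and [vker] dy. With these signs the counterclockwise circuit is top minus bottom plus right
    minus left. *)
Definition hker p x y : R := - Im (p^`().[x +i* y] / p.[x +i* y]).
Definition vker p x y : R := Re (p^`().[x +i* y] / p.[x +i* y]).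

Lemma kern_complex x y (a : R[i]) :
  (x +i* y - a)^-1 = kern (x - Re a) y (Im a) -i* kern (y - Im a) x (Re a).
Proof.
case: a => a b /=; rewrite /kern; congr (_ +i* _).
by rewrite [X in _ / X]addrC.
Qed.

Lemma hker_zeros p x y : x +i* y \notin zeros p ->
  hker p x y = \sum_(a <- zeros p) kern (y - Im a) x (Re a).
Proof.
move=> zp; rewrite /hker logderiv_zeros// sum_complexE /= -sumrN.
by apply: eq_bigr => a _; rewrite kern_complex opprK.
Qed.

Lemma vker_zeros p x y : x +i* y \notin zeros p ->
  vker p x y = \sum_(a <- zeros p) kern (x - Re a) y (Im a).
Proof.
move=> zp; rewrite /vker logderiv_zeros// sum_complexE /=.
by apply: eq_bigr => a _; rewrite kern_complex.
Qed.

(* An edge integral of a sum of kernels; [S] collects the poles on the edge. *)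
Lemma integral_sum_kern (I : Type) (r : seq I) (h c : I -> R) (S : seq R) (f : R -> R) x1 x2 :
  x1 <= x2 -> measurable_fun setT f ->
  (forall x, x \notin S -> f x = \sum_(i <- r) kern (h i) x (c i)) ->
  (\int[mu]_(x in `[x1, x2]) (f x)%:E =
    (\sum_(i <- r) (atan ((x2 - c i) / h i) - atan ((x1 - c i) / h i)))%:E)%E /\
  (\int[mu]_(x in `[x1, x2]) `|f x|%:E <= ((size r)%:R * pi)%:E)%E.
Proof.
move=> x12 mf fE.
have mk i : measurable_fun setT (fun x => kern (h i) x (c i)).
  exact: continuous_measurable_fun (@continuous_kern _ _ _).
have aeS : {ae mu, forall x : R, x \notin S}.
  have cS : countable [set` S] by exact/finite_set_countable.
  exists [set` S]; split.
  - exact: countable_measurable.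
  - exact: countable_lebesgue_measure0.
  - by move=> x /= /negP; rewrite negbK.
have aeSS (Q : R -> Prop) : (forall x, x \notin S -> Q x) -> {ae mu, forall x, Q x}.
  by case: aeS => N [mN N0 sN] SQ; exists N; split => // x nQ; apply: sN; apply: contra_not nQ; exact: SQ.
have ik i : mu.-integrable `[x1, x2] (EFin \o (fun x => kern (h i) x (c i))).
  apply: continuous_compact_integrable; first exact: segment_compact.
  exact/continuous_subspaceT/continuous_kern.
split.
  transitivity (\int[mu]_(x in `[x1, x2]) (\sum_(i <- r) (kern (h i) x (c i))%:E))%E.
    apply: ae_eq_integral => //.
    - apply: measurable_funTS; exact/measurable_EFinP.
    - apply: emeasurable_sum => i; apply: measurable_funTS; apply/measurable_EFinP.
      exact: mk.
    - by apply: aeSS => x xS _; rewrite fE// sumEFin.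
  rewrite integral_sum// -sumEFin; apply: eq_bigr => i _.
  exact: integral_kern.
apply: (@le_trans _ _ (\int[mu]_(x in `[x1, x2]) (\sum_(i <- r) `|kern (h i) x (c i)|%:E))%E).
  apply: ae_ge0_le_integral => //.
  - by apply: measurable_funTS; apply/measurable_EFinP; exact: measurableT_comp.
  - by move=> x _; apply: sume_ge0 => i _; rewrite lee_fin.
  - by apply: emeasurable_sum => i; apply: measurable_funTS; apply/measurable_EFinP; exact: (measurableT_comp _ (mk i)).
  - by apply: aeSS => x xS _; rewrite fE// sumEFin lee_fin ler_norm_sum.
rewrite ge0_integral_sum//; last first.
  by move=> i; apply: measurable_funTS; apply/measurable_EFinP; exact: (measurableT_comp _ (mk i)).
have -> : (size r)%:R * pi = \sum_(i <- r) (pi : R).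
  by rewrite big_const_seq count_predT iter_addr_0 mulr_natl.
rewrite -sumEFin.
apply: lee_sum => i _; exact: integral_abs_kern.
Qed.

End LogDerivative.

(** * Random polynomials with Gaussian coefficients *)

Section GaussianPolynomial.
Local Open Scope complex_scope.
Context d (T : measurableType d) (R : realType) (P : probability T R).
Local Notation mu := (@lebesgue_measure R).
Variables (alpha beta : nat -> {RV P >-> R}) (s : nat -> R) (n : nat).
Hypothesis hgauss : iid_standard_gaussian alpha beta.
Hypothesis s0 : s 0%N != 0.

Let X (i : nat + nat) : {RV P >-> R} :=
  match i with inl k => alpha k | inr k => beta k end.

Let indX : mutually_independent X. Proof. by case: hgauss. Qed.
Let gaussX i : standard_gaussian (X i). Proof. by case: hgauss => _; exact. Qed.

Definition indices : {fset nat + nat} :=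
  [fset i in [seq inl k | k <- iota 0 n.+1] ++ [seq inr k | k <- iota 0 n.+1]]%fset.

Lemma sum_indices (F : nat + nat -> R) :
  \sum_(i <- indices) F i = \sum_(k < n.+1) (F (inl (k : nat)) + F (inr (k : nat))).
Proof.
rewrite (perm_big ([seq inl k | k <- iota 0 n.+1] ++ [seq inr k | k <- iota 0 n.+1])).
  rewrite big_cat !big_map big_split.
  by rewrite -[iota 0 n.+1]/(index_iota 0 n.+1) !big_mkord.
apply: uniq_perm.
- exact: fset_uniq.
- rewrite cat_uniq !(map_inj_uniq, iota_uniq) ?andbT ?andTb; [|by move=> ? ? []..].
  by apply/hasPn => _ /mapP[k _ ->]; apply/negP => /mapP[].
- by move=> i; rewrite in_fset.
Qed.

(** The real and imaginary parts of the product of alpha + i beta and a + i b are a alpha - b beta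
    and b alpha + a beta. For every [c] the two coefficient vectors are orthogonal and of equal
    norm, as [gaussian_ratio] asks. *)
Definition ru (c : nat -> R[i]) (i : nat + nat) : R :=
  match i with inl k => Re (c k) | inr k => - Im (c k) end.
Definition rv (c : nat -> R[i]) (i : nat + nat) : R :=
  match i with inl k => Im (c k) | inr k => Re (c k) end.

Definition cform (c : nat -> R[i]) (w : T) : R[i] :=
  \sum_(k < n.+1) (alpha k w +i* beta k w) * c k.

Lemma Re_cform c w : Re (cform c w) = lin_form X indices (ru c) w.
Proof.
rewrite /cform sum_complexE/= /lin_form sum_indices; apply: eq_bigr => k _.
by rewrite /X /=; case: (c k) => a b /=; ring.
Qed.

Lemma Im_cform c w : Im (cform c w) = lin_form X indices (rv c) w.
Proof.
rewrite /cform sum_complexE/= /lin_form sum_indices; apply: eq_bigr => k _.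
by rewrite /X /=; case: (c k) => a b /=; ring.
Qed.

Definition gpoly (w : T) : {poly R[i]} :=
  \poly_(k < n.+1) ((alpha k w +i* beta k w) * (s k)%:C).

Definition zcoef (z : R[i]) k : R[i] := (s k)%:C * z ^+ k.
Definition zdcoef (z : R[i]) k : R[i] := (s k)%:C * (z ^+ k.-1 *+ k).

Lemma horner_gpoly w z : (gpoly w).[z] = cform (zcoef z) w.
Proof. by rewrite horner_poly; apply: eq_bigr => k _; rewrite mulrA. Qed.

Lemma horner_deriv_gpoly w z : (gpoly w)^`().[z] = cform (zdcoef z) w.
Proof.
rewrite /gpoly poly_def raddf_sum horner_sum; apply: eq_bigr => k _ /=.
by rewrite derivZ derivXn hornerZ hornerMn hornerXn mulrA.
Qed.

Definition Kpoly : {poly R} := \poly_(k < n.+1) (s k ^+ 2).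

Definition Kratio (t : R) : R := Kpoly^`().[t] / Kpoly.[t].

Lemma Kpoly_gt0 t : 0 <= t -> 0 < Kpoly.[t].
Proof.
move=> t0; rewrite horner_poly big_ord_recl/= expr0 mulr1.
rewrite ltr_pwDl ?exprn_even_gt0//; apply: sumr_ge0 => k _.
by rewrite mulr_ge0 ?sqr_ge0 ?exprn_ge0.
Qed.

Lemma horner_deriv_Kpoly t :
  Kpoly^`().[t] = \sum_(k < n.+1) s k ^+ 2 * (t ^+ k.-1 *+ k).
Proof.
rewrite /Kpoly poly_def raddf_sum horner_sum; apply: eq_bigr => k _ /=.
by rewrite derivZ derivXn hornerZ hornerMn hornerXn.
Qed.

Let Re_realM (c : R) (w : R[i]) : Re (c%:C * w) = c * Re w.
Proof. by case: w => p q /=; ring. Qed.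

Let Im_realM (c : R) (w : R[i]) : Im (c%:C * w) = c * Im w.
Proof. by case: w => p q /=; ring. Qed.

Section dots.
Variables x y : R.
Let z := x +i* y.
Let t := x ^+ 2 + y ^+ 2.
Local Notation u := (ru (zcoef z)).
Local Notation v := (rv (zcoef z)).
Local Notation a := (ru (zdcoef z)).
Local Notation b := (rv (zdcoef z)).

Lemma dot_uv : dot indices u v = 0.
Proof.
rewrite /dot sum_indices big1// => k _ /=; ring.
Qed.

Lemma dot_uu : dot indices u u = Kpoly.[t].
Proof.
rewrite /dot sum_indices horner_poly; apply: eq_bigr => k _ /=.
by rewrite /t -Re2Im2_expr -/z /zcoef /=; case: (z ^+ k) => p q /=; ring.
Qed.

Lemma dot_vv : dot indices v v = dot indices u u.
Proof.
by rewrite /dot !sum_indices; apply: eq_bigr => k _ /=; ring.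
Qed.

Lemma dot_bv : dot indices b v = dot indices a u.
Proof.
by rewrite /dot !sum_indices; apply: eq_bigr => k _ /=; ring.
Qed.

Lemma dot_bu : dot indices b u = - dot indices a v.
Proof.
by rewrite /dot !sum_indices -sumrN; apply: eq_bigr => k _ /=; ring.
Qed.

Let zdcoefS k : zdcoef z k.+1 = (s k.+1 * k.+1%:R)%:C * z ^+ k.
Proof. by rewrite /zdcoef rmorphM/= rmorph_nat -mulrA mulr_natl. Qed.

(** [dot a u] and [- dot a v] are the real and imaginary parts of the sum of s_k^2 k z^(k-1)
    conj(z)^k, which is conj(z) K'(|z|^2). *)
Lemma dot_au : dot indices a u = x * Kpoly^`().[t].
Proof.
rewrite /dot sum_indices horner_deriv_Kpoly mulr_sumr; apply: eq_bigr => -[[|k] kn] _ /=.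
  by rewrite mulr0n; ring.
rewrite zdcoefS /zcoef /z !Re_realM !Im_realM !Re_exprS !Im_exprS -/z /t -mulr_natr -Re2Im2_expr -/z.
by case: (z ^+ k) => p q /=; ring.
Qed.

Lemma dot_av : dot indices a v = y * Kpoly^`().[t].
Proof.
rewrite /dot sum_indices horner_deriv_Kpoly mulr_sumr; apply: eq_bigr => -[[|k] kn] _ /=.
  by rewrite mulr0n; ring.
rewrite zdcoefS /zcoef /z !Re_realM !Im_realM !Re_exprS !Im_exprS -/z /t -mulr_natr -Re2Im2_expr -/z.
by case: (z ^+ k) => p q /=; ring.
Qed.

End dots.

Section edges.
Local Notation U z := (lin_form X indices (ru (zcoef z))).
Local Notation V z := (lin_form X indices (rv (zcoef z))).
Local Notation A z := (lin_form X indices (ru (zdcoef z))).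
Local Notation B z := (lin_form X indices (rv (zdcoef z))).

Let hornerE w z : (gpoly w).[z] = U z w +i* V z w.
Proof. by rewrite horner_gpoly -Re_cform -Im_cform; case: cform. Qed.

Let deriv_hornerE w z : (gpoly w)^`().[z] = A z w +i* B z w.
Proof. by rewrite horner_deriv_gpoly -Re_cform -Im_cform; case: cform. Qed.

Let q z w := U z w ^+ 2 + V z w ^+ 2.

Let q_ge0 z w : 0 <= q z w. Proof. by rewrite addr_ge0 ?sqr_ge0. Qed.

Let q_eq0 z w : q z w = 0 -> U z w = 0 /\ V z w = 0.
Proof.
by move=> /eqP; rewrite paddr_eq0 ?sqr_ge0// !sqrf_eq0 => /andP[/eqP ? /eqP].
Qed.

(** The coordinate [alpha 0] enters [U z] with coefficient [s 0] for every [z], the origin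
    included. *)
Let q_neq0 z : {ae P, forall w, q z w != 0}.
Proof.
have i0 : inl 0%N \in indices by rewrite in_fset.
have u0 : ru (zcoef z) (inl 0%N) != 0 by rewrite -[ru _ _]/(Re ((s 0%N)%:C * 1)) mulr1.
have := lin_form_neq0 indX gaussX i0 u0; apply: filterS => w Uw.
by apply: contra_neq Uw => /q_eq0[].
Qed.

Let hkerE w x y : hker (gpoly w) x y =
  (A (x +i* y) w * V (x +i* y) w - B (x +i* y) w * U (x +i* y) w) / q (x +i* y) w.
Proof.
rewrite /hker deriv_hornerE hornerE Im_div -mulNr opprB.
by congr (_ / _); rewrite [A _ _ * _]mulrC; ring.
Qed.

Let vkerE w x y : vker (gpoly w) x y =
  (A (x +i* y) w * U (x +i* y) w + B (x +i* y) w * V (x +i* y) w) / q (x +i* y) w.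
Proof. by rewrite /vker deriv_hornerE hornerE Re_div. Qed.

Let regularize (a b e : R) : 0 < e -> 0 <= b -> (b = 0 -> a = 0) ->
  a / b * (b / (b + e)) = a / (b + e).
Proof.
move=> e0 b0 ba; have [b00|bn] := eqVneq b 0; first by rewrite (ba b00) !mul0r.
by rewrite mulrA divfK.
Qed.

Let mform (c : measurableTypeR R -> nat -> R[i]) :
  (forall k, measurable_fun setT (fun r => Re (c r k))) ->
  (forall k, measurable_fun setT (fun r => Im (c r k))) ->
  measurable_fun setT (fun z : T * measurableTypeR R => lin_form X indices (ru (c z.2)) z.1) /\
  measurable_fun setT (fun z : T * measurableTypeR R => lin_form X indices (rv (c z.2)) z.1).
Proof.
move=> mRe mIm.
have mX i : measurable_fun setT (fun z : T * measurableTypeR R => X i z.1).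
  by apply: measurableT_comp.
have mc (f : measurableTypeR R -> R) : measurable_fun setT f ->
    measurable_fun setT (fun z : T * measurableTypeR R => f z.2).
  by move=> mf; apply: (measurableT_comp mf).
have mru i : measurable_fun setT (fun r => ru (c r) i).
  by case: i => k; [exact: mRe|apply: measurableT_comp => //; exact: mIm].
have mrv i : measurable_fun setT (fun r => rv (c r) i).
  by case: i => k; [exact: mIm|exact: mRe].
split; apply: measurable_sum => i; apply: measurable_funM => //.
  exact: (mc _ (mru i)).
exact: (mc _ (mrv i)).
Qed.

Variables (xi eta : measurableTypeR R -> R).
Hypotheses (mxi : measurable_fun setT xi) (meta : measurable_fun setT eta).
Let z r := xi r +i* eta r.

Let mpow k := measurable_Re_Im_expr k mxi meta.

Let mUV : measurable_fun setT (fun t : T * measurableTypeR R => U (z t.2) t.1) /\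
  measurable_fun setT (fun t : T * measurableTypeR R => V (z t.2) t.1).
Proof.
apply: (mform (c := fun r => zcoef (z r))) => k.
  under eq_fun do rewrite Re_realM; apply: measurable_funM => //; exact: (mpow k).1.
by under eq_fun do rewrite Im_realM; apply: measurable_funM => //; exact: (mpow k).2.
Qed.

Let mAB : measurable_fun setT (fun t : T * measurableTypeR R => A (z t.2) t.1) /\
  measurable_fun setT (fun t : T * measurableTypeR R => B (z t.2) t.1).
Proof.
have zdcoefE r k : zdcoef (z r) k = (s k * k%:R)%:C * z r ^+ k.-1.
  by rewrite /zdcoef rmorphM/= rmorph_nat -mulrA mulr_natl.
apply: (mform (c := fun r => zdcoef (z r))) => k.
  under eq_fun do rewrite zdcoefE Re_realM; apply: measurable_funM => //; exact: (mpow _).1.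
by under eq_fun do rewrite zdcoefE Im_realM; apply: measurable_funM => //; exact: (mpow _).2.
Qed.

Let mq : measurable_fun setT (fun t : T * measurableTypeR R => q (z t.2) t.1).
Proof. by case: mUV => mU mV; apply: measurable_funD; exact: measurable_funX. Qed.

Lemma measurable_hker : measurable_fun setT
  (fun t : T * measurableTypeR R => hker (gpoly t.1) (xi t.2) (eta t.2)).
Proof.
under eq_fun do rewrite hkerE; case: mUV => mU mV; case: mAB => mA mB.
apply: measurable_funM; last exact: measurable_funV.
by apply: measurable_funB; exact: measurable_funM.
Qed.

Lemma measurable_vker : measurable_fun setT
  (fun t : T * measurableTypeR R => vker (gpoly t.1) (xi t.2) (eta t.2)).
Proof.
under eq_fun do rewrite vkerE; case: mUV => mU mV; case: mAB => mA mB.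
apply: measurable_funM; last exact: measurable_funV.
by apply: measurable_funD; exact: measurable_funM.
Qed.

(** Common form of the two kinds of edge. The deterministic integrand [g] is the quotient of
    [dot u' u] by [dot u u] = K(|z|^2) > 0; being continuous, it is bounded on the edge. *)
Let edge_core (f : T * measurableTypeR R -> R) (u' v' : R -> nat + nat -> R)
    (g : R -> R) (a b C : R) :
  a <= b -> continuous g -> measurable_fun setT f ->
  (forall r w, f (w, r) = (lin_form X indices (u' r) w * U (z r) w +
    lin_form X indices (v' r) w * V (z r) w) / q (z r) w) ->
  (forall r, dot indices (v' r) (rv (zcoef (z r))) = dot indices (u' r) (ru (zcoef (z r)))) ->
  (forall r, dot indices (v' r) (ru (zcoef (z r))) = - dot indices (u' r) (rv (zcoef (z r)))) ->
  (forall r, dot indices (u' r) (ru (zcoef (z r))) =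
    g r * dot indices (ru (zcoef (z r))) (ru (zcoef (z r)))) ->
  (forall w, (\int[mu]_(r in `[a, b]) `|f (w, r)|%:E <= C%:E)%E) ->
  (\int[P]_w \int[mu]_(r in `[a, b]) (f (w, r))%:E =
   \int[mu]_(r in `[a, b]) (g r)%:E)%E.
Proof.
move=> ab cg mf fE v'v v'u u'u fC.
have [M gM] : exists M, forall x, x \in `[a, b] -> `|g x| <= M.
  have cn : {within `[a, b], continuous (fun x => `|g x|)}.
    apply: continuous_subspaceT => x; apply: (continuous_comp (f := g) (g := Num.norm)).
      exact: cg.
    exact: norm_continuous.
  by have [c _ h] := EVT_max ab cn; exists `|g c|.
have num0 r w : q (z r) w = 0 -> lin_form X indices (u' r) w * U (z r) w +
    lin_form X indices (v' r) w * V (z r) w = 0.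
  by move=> /q_eq0[-> ->]; rewrite !mulr0 addr0.
have regE (e : R) r w : 0 < e -> f (w, r) * (q (z r) w / (q (z r) w + e)) =
    (lin_form X indices (u' r) w * U (z r) w + lin_form X indices (v' r) w * V (z r) w) / (q (z r) w + e).
  by move=> e0; rewrite fE regularize//; exact: num0.
apply: (@regularized_fubini _ _ _ P f (fun t => q (z t.2) t.1) g a b C M) => //.
- exact: continuous_measurable_fun.
- by move=> [w r] /= qz; rewrite fE num0// mul0r.
- by move=> r; exact: (q_neq0 (z r)).
- move=> e r e0 /=; under eq_Rintegral do rewrite regE//.
  have := gaussian_ratio indX gaussX e0 (dot_uv (xi r) (eta r)) (dot_vv (xi r) (eta r)) (v'v r) (v'u r).
  have N0 : dot indices (ru (zcoef (z r))) (ru (zcoef (z r))) != 0.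
    by rewrite dot_uu gt_eqF// Kpoly_gt0// addr_ge0 ?sqr_ge0.
  by rewrite u'u => h; apply: (mulfI N0); rewrite h mulrAC mulrC.
- move=> e r e0 /=; under eq_fun do rewrite regE//.
  exact: integrable_ratio.
Qed.

Let lin_formN (J : {fset nat + nat}) (u : nat + nat -> R) w :
  lin_form X J (fun i => - u i) w = - lin_form X J u w.
Proof. by rewrite /lin_form -sumrN; apply: eq_bigr => i _; rewrite mulNr. Qed.

Let dotN (J : {fset nat + nat}) (u v : nat + nat -> R) :
  dot J (fun i => - u i) v = - dot J u v.
Proof. by rewrite /dot -sumrN; apply: eq_bigr => i _; rewrite mulNr. Qed.

(** [hker] is Re (i P'/P), so the pair (A, B) of the derivative is replaced by (-B, A). *)
Lemma expected_hker (a b : R) : a <= b ->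
  continuous (fun r => eta r * Kratio (xi r ^+ 2 + eta r ^+ 2)) ->
  (forall w, (\int[mu]_(r in `[a, b]) `|hker (gpoly w) (xi r) (eta r)|%:E <= (n%:R * pi)%:E)%E) ->
  (\int[P]_w \int[mu]_(r in `[a, b]) (hker (gpoly w) (xi r) (eta r))%:E =
   \int[mu]_(r in `[a, b]) (eta r * Kratio (xi r ^+ 2 + eta r ^+ 2))%:E)%E.
Proof.
move=> ab cg fC.
apply: (edge_core (u' := fun r i => - rv (zdcoef (z r)) i)
  (v' := fun r => ru (zdcoef (z r))) ab cg measurable_hker _ _ _ _ fC).
- by move=> r w; rewrite hkerE lin_formN -/(z r); congr (_ / _); rewrite addrC mulNr.
- by move=> r; rewrite dotN dot_bu opprK.
- by move=> r; rewrite dotN dot_bv opprK.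
- move=> r; rewrite dotN dot_bu opprK dot_av dot_uu /Kratio -!mulrA mulVf ?mulr1//.
  by rewrite gt_eqF// Kpoly_gt0// addr_ge0 ?sqr_ge0.
Qed.

Lemma expected_vker (a b : R) : a <= b ->
  continuous (fun r => xi r * Kratio (xi r ^+ 2 + eta r ^+ 2)) ->
  (forall w, (\int[mu]_(r in `[a, b]) `|vker (gpoly w) (xi r) (eta r)|%:E <= (n%:R * pi)%:E)%E) ->
  (\int[P]_w \int[mu]_(r in `[a, b]) (vker (gpoly w) (xi r) (eta r))%:E =
   \int[mu]_(r in `[a, b]) (xi r * Kratio (xi r ^+ 2 + eta r ^+ 2))%:E)%E.
Proof.
move=> ab cg fC.
apply: (edge_core (u' := fun r => ru (zdcoef (z r)))
  (v' := fun r => rv (zdcoef (z r))) ab cg measurable_vker _ _ _ _ fC).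
- by move=> r w; rewrite vkerE.
- by move=> r; rewrite dot_bv.
- by move=> r; rewrite dot_bu.
- move=> r; rewrite dot_au dot_uu /Kratio -!mulrA mulVf ?mulr1//.
  by rewrite gt_eqF// Kpoly_gt0// addr_ge0 ?sqr_ge0.
Qed.

End edges.

Lemma size_zeros_gpoly w : (size (zeros (gpoly w)) <= n)%N.
Proof.
have : (size (gpoly w) <= n.+1)%N by exact: size_poly.
move=> sn; apply: leq_trans (size_zeros _) _.
by move: sn; case: (size (gpoly w)).
Qed.

Lemma continuous_Kratio (f g : R -> R) : continuous f -> continuous g ->
  continuous (fun r => Kratio (f r ^+ 2 + g r ^+ 2)).
Proof.
move=> cf cg r.
have ct : (fun r => f r ^+ 2 + g r ^+ 2) @ r --> f r ^+ 2 + g r ^+ 2.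
  by apply: cvgD; rewrite !expr2; apply: cvgM; first [exact: cf|exact: cg].
have K0 : Kpoly.[f r ^+ 2 + g r ^+ 2] != 0.
  by rewrite gt_eqF// Kpoly_gt0// addr_ge0 ?sqr_ge0.
have ch (p : {poly R}) : p.[f x ^+ 2 + g x ^+ 2] @[x --> r] --> p.[f r ^+ 2 + g r ^+ 2].
  by apply: (continuous_cvg _ _ ct); exact: continuous_horner.
by apply: cvgM; [exact: ch|apply: cvgV => //; exact: ch].
Qed.

Let measurable_section (f : T * measurableTypeR R -> R) w :
  measurable_fun setT f -> measurable_fun setT (fun r => f (w, r)).
Proof. by move=> mf; apply: (measurableT_comp mf); exact: pair1_measurable. Qed.

Let size_pi w : ((size (zeros (gpoly w)))%:R * pi <= n%:R * pi :> R)%R.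
Proof. by rewrite ler_wpM2r ?pi_ge0// ler_nat size_zeros_gpoly. Qed.

Lemma integral_hker w (a b c : R) : a <= b ->
  (\int[mu]_(x in `[a, b]) (hker (gpoly w) x c)%:E =
    (\sum_(i <- zeros (gpoly w))
      (atan ((b - Re i) / (c - Im i)) - atan ((a - Re i) / (c - Im i))))%:E)%E /\
  (\int[mu]_(x in `[a, b]) `|hker (gpoly w) x c|%:E <= (n%:R * pi)%:E)%E.
Proof.
move=> ab.
have mh : measurable_fun setT (fun x : R => hker (gpoly w) x c).
  exact: (measurable_section w (measurable_hker (xi := id) (eta := cst c) _ _)).
have [|H1 H2] := @integral_sum_kern R _ (zeros (gpoly w)) (fun i => c - Im i) (@Re R)
  [seq Re i | i <- zeros (gpoly w)] _ a b ab mh.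
  move=> x xS; apply: hker_zeros; apply: contra xS => xz.
  by apply/mapP; exists (x +i* c).
by split => //; apply: le_trans H2 _; rewrite lee_fin.
Qed.

Lemma integral_vker w (a b c : R) : a <= b ->
  (\int[mu]_(y in `[a, b]) (vker (gpoly w) c y)%:E =
    (\sum_(i <- zeros (gpoly w))
      (atan ((b - Im i) / (c - Re i)) - atan ((a - Im i) / (c - Re i))))%:E)%E /\
  (\int[mu]_(y in `[a, b]) `|vker (gpoly w) c y|%:E <= (n%:R * pi)%:E)%E.
Proof.
move=> ab.
have mh : measurable_fun setT (fun y : R => vker (gpoly w) c y).
  exact: (measurable_section w (measurable_vker (xi := cst c) (eta := id) _ _)).
have [|H1 H2] := @integral_sum_kern R _ (zeros (gpoly w)) (fun i => c - Re i) (@Im R)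
  [seq Im i | i <- zeros (gpoly w)] _ a b ab mh.
  move=> y yS; apply: vker_zeros; apply: contra yS => yz.
  by apply/mapP; exists (c +i* y).
by split => //; apply: le_trans H2 _; rewrite lee_fin.
Qed.

Lemma expected_hedge (a b c : R) : a <= b ->
  (\int[P]_w \int[mu]_(x in `[a, b]) (hker (gpoly w) x c)%:E =
   \int[mu]_(x in `[a, b]) (c * Kratio (x ^+ 2 + c ^+ 2))%:E)%E.
Proof.
move=> ab; apply: (expected_hker (xi := id) (eta := cst c)) => //.
  move=> r; apply: cvgM; first exact: cvg_cst.
  by apply: (@continuous_Kratio id (cst c)); [move=> ?; exact: cvg_id|exact: cst_continuous].
by move=> w; exact: (integral_hker w c ab).2.
Qed.

Lemma expected_vedge (a b c : R) : a <= b ->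
  (\int[P]_w \int[mu]_(y in `[a, b]) (vker (gpoly w) c y)%:E =
   \int[mu]_(y in `[a, b]) (c * Kratio (c ^+ 2 + y ^+ 2))%:E)%E.
Proof.
move=> ab; apply: (expected_vker (xi := cst c) (eta := id)) => //.
  move=> r; apply: cvgM; first exact: cvg_cst.
  by apply: (@continuous_Kratio (cst c) id); [exact: cst_continuous|move=> ?; exact: cvg_id].
by move=> w; exact: (integral_vker w c ab).2.
Qed.

End GaussianPolynomial.

(** * Green's formula on rectangles *)

Section Rectangles.
Context {R : realType}.
Local Notation mu := (@lebesgue_measure R).
Local Notation plane := (measurableTypeR R * measurableTypeR R)%type.

Definition rect (x1 x2 y1 y2 : R) : set plane := `[x1, x2]%classic `*` `[y1, y2]%classic.

Lemma measurable_rect x1 x2 y1 y2 : measurable (rect x1 x2 y1 y2).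
Proof. by apply: measurableX; exact: measurable_itv. Qed.

(** Both orders of integration are provided, since each half of Green's formula integrates first in
    the variable of its partial derivative. *)
Lemma rect_fubini (phi : plane -> R) (M x1 x2 y1 y2 : R) :
  measurable_fun setT phi ->
  (forall u, rect x1 x2 y1 y2 u -> `|phi u| <= M) ->
  [/\ area.-integrable (rect x1 x2 y1 y2) (EFin \o phi),
   (\int[area]_(u in rect x1 x2 y1 y2) (phi u)%:E =
    \int[mu]_(x in `[x1, x2]) \int[mu]_(y in `[y1, y2]) (phi (x, y))%:E)%E &
   (\int[area]_(u in rect x1 x2 y1 y2) (phi u)%:E =
    \int[mu]_(y in `[y1, y2]) \int[mu]_(x in `[x1, x2]) (phi (x, y))%:E)%E].
Proof.
move=> mphi phiM.
have mD := measurable_rect x1 x2 y1 y2.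
have iphi : area.-integrable (rect x1 x2 y1 y2) (EFin \o phi).
  apply: measurable_bounded_integrable => //.
  - rewrite /area /= product_measure1E//; try exact: measurable_itv.
    rewrite ltey_eq fin_numM// ?[_ `[_, _]%classic]lebesgue_measure_itv//=.
      by case: ifP.
    by case: ifP.
  - exact: measurable_funTS.
  - exists M; split; first exact: num_real.
    by move=> y My u Du; apply: le_trans (ltW My); exact: phiM.
have iF : area.-integrable setT ((EFin \o phi) \_ (rect x1 x2 y1 y2)).
  by apply/(integrable_mkcond _ mD).
have FE x y : ((EFin \o phi) \_ (rect x1 x2 y1 y2)) (x, y) =
    (((fun x => (fun y => (phi (x, y))%:E) \_ `[y1, y2]%classic) \_ `[x1, x2]%classic) x y).
  by rewrite !patchE in_setX/=; case: (x \in _) => //=; rewrite ?patchE.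
split => //.
  rewrite integral_mkcond/= -integral12_prod_meas1//.
  rewrite [RHS]integral_mkcond; apply: eq_integral => x _.
  rewrite /fubini_F patchE; case: (boolP (x \in `[x1, x2]%classic)) => xX.
    rewrite [RHS]integral_mkcond; apply: eq_integral => y _.
    by rewrite FE patchE xX.
  by rewrite integral0_eq// => y _; rewrite FE patchE (negbTE xX).
rewrite integral_mkcond/= -integral21_prod_meas1//.
rewrite [RHS]integral_mkcond; apply: eq_integral => y _.
rewrite /fubini_G patchE; case: (boolP (y \in `[y1, y2]%classic)) => yY.
  rewrite [RHS]integral_mkcond; apply: eq_integral => x _.
  by rewrite FE !patchE; case: ifP => //; rewrite patchE yY.
rewrite integral0_eq// => x _; rewrite FE patchE; case: ifP => //.
by rewrite patchE (negbTE yY).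
Qed.

End Rectangles.

Section Green.
Context {R : realType}.
Local Notation mu := (@lebesgue_measure R).
Local Notation plane := (measurableTypeR R * measurableTypeR R)%type.
Variables (s : nat -> R) (n : nat).
Hypothesis s0 : s 0%N != 0.
Local Notation K := (Kpoly s n).
Local Notation k := (Kratio s n).

Lemma is_derive_horner (p : {poly R}) (t : R) : is_derive t 1 (horner p) p^`().[t].
Proof.
by apply: DeriveDef; [exact: derivable_horner|rewrite -derive1E -derivE].
Qed.

Definition dKratio (t : R) : R :=
  (K^`()^`().[t] * K.[t] - K^`().[t] ^+ 2) / K.[t] ^+ 2.

Lemma derive_Kratio (t : R) : 0 <= t -> is_derive t 1 k (dKratio t).
Proof.
move=> t0; have K0 : K.[t] != 0 by rewrite gt_eqF// Kpoly_gt0.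
have d1 := is_derive_horner K t; have d2 := is_derive_horner K^`() t.
rewrite (_ : k = (horner K^`()) * (fun x => (horner K x)^-1))//.
apply: is_derive_eq; rewrite /GRing.scale/= /dKratio -!/(_.[_]).
by field.
Qed.

(** At t = |z|^2 this is the Edelman-Kostlan density, the Laplacian of log K(|z|^2) divided by 4
    pi. *)
Definition density0 (t : R) : R := (k t + t * dKratio t) / pi.

Lemma derive_edge (c x : R) :
  is_derive x 1 (fun x => x * k (x ^+ 2 + c ^+ 2))
    (k (x ^+ 2 + c ^+ 2) + 2 * x ^+ 2 * dKratio (x ^+ 2 + c ^+ 2)).
Proof.
have t0 : 0 <= x ^+ 2 + c ^+ 2 by rewrite addr_ge0 ?sqr_ge0.
have dk := derive_Kratio t0.
have dt : is_derive x 1 (fun x : R => x ^+ 2 + c ^+ 2) (2 * x).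
  by apply: is_derive_eq; rewrite /GRing.scale/=; ring.
have dc := @is_derive1_comp _ k (fun x : R => x ^+ 2 + c ^+ 2) x _ _ dk dt.
rewrite (_ : (fun x => _) = id * (k \o (fun x : R => x ^+ 2 + c ^+ 2)))//.
by apply: is_derive_eq; rewrite /GRing.scale/=; ring.
Qed.

Let continuous_K (t : R) : 0 <= t -> {for t, continuous k}.
Proof.
move=> t0; have dk := derive_Kratio t0.
by apply: differentiable_continuous; apply/derivable1_diffP.
Qed.

Let continuous_dK (t : R) : 0 <= t -> {for t, continuous dKratio}.
Proof.
move=> t0; have K0 : K.[t] != 0 by rewrite gt_eqF// Kpoly_gt0.
have ch (p : {poly R}) : horner p x @[x --> t] --> p.[t] by exact: continuous_horner.
have csq (f : R -> R) (l : R) : f x @[x --> t] --> l -> f x ^+ 2 @[x --> t] --> l ^+ 2.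
  by move=> fl; exact: (cvgM fl fl).
apply: cvgM; last by apply: cvgV; [rewrite expf_neq0|exact: (csq _ _ (ch _))].
by apply: cvgB; [apply: cvgM; exact: ch|exact: (csq _ _ (ch _))].
Qed.

Let measurable_horner (p : {poly R}) : measurable_fun setT (horner p : R -> R).
Proof. by apply: continuous_measurable_fun; exact: continuous_horner. Qed.

Let measurable_k : measurable_fun setT (k : R -> R).
Proof.
apply: (@measurable_funM _ _ _ _ (horner K^`()) (fun x => (horner K x)^-1)) => //.
exact: (measurable_funV (measurable_horner _)).
Qed.

Let measurable_dK : measurable_fun setT (dKratio : R -> R).
Proof.
have mh2 (p : {poly R}) : measurable_fun setT (fun t : R => p.[t] ^+ 2).
  by apply: measurable_funX.
apply: measurable_funM; last exact: (measurable_funV (mh2 _)).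
by apply: measurable_funB => //; exact: measurable_funM.
Qed.

Let t2 (u : plane) : R := u.1 ^+ 2 + u.2 ^+ 2.

Let t2_ge0 u : 0 <= t2 u. Proof. by rewrite addr_ge0 ?sqr_ge0. Qed.

Let measurable_t2 : measurable_fun setT t2.
Proof.
apply: measurable_funD; apply: measurable_funX.
  exact: (@measurable_fst _ _ (measurableTypeR R) (measurableTypeR R)).
exact: (@measurable_snd _ _ (measurableTypeR R) (measurableTypeR R)).
Qed.

Lemma measurable_density0 : measurable_fun setT (density0 : R -> R).
Proof.
apply: measurable_funM => //; apply: measurable_funD => //; exact: measurable_funM.
Qed.

Lemma measurable_density0_plane :
  measurable_fun setT (fun u : plane => density0 (u.1 ^+ 2 + u.2 ^+ 2)).
Proof. exact: (measurableT_comp measurable_density0 measurable_t2). Qed.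

Lemma continuous_density0 (t : R) : 0 <= t -> {for t, continuous density0}.
Proof.
move=> t0; apply: cvgM; last exact: cvg_cst.
apply: cvgD; first exact: continuous_K.
by apply: cvgM; [exact: cvg_id|exact: continuous_dK].
Qed.

Let bounded_on (h : R -> R) (t : R) : 0 <= t ->
  (forall x, 0 <= x -> {for x, continuous h}) ->
  exists2 M, 0 <= M & forall x, 0 <= x <= t -> `|h x| <= M.
Proof.
move=> t0 ch.
have cn : {within `[0, t], continuous (fun x => `|h x|)}.
  apply: continuous_in_subspaceT => x; rewrite inE/= in_itv/= => /andP[x0 _].
  by apply: (continuous_comp (f := h) (g := Num.norm)); [exact: ch|exact: norm_continuous].
have [c _ hc] := EVT_max t0 cn; exists `|h c| => // x xt.
Qed.

Section rectangle.
Variables (x1 x2 y1 y2 : R).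
Hypotheses (x12 : x1 <= x2) (y12 : y1 <= y2).

Let t0 := x1 ^+ 2 + x2 ^+ 2 + (y1 ^+ 2 + y2 ^+ 2).

Let sqr_le a b (x : R) : a <= x <= b -> x ^+ 2 <= a ^+ 2 + b ^+ 2.
Proof.
move=> /andP[ax xb]; have := sqr_ge0 a; have := sqr_ge0 b => b0 a0.
have [x0|x0] := leP 0 x.
  have : x ^+ 2 <= b ^+ 2 by rewrite ler_sqr ?nnegrE//; apply: le_trans xb.
  lra.
have : (- x) ^+ 2 <= (- a) ^+ 2.
  by rewrite ler_sqr ?nnegrE; lra.
rewrite !sqrrN; lra.
Qed.

Let t2_le u : rect x1 x2 y1 y2 u -> u.1 ^+ 2 + u.2 ^+ 2 <= t0.
Proof. by case=> /=; rewrite !in_itv/= => /sqr_le u1 /sqr_le u2; exact: lerD. Qed.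

Let t0_ge0 : 0 <= t0.
Proof. by rewrite /t0 !addr_ge0 ?sqr_ge0. Qed.

Let phi1 (u : plane) := k (u.1 ^+ 2 + u.2 ^+ 2) + 2 * u.2 ^+ 2 * dKratio (u.1 ^+ 2 + u.2 ^+ 2).
Let phi2 (u : plane) := k (u.1 ^+ 2 + u.2 ^+ 2) + 2 * u.1 ^+ 2 * dKratio (u.1 ^+ 2 + u.2 ^+ 2).

Let mphi (f : plane -> R) : measurable_fun setT f -> measurable_fun setT
  (fun u : plane => k (u.1 ^+ 2 + u.2 ^+ 2) + 2 * f u ^+ 2 * dKratio (u.1 ^+ 2 + u.2 ^+ 2)).
Proof.
move=> mf; apply: measurable_funD; first exact: (measurableT_comp measurable_k measurable_t2).
apply: measurable_funM; last exact: (measurableT_comp measurable_dK measurable_t2).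
by apply: measurable_funM => //; exact: measurable_funX.
Qed.

Let phi_bounded : exists M, forall (f : plane -> R) u, rect x1 x2 y1 y2 u ->
  f u ^+ 2 <= u.1 ^+ 2 + u.2 ^+ 2 ->
  `|k (u.1 ^+ 2 + u.2 ^+ 2) + 2 * f u ^+ 2 * dKratio (u.1 ^+ 2 + u.2 ^+ 2)| <= M.
Proof.
have [M1 M10 h1] := bounded_on t0_ge0 continuous_K.
have [M2 M20 h2] := bounded_on t0_ge0 continuous_dK.
exists (M1 + 2 * t0 * M2) => f u ru fu; have tu := t2_le ru.
have t2u : 0 <= u.1 ^+ 2 + u.2 ^+ 2 <= t0 by rewrite tu addr_ge0 ?sqr_ge0.
apply: le_trans (ler_normD _ _) _; apply: lerD; first exact: h1.
rewrite normrM; apply: ler_pM => //; last exact: h2.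
have := le_trans fu tu; have := sqr_ge0 (f u) => f0 ft.
rewrite ger0_norm; [lra|by rewrite mulr_ge0].
Qed.

Let continuous_edge (c : R) : continuous (fun x : R => x * k (x ^+ 2 + c ^+ 2)).
Proof.
move=> x; have dx := derive_edge c x.
by apply: differentiable_continuous; apply/derivable1_diffP.
Qed.

Let continuous_dedge (c : R) : continuous (fun x : R =>
  k (x ^+ 2 + c ^+ 2) + 2 * x ^+ 2 * dKratio (x ^+ 2 + c ^+ 2)).
Proof.
move=> x; have tx : 0 <= x ^+ 2 + c ^+ 2 by rewrite addr_ge0 ?sqr_ge0.
have sq : (fun y : R => y ^+ 2) @ x --> x ^+ 2.
  exact: exprn_continuous.
have ct : (fun y : R => y ^+ 2 + c ^+ 2) @ x --> x ^+ 2 + c ^+ 2.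
  by apply: cvgD => //; exact: cvg_cst.
apply: cvgD; first by apply: (continuous_cvg _ _ ct); exact: continuous_K.
apply: cvgM; first by apply: cvgM => //; exact: cvg_cst.
by apply: (continuous_cvg _ _ ct); exact: continuous_dK.
Qed.

Let iedge (a b c : R) : mu.-integrable `[a, b]
  (EFin \o (fun x : R => c * k (x ^+ 2 + c ^+ 2))).
Proof.
apply: continuous_compact_integrable; first exact: segment_compact.
apply: continuous_subspaceT => x; apply: cvgM; first exact: cvg_cst.
by apply: (@continuous_Kratio _ s n s0 id (cst c)); [move=> ?; exact: cvg_id|exact: cst_continuous].
Qed.

Let iedge' (a b c : R) : mu.-integrable `[a, b]
  (EFin \o (fun y : R => c * k (c ^+ 2 + y ^+ 2))).
Proof.
apply: eq_integrable (iedge a b c); first exact: measurable_itv.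
by move=> y _ /=; rewrite addrC.
Qed.

(** The field (x, y) k(x^2 + y^2) has partial derivatives k + 2 x^2 k' and k + 2 y^2 k', whose sum
    is 2 (k + t k'), that is 2 pi times [density0]. The fundamental theorem of calculus integrates
    each along its own variable. *)
Lemma green_rect :
  [/\ area.-integrable (rect x1 x2 y1 y2) (fun u => (density0 (u.1 ^+ 2 + u.2 ^+ 2))%:E) &
  ((2 * pi)%:E * \int[area]_(u in rect x1 x2 y1 y2) (density0 (u.1 ^+ 2 + u.2 ^+ 2))%:E =
  (\int[mu]_(x in `[x1, x2]) (y2 * k (x ^+ 2 + y2 ^+ 2))%:E -
   \int[mu]_(x in `[x1, x2]) (y1 * k (x ^+ 2 + y1 ^+ 2))%:E) +
  (\int[mu]_(y in `[y1, y2]) (x2 * k (x2 ^+ 2 + y ^+ 2))%:E -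
   \int[mu]_(y in `[y1, y2]) (x1 * k (x1 ^+ 2 + y ^+ 2))%:E))%E].
Proof.
have [M phiM] := phi_bounded.
have lerDr' (u : plane) : u.2 ^+ 2 <= u.1 ^+ 2 + u.2 ^+ 2 by rewrite lerDr sqr_ge0.
have lerDl' (u : plane) : u.1 ^+ 2 <= u.1 ^+ 2 + u.2 ^+ 2 by rewrite lerDl sqr_ge0.
have [i1 e1 _] := @rect_fubini _ phi1 M x1 x2 y1 y2 (mphi (@measurable_snd _ _ _ _))
  (fun u ru => phiM snd u ru (lerDr' u)).
have [i2 _ e2] := @rect_fubini _ phi2 M x1 x2 y1 y2 (mphi (@measurable_fst _ _ _ _))
  (fun u ru => phiM fst u ru (lerDl' u)).
have mr := measurable_rect x1 x2 y1 y2.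
have pi0 : (pi : R) != 0 by rewrite gt_eqF ?pi_gt0.
have phiE u : (2 * pi) * density0 (u.1 ^+ 2 + u.2 ^+ 2) = phi1 u + phi2 u.
  rewrite /density0 /phi1 /phi2 mulrA -[2 * pi * _]mulrA [pi * _]mulrC mulrA mulfK//.
  by move: (k _) (dKratio _) => a b; ring.
have id0 : area.-integrable (rect x1 x2 y1 y2) (fun u => (density0 (u.1 ^+ 2 + u.2 ^+ 2))%:E).
  have := integrableZl mr (2 * pi)^-1 (integrableD mr i1 i2).
  apply: eq_integrable => // u _.
  by rewrite -[LHS]/(((2 * pi)^-1 * (phi1 u + phi2 u))%:E) -phiE mulKf// mulf_neq0.
split => //; rewrite -integralZl//.
transitivity (\int[area]_(u in rect x1 x2 y1 y2) ((phi1 u)%:E + (phi2 u)%:E))%E.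
  by apply: eq_integral => u _; rewrite -EFinM -EFinD phiE.
rewrite integralD//; congr (_ + _)%E.
  rewrite e1.
  transitivity (\int[mu]_(x in `[x1, x2]) ((y2 * k (x ^+ 2 + y2 ^+ 2))%:E - (y1 * k (x ^+ 2 + y1 ^+ 2))%:E))%E.
    apply: eq_integral => x _; rewrite -EFinB.
    have := @integral_itv_derive R _ _ y1 y2 y12 (@continuous_dedge x) (@derive_edge x).
    rewrite ![_ + x ^+ 2]addrC => <-; apply: eq_integral => y _.
    by rewrite /phi1/= [x ^+ 2 + _]addrC.
  by rewrite integralB_EFin//; exact: iedge.
rewrite e2.
transitivity (\int[mu]_(y in `[y1, y2]) ((x2 * k (x2 ^+ 2 + y ^+ 2))%:E - (x1 * k (x1 ^+ 2 + y ^+ 2))%:E))%E.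
  apply: eq_integral => y _; rewrite -EFinB.
  exact: (@integral_itv_derive R _ _ x1 x2 x12 (@continuous_dedge y) (@derive_edge y)).
rewrite integralB_EFin//.
Qed.

End rectangle.

End Green.

(** * Expected number of zeros in a rectangle *)

(** Tonelli gives measurability for nonnegative integrands; a signed one is split into its positive
    and negative parts. *)
Lemma measurable_integral_section d (T : measurableType d) (R : realType)
    (f : T * measurableTypeR R -> R) (D : set (measurableTypeR R)) :
  measurable D -> measurable_fun setT f ->
  measurable_fun setT
    (fun w => \int[@lebesgue_measure R]_(x in D) (f (w, x))%:E)%E.
Proof.
move=> mD mf.
have key (g : T * measurableTypeR R -> \bar R) : measurable_fun setT g ->
    (forall z, (0 <= g z)%E) -> measurable_fun setT
    (fun w => \int[@lebesgue_measure R]_(x in D) (g (w, x)))%E.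
  move=> mg g0.
  have mG : measurable_fun setT (g \_ (setT `*` D)).
    by apply/(measurable_restrictT _ (measurableX measurableT mD)); exact: measurable_funTS.
  have := @measurable_fun_fubini_tonelli_F _ _ _ _ R (@lebesgue_measure R) _ mG.
  move=> /(_ (fun z => _)) h.
  have -> : (fun w => \int[@lebesgue_measure R]_(x in D) (g (w, x)))%E =
     fubini_F (@lebesgue_measure R) (g \_ (setT `*` D)).
    apply/funext => w; rewrite /fubini_F [LHS]integral_mkcond.
    apply: eq_integral => x _.
    by rewrite !patchE in_setX in_setT.
  by apply: h => z; rewrite patchE; case: ifP.
have mE : measurable_fun setT (EFin \o f) by exact/measurable_EFinP.
under eq_fun do rewrite integralE.
apply: emeasurable_funB.
  rewrite (_ : (fun _ => _) = fun w =>
      (\int[@lebesgue_measure R]_(x in D) ((EFin \o f)^\+ (w, x)))%E); last first.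
    by apply/funext => w; apply: eq_integral => x _; rewrite !funeposE.
  by apply: key => [|z]; [exact: measurable_funepos|exact: funepos_ge0].
rewrite (_ : (fun _ => _) = fun w =>
    (\int[@lebesgue_measure R]_(x in D) ((EFin \o f)^\- (w, x)))%E); last first.
  by apply/funext => w; apply: eq_integral => x _; rewrite !funenegE.
by apply: key => [|z]; [exact: measurable_funeneg|exact: funeneg_ge0].
Qed.

Section Winding.
Context d (T : measurableType d) (R : realType) (P : probability T R).
Local Notation mu := (@lebesgue_measure R).
Variables (alpha beta : nat -> {RV P >-> R}) (s : nat -> R) (n : nat).
Hypothesis hgauss : iid_standard_gaussian alpha beta.
Hypothesis s0 : s 0%N != 0.
Local Notation poly := (gpoly alpha beta s n).
Local Notation K := (Kratio s n).

(** What the boundary integral really counts: for a nondegenerate rectangle, interior zeros with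
    weight 1, those on a side with 1/2 and those at a corner with 1/4. *)
Definition weight (p : {poly R[i]}) (x1 x2 y1 y2 : R) : R :=
  \sum_(i <- zeros p) halfsg x1 x2 (Re i) * halfsg y1 y2 (Im i).

Variables (x1 x2 y1 y2 : R).
Hypotheses (x12 : x1 <= x2) (y12 : y1 <= y2).

Local Notation H c w := (\int[mu]_(x in `[x1, x2]) (hker (poly w) x c)%:E)%E.
Local Notation V c w := (\int[mu]_(y in `[y1, y2]) (vker (poly w) c y)%:E)%E.

(** The argument principle, obtained zero by zero from the explicit [atan] values of the edge
    integrals. *)
Lemma weight_edges w : ((2 * pi)%:E * (weight (poly w) x1 x2 y1 y2)%:E =
  (H y2 w - H y1 w) + (V x2 w - V x1 w))%E.
Proof.
rewrite !(integral_hker alpha beta s n w _ x12).1 !(integral_vker alpha beta s n w _ y12).1.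
rewrite -!EFinB -EFinD -EFinM; congr EFin; rewrite -!sumrB -big_split/= mulr_sumr.
apply: eq_bigr => i _; rewrite -winding_kern; ring.
Qed.

Lemma measurable_hedge c : measurable_fun setT (fun w => H c w).
Proof.
apply: (measurable_integral_section (f := fun t => hker (poly t.1) t.2 c)).
  exact: measurable_itv.
exact: (measurable_hker _ _ _ _ (xi := id) (eta := cst c)).
Qed.

Lemma measurable_vedge c : measurable_fun setT (fun w => V c w).
Proof.
apply: (measurable_integral_section (f := fun t => vker (poly t.1) c t.2)).
  exact: measurable_itv.
exact: (measurable_vker _ _ _ _ (xi := cst c) (eta := id)).
Qed.

Let integrable_le (f : T -> \bar R) (C : R) : measurable_fun setT f ->
  (forall w, `|f w| <= C%:E)%E -> P.-integrable setT f.
Proof.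
move=> mf fC; apply: (le_integrable measurableT mf (g := cst C%:E)) => //.
  move=> w _ /=; apply: le_trans (fC w) _; rewrite lee_fin; exact: ler_norm.
by apply: finite_measure_integrable_cst.
Qed.

Let measurable_section (f : T * measurableTypeR R -> R) w :
  measurable_fun setT f -> measurable_fun setT (fun r => f (w, r)).
Proof. by move=> mf; apply: (measurableT_comp mf); exact: pair1_measurable. Qed.

Lemma integrable_hedge c : P.-integrable setT (fun w => H c w).
Proof.
apply: (integrable_le (C := n%:R * pi)); first exact: measurable_hedge.
move=> w; apply: le_trans (integral_hker alpha beta s n w c x12).2.
apply: le_abse_integral; first exact: measurable_itv.
apply/measurable_EFinP; apply: measurable_funTS.
exact: (measurable_section w (measurable_hker _ _ _ _ (xi := id) (eta := cst c) _ _)).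
Qed.

Lemma integrable_vedge c : P.-integrable setT (fun w => V c w).
Proof.
apply: (integrable_le (C := n%:R * pi)); first exact: measurable_vedge.
move=> w; apply: le_trans (integral_vker alpha beta s n w c y12).2.
apply: le_abse_integral; first exact: measurable_itv.
apply/measurable_EFinP; apply: measurable_funTS.
exact: (measurable_section w (measurable_vker _ _ _ _ (xi := cst c) (eta := id) _ _)).
Qed.

Lemma expected_weight :
  measurable_fun setT (fun w => weight (poly w) x1 x2 y1 y2) /\
  (\int[P]_w (weight (poly w) x1 x2 y1 y2)%:E =
   \int[area]_(u in rect x1 x2 y1 y2) (density0 s n (u.1 ^+ 2 + u.2 ^+ 2))%:E)%E.
Proof.
have pi2 : 2 * pi != 0 :> R by rewrite mulf_neq0// gt_eqF ?pi_gt0.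
have ih := integrable_hedge; have iv := integrable_vedge.
have iw : P.-integrable setT (fun w => (2 * pi)%:E * (weight (poly w) x1 x2 y1 y2)%:E)%E.
  apply: eq_integrable (integrableD measurableT (integrableB measurableT (ih y2) (ih y1))
    (integrableB measurableT (iv x2) (iv x1))) => //.
  by move=> w _; rewrite weight_edges.
have iw' : P.-integrable setT (fun w => (weight (poly w) x1 x2 y1 y2)%:E).
  apply: eq_integrable (integrableZl measurableT (2 * pi)^-1 iw) => //.
  by move=> w _; rewrite /= -!EFinM mulKf.
split; first by apply/measurable_EFinP; case/integrableP: iw'.
have [_ green] := @green_rect _ s n s0 _ _ _ _ x12 y12.
have cancel2pi (x y : \bar R) : ((2 * pi)%:E * x = (2 * pi)%:E * y -> x = y)%E.
  by move=> /(congr1 (fun z => ((2 * pi)^-1)%:E * z)%E); rewrite !muleA -EFinM mulVf// !mul1e.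
apply: cancel2pi.
rewrite green -integralZl//.
under eq_integral do rewrite weight_edges.
rewrite integralD//; [|exact: integrableB|exact: integrableB].
rewrite (integralB measurableT (ih y2) (ih y1)) (integralB measurableT (iv x2) (iv x1)).
by rewrite !(expected_hedge n hgauss s0 _ x12) !(expected_vedge n hgauss s0 _ y12).
Qed.

End Winding.

(** * Nonnegativity of the density *)

Section DensityNonneg.
Context {R : realType}.
Variables (s : nat -> R) (n : nat).
Hypothesis s0 : s 0%N != 0.
Local Notation K := (Kpoly s n).

Lemma horner_mulX_deriv_poly (a : nat -> R) (m : nat) (t : R) :
  t * (\poly_(k < m) a k)^`().[t] = \sum_(k < m) k%:R * a k * t ^+ k.
Proof.
rewrite poly_def raddf_sum horner_sum mulr_sumr; apply: eq_bigr => -[[|k] km] _ /=.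
  by rewrite derivZ derivXn mulr0n scaler0 horner0; ring.
by rewrite derivZ derivXn hornerZ hornerMn hornerXn -mulr_natr exprS /=; ring.
Qed.

(** For t > 0, [pi * t * density0 t] is the variance of the index [k] under the weights s_k^2 t^k,
    with [m0], [m1], [m2] the unnormalized moments. At t = 0 the density is K'(0) / K(0) divided by
    [pi]. *)
Lemma density0_ge0 (t : R) : 0 <= t -> 0 <= density0 s n t.
Proof.
move=> t0; rewrite /density0 divr_ge0 ?pi_ge0//.
have K0 : 0 < K.[t] by exact: Kpoly_gt0.
have K'0 : 0 <= K^`().[t].
  rewrite horner_deriv_Kpoly; apply: sumr_ge0 => k _.
  by rewrite mulr_ge0 ?sqr_ge0// mulrn_wge0// exprn_ge0.
have [te|tn0] := eqVneq t 0; first by rewrite [X in X * _]te mul0r addr0 divr_ge0// ltW.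
have tpos : 0 < t by rewrite lt_neqAle eq_sym tn0.
set m0 := K.[t] in K0 *; pose m1 := t * K^`().[t].
pose m2 := t * (K^`().[t] + t * K^`()^`().[t]).
have m0E : m0 = \sum_(k < n.+1) s k ^+ 2 * t ^+ k by rewrite /m0 horner_poly.
have m1E : m1 = \sum_(k < n.+1) k%:R * s k ^+ 2 * t ^+ k.
  by rewrite /m1 horner_mulX_deriv_poly.
have m2E : m2 = \sum_(k < n.+1) k%:R * (k%:R * s k ^+ 2) * t ^+ k.
  rewrite -(@horner_mulX_deriv_poly (fun k => k%:R * s k ^+ 2)).
  have -> : \poly_(k < n.+1) (k%:R * s k ^+ 2) = 'X * K^`().
    apply/polyP => k; rewrite coef_poly coefXM coef_deriv coef_poly.
    case: k => [|k] /=; first by rewrite mul0r.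
    by case: ifP => _; rewrite ?mul0rn// mulr_natl.
  by rewrite derivM derivX mul1r hornerD hornerM hornerX /m2.
have cs : 0 <= m0 * m2 - m1 ^+ 2.
  (* Squared deviations of [k] from its mean [m1 / m0], cleared of the denominator. *)
  have : 0 <= \sum_(k < n.+1) (k%:R * m0 - m1) ^+ 2 * (s k ^+ 2 * t ^+ k).
    by apply: sumr_ge0 => k _; rewrite mulr_ge0 ?sqr_ge0// mulr_ge0 ?sqr_ge0 ?exprn_ge0.
  have -> : \sum_(k < n.+1) (k%:R * m0 - m1) ^+ 2 * (s k ^+ 2 * t ^+ k) =
      m0 ^+ 2 * m2 - 2 * m0 * m1 * m1 + m1 ^+ 2 * m0.
    rewrite m2E {3}m1E {4}m0E !mulr_sumr -sumrB -big_split/=.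
    by apply: eq_bigr => k _; ring.
  rewrite (_ : _ + _ = m0 * (m0 * m2 - m1 ^+ 2)); last by ring.
  by rewrite pmulr_rge0.
rewrite /Kratio /dKratio -/m0.
have -> : K^`().[t] / m0 + t * ((K^`()^`().[t] * m0 - K^`().[t] ^+ 2) / m0 ^+ 2) =
    (m0 * m2 - m1 ^+ 2) / (t * m0 ^+ 2).
  have m0n : m0 != 0 by rewrite gt_eqF.
  rewrite /m1 /m2; move: (K^`().[t]) (K^`()^`().[t]) => b c.
  by field; rewrite m0n.
by rewrite divr_ge0// mulr_ge0// sqr_ge0.
Qed.

End DensityNonneg.

(** * Open rectangles as a generating pi-system *)

Section OpenRectangles.
Context {R : realType}.
Local Notation plane := (measurableTypeR R * measurableTypeR R)%type.

Definition orect (x1 x2 y1 y2 : R) : set plane := `]x1, x2[%classic `*` `]y1, y2[%classic.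

Definition orects : set (set plane) :=
  [set A | exists x1 x2 y1 y2, A = orect x1 x2 y1 y2].

Lemma setI_orects : setI_closed orects.
Proof.
move=> _ _ [x1 [x2 [y1 [y2 ->]]]] [u1 [u2 [v1 [v2 ->]]]].
exists (Num.max x1 u1), (Num.min x2 u2), (Num.max y1 v1), (Num.min y2 v2).
apply/seteqP; split => -[x y]; rewrite /orect /= !in_itv/= !gt_max !lt_min.
  by case=> -[/andP[-> ->] /andP[-> ->]] [/andP[-> ->] /andP[-> ->]].
by case=> /andP[/andP[-> ->] /andP[-> ->]] /andP[/andP[-> ->] /andP[-> ->]].
Qed.

Lemma orect_bigcup (x1 x2 : R) : 
  (fst @^-1` `]x1, x2[%classic : set plane) = \bigcup_k orect x1 x2 (- k%:R) k%:R /\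
  (snd @^-1` `]x1, x2[%classic : set plane) = \bigcup_k orect (- k%:R) k%:R x1 x2.
Proof.
have big (y : R) : exists k : nat, y \in `](- k%:R), k%:R[%R.
  exists (Num.truncn `|y|).+1; rewrite in_itv/= -ltr_norml; exact: truncnS_gt.
split; apply/seteqP; split => -[x y] /=.
- by move=> xx; have [k yk] := big y; exists k.
- by case=> k _ [].
- by move=> xx; have [k yk] := big x; exists k.
- by case=> k _ [].
Qed.

(** The product sigma-algebra comes from preimages under the two projections, and the Borel sets of
    the line from open intervals. The strips above these intervals are countable unions of open
    rectangles. *)
Lemma measurable_orects : (@measurable _ plane) = <<s orects >>.
Proof.
apply/seteqP; split; last first.
  apply: smallest_sub; first exact: sigma_algebra_measurable.
  by move=> _ [x1 [x2 [y1 [y2 ->]]]]; apply: measurableX; exact: measurable_itv.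
have key (f : plane -> measurableTypeR R) :
    (forall x1 x2, <<s orects >> (f @^-1` `]x1, x2[%classic)) ->
    preimage_set_system setT f measurable `<=` <<s orects >>.
  move=> fo; rewrite -[measurable]/((@ocitv R).-sigma.-measurable) RGenOpens.measurableE.
  rewrite -g_sigma_preimageE; apply: smallest_sub; first exact: smallest_sigma_algebra.
  by move=> _ [_ [x1 [x2 ->]] <-]; rewrite setTI.
apply: smallest_sub; first exact: smallest_sigma_algebra.
rewrite subUset; split; apply: key => x1 x2.
  rewrite (orect_bigcup x1 x2).1; apply: sigma_algebra_bigcup => k.
  by apply: sub_sigma_algebra; do 4 eexists.
rewrite (orect_bigcup x1 x2).2; apply: sigma_algebra_bigcup => k.
by apply: sub_sigma_algebra; do 4 eexists.
Qed.

End OpenRectangles.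

(** * From rectangles to Borel sets *)

Section Counting.
Context {R : realType}.
Local Notation plane := (measurableTypeR R * measurableTypeR R)%type.

Definition plane_of (z : R[i]) : plane := (Re z, Im z).

Definition count (p : {poly R[i]}) (B : set plane) : R :=
  \sum_(a <- zeros p) \1_B (plane_of a).

Let dirac_zero (p : {poly R[i]}) (i : nat) : {measure set plane -> \bar R} :=
  \d_(plane_of (nth 0 (zeros p) i)).

(** Seeing [count] as a sum of Dirac masses gives its behaviour on differences and increasing unions
    from measure theory. *)
Definition zeros_measure (p : {poly R[i]}) : {measure set plane -> \bar R} :=
  msum (dirac_zero p) (size (zeros p)).

Lemma zeros_measureE p B : zeros_measure p B = (count p B)%:E.
Proof.
rewrite /zeros_measure /= /msum /count (big_nth 0) big_mkord -sumEFin.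
by apply: eq_bigr => i _; rewrite /dirac_zero /= diracE indicE.
Qed.

Lemma count_ge0 p B : 0 <= count p B.
Proof. by apply: sumr_ge0 => a _; rewrite indicE. Qed.

Lemma le_count_size p B : count p B <= (size (zeros p))%:R.
Proof.
rewrite -sum1_size natr_sum; apply: ler_sum => i _.
by rewrite indicE; case: (_ \in _).
Qed.

Lemma countD p (A B : set plane) : measurable A -> measurable B -> B `<=` A ->
  count p A = count p B + count p (A `\` B).
Proof.
move=> mA mB BA; apply: EFin_inj; rewrite EFinD -!zeros_measureE.
rewrite -measureU//; [by rewrite setDUK|exact: measurableD|by rewrite setDIK].
Qed.

Lemma count_bigcup p (F : (set plane)^nat) : nondecreasing_seq F ->
  (forall k, measurable (F k)) ->
  (count p (F k))%:E @[k --> \oo] --> (count p (\bigcup_k F k))%:E.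
Proof.
move=> ndF mF; rewrite -zeros_measureE; under eq_cvg do rewrite -zeros_measureE.
by apply: nondecreasing_cvg_mu => //; exact: bigcupT_measurable.
Qed.

(** The factor (x2 - x1) / 2 keeps the end points in order from [k = 0] on, where the interval is
    reduced to its midpoint. *)
Definition inner_lo (x1 x2 : R) (k : nat) := x1 + (x2 - x1) / 2 * harmonic k.
Definition inner_hi (x1 x2 : R) (k : nat) := x2 - (x2 - x1) / 2 * harmonic k.

Lemma inner_le x1 x2 k : x1 < x2 ->
  [/\ x1 < inner_lo x1 x2 k, inner_lo x1 x2 k <= inner_hi x1 x2 k &
      inner_hi x1 x2 k < x2].
Proof.
move=> x12; rewrite /inner_lo /inner_hi.
have h0 : 0 < harmonic k :> R by exact: harmonic_gt0.
have h1 : harmonic k <= 1 :> R by rewrite /harmonic invf_le1 ?ltr0n// ler1n.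
by split; nra.
Qed.

Lemma inner_nd x1 x2 k m : x1 < x2 -> (k <= m)%N ->
  inner_lo x1 x2 m <= inner_lo x1 x2 k /\ inner_hi x1 x2 k <= inner_hi x1 x2 m.
Proof.
move=> x12 km; rewrite /inner_lo /inner_hi.
have h : harmonic m <= harmonic k :> R.
  by rewrite /harmonic lef_pV2 ?posrE ?ltr0n// ler_nat.
by split; nra.
Qed.

Lemma inner_near x1 x2 c : x1 < x2 -> x1 < c < x2 ->
  \forall k \near \oo, inner_lo x1 x2 k < c < inner_hi x1 x2 k.
Proof.
move=> x12 /andP[x1c cx2].
have d0 : 0 < (x2 - x1) / 2 by rewrite divr_gt0// subr_gt0.
pose e := Num.min (c - x1) (x2 - c) / ((x2 - x1) / 2).
have e0 : 0 < e by rewrite divr_gt0// lt_min !subr_gt0 x1c.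
have /cvgrPdist_lt /(_ e e0) := @cvg_harmonic R.
apply: filterS => k; rewrite sub0r normrN ger0_norm ?ltW ?harmonic_gt0//.
rewrite /e ltr_pdivlMr// lt_min /inner_lo /inner_hi => /andP[h1 h2].
by apply/andP; split; lra.
Qed.

(** A point outside the open interval is strictly outside every inner one, and a point of it is
    strictly inside the inner ones for large [k]. The value 1/2 therefore does not survive. *)
Lemma halfsg_inner x1 x2 c : x1 < x2 ->
  \forall k \near \oo, halfsg (inner_lo x1 x2 k) (inner_hi x1 x2 k) c =
    (\1_(`]x1, x2[%classic) c : R).
Proof.
move=> x12; have [cx|cx] := boolP (x1 < c < x2).
  have := inner_near x12 cx; apply: filterS => k /andP[h1 h2].
  rewrite /halfsg indicE mem_set ?in_itv//= gtr0_sg ?subr_gt0// ltr0_sg ?subr_lt0//.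
  by rewrite opprK -[1 + 1]/(2%:R) divff.
apply: nearW => k; have [l1 l2 l3] := inner_le k x12.
rewrite /halfsg indicE memNset; last by rewrite /= in_itv/=; apply/negP.
move: cx; rewrite negb_and -!leNgt => /orP[cx|cx].
  rewrite !gtr0_sg ?subrr ?mul0r// subr_gt0.
    by apply: le_lt_trans l1.
  by apply: le_lt_trans cx _; apply: lt_le_trans l1 l2.
rewrite !ltr0_sg ?subrr ?mul0r// subr_lt0.
  by apply: lt_le_trans cx; apply: le_lt_trans l2 l3.
by apply: lt_le_trans cx.
Qed.

Lemma halfsg_bound a b c : `|halfsg a b c : R| <= 1.
Proof.
have sg1 (x : R) : `|Num.sg x| <= 1 by rewrite normr_sg; case: (x != 0).
rewrite /halfsg normrM (@ger0_norm _ 2^-1)// ler_pdivrMr// mul1r.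
apply: le_trans (ler_normB _ _) _; rewrite -[2]/(1 + 1 : R); exact: lerD.
Qed.

Lemma weight_inner p x1 x2 y1 y2 : x1 < x2 -> y1 < y2 ->
  weight p (inner_lo x1 x2 k) (inner_hi x1 x2 k) (inner_lo y1 y2 k) (inner_hi y1 y2 k)
    @[k --> \oo] --> count p (orect x1 x2 y1 y2).
Proof.
move=> x12 y12; rewrite /weight /count; apply: cvg_big => [|a _].
  by move=> [x y]; apply: cvgD; [exact: cvg_fst|exact: cvg_snd].
apply: cvg_near_cst.
have := halfsg_inner (Re a) x12; have := halfsg_inner (Im a) y12.
apply: filterS2 => k -> ->; rewrite !indicE /orect in_setX/=.
by case: (_ \in _); case: (_ \in _); rewrite ?mulr1 ?mulr0 ?mul0r.
Qed.

Lemma weight_bound (p : {poly R[i]}) (x1 x2 y1 y2 : R) : `|weight p x1 x2 y1 y2| <= (size (zeros p))%:R.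
Proof.
apply: le_trans (ler_norm_sum _ _ _) _.
rewrite -sum1_size natr_sum; apply: ler_sum => i _.
 rewrite normrM -[1]mulr1.
by apply: ler_pM => //; exact: halfsg_bound.
Qed.

Lemma orect_inner (x1 x2 y1 y2 : R) : x1 < x2 -> y1 < y2 ->
  orect x1 x2 y1 y2 = \bigcup_k rect (inner_lo x1 x2 k) (inner_hi x1 x2 k) (inner_lo y1 y2 k) (inner_hi y1 y2 k).
Proof.
move=> x12 y12; apply/seteqP; split => -[x y].
  case=> /=; rewrite !in_itv/= => xx yy.
  have [k []] := @filter_ex _ _ _ _ (filterI (inner_near x12 xx) (inner_near y12 yy)).
  move=> /andP[h1 h2] /andP[h3 h4]; exists k => //.
  by split; rewrite /= in_itv/=; apply/andP; split; apply: ltW.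
case=> k _ [] /=; rewrite !in_itv/= => /andP[h1 h2] /andP[h3 h4].
have [? _ ?] := inner_le k x12; have [? _ ?] := inner_le k y12.
by split; rewrite /= in_itv/=; apply/andP; split; lra.
Qed.

End Counting.

Section ExpectedCount.
Context d (T : measurableType d) (R : realType) (P : probability T R).
Local Notation plane := (measurableTypeR R * measurableTypeR R)%type.
Variables (alpha beta : nat -> {RV P >-> R}) (s : nat -> R) (n : nat).
Hypothesis hgauss : iid_standard_gaussian alpha beta.
Hypothesis s0 : s 0%N != 0.
Local Notation poly := (gpoly alpha beta s n).

Let dens (u : plane) : \bar R := (density0 s n (u.1 ^+ 2 + u.2 ^+ 2))%:E.

Let dens_ge0 u : (0 <= dens u)%E.
Proof. by rewrite lee_fin density0_ge0// addr_ge0 ?sqr_ge0. Qed.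

Let mdens : measurable_fun setT dens.
Proof. by apply/measurable_EFinP; exact: measurable_density0_plane. Qed.

Let good (B : set plane) := [/\ measurable B,
  measurable_fun setT (fun w => count (poly w) B) &
  (\int[P]_w (count (poly w) B)%:E = \int[area]_(u in B) dens u)%E].

Lemma count_gpoly_le w B : count (poly w) B <= n%:R.
Proof. by apply: le_trans (le_count_size _ _) _; rewrite ler_nat size_zeros_gpoly. Qed.

Let good_bigcup : ndseq_closed good.
Proof.
move=> F ndF gF.
have mF k : measurable (F k) by case: (gF k).
have mU : measurable (\bigcup_k F k) by exact: bigcupT_measurable.
have cF w := @count_bigcup _ (poly w) F ndF mF.
have mc : measurable_fun setT (fun w => (count (poly w) (\bigcup_k F k))%:E).
  apply: (emeasurable_fun_cvg (fun k w => (count (poly w) (F k))%:E)) => [k|w _].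
    by apply/measurable_EFinP; case: (gF k).
  exact: cF.
split => //; first exact/measurable_EFinP.
have := @ge0_nondecreasing_set_cvg_integral _ _ _ F dens area ndF mF
  (fun i => measurable_funTS mdens) (fun i x _ => dens_ge0 x).
have : (\int[P]_w (count (poly w) (F k))%:E)%E @[k --> \oo] -->
    (\int[P]_w (count (poly w) (\bigcup_k F k))%:E)%E.
  have -> : (fun w => (count (poly w) (\bigcup_k F k))%:E) =
      (fun w => limn (fun k => (count (poly w) (F k))%:E)).
    by apply/funext => w; apply/esym/cvg_lim; [|exact: cF].
  apply: cvg_monotone_convergence => //.
  - by move=> k; apply/measurable_EFinP; case: (gF k).
  - by move=> k w _; rewrite lee_fin count_ge0.
  - move=> w _ k m km; rewrite lee_fin -lee_fin -!zeros_measureE.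
    by apply: le_measure; rewrite ?inE//; apply/subsetPset/ndF.
have eF k : (\int[P]_w (count (poly w) (F k))%:E = \int[area]_(u in F k) dens u)%E.
  by case: (gF k).
under eq_cvg do rewrite eF.
by move=> h1 h2; apply: cvg_unique h1 h2.
Qed.

Let cancel (a b c : \bar R) : a \is a fin_num -> (a + b = a + c)%E -> b = c.
Proof. by move=> fa /(congr1 (fun z => z - a)%E); rewrite ![(a + _)%E]addeC !addeK. Qed.

(** Cancelling the expectation for [B] in the extended reals requires it to be finite, and it is at
    most [n], the bound on the number of zeros. *)
Let good_diff : setSD_closed good.
Proof.
move=> A B BA [mA mcA eA] [mB mcB eB].
have cE w : count (poly w) (A `\` B) = count (poly w) A - count (poly w) B.
  by rewrite (countD (poly w) mA mB BA) addrAC subrr add0r.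
have mD : measurable (A `\` B) by exact: measurableD.
have mcD : measurable_fun setT (fun w => count (poly w) (A `\` B)).
  by under eq_fun do rewrite cE; exact: measurable_funB.
split => //.
have : (\int[P]_w (count (poly w) B)%:E + \int[P]_w (count (poly w) (A `\` B))%:E =
    \int[area]_(u in B) dens u + \int[area]_(u in A `\` B) dens u)%E.
  rewrite -ge0_integralD//; try by move=> w _; rewrite lee_fin count_ge0.
  - rewrite -ge0_integral_setU//; [|exact: measurable_funTS|by rewrite disj_set2E setDIK].
    rewrite setDUK// -eA; apply: eq_integral => w _.
    by rewrite -EFinD -countD.
  - exact/measurable_EFinP.
  - exact/measurable_EFinP.
rewrite -eB; suff fB : (\int[P]_w (count (poly w) B)%:E)%E \is a fin_num.
  exact: cancel fB.
rewrite ge0_fin_numE; last by apply: integral_ge0 => w _; rewrite lee_fin count_ge0.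
apply: (@le_lt_trans _ _ (\int[P]_w (cst n%:R%:E w))%E).
  apply: ge0_le_integral => //; first by move=> w _; rewrite lee_fin count_ge0.
    exact/measurable_EFinP.
  by move=> w _; rewrite lee_fin; exact: count_gpoly_le.
rewrite integral_cst// [X in (_ * X)%E](_ : _ = 1%E) ?mule1 ?ltry//.
exact: probability_setT.
Qed.

(** On the inner closed rectangles the identity is known for [weight]. These weights converge to the
    exact count of the open rectangle and are bounded by [n], while the integrals of the density
    increase to the integral over the union. *)
Let good_orect (x1 x2 y1 y2 : R) : good (orect x1 x2 y1 y2).
Proof.
have empty : (x2 <= x1) || (y2 <= y1) -> good (orect x1 x2 y1 y2).
  rewrite /good => h; have -> : orect x1 x2 y1 y2 = set0.
    apply/seteqP; split => // -[x y] [] /=; rewrite !in_itv/= => /andP[h1 h2] /andP[h3 h4].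
    by move: h => /orP[h|h]; lra.
  have c0 w : count (poly w) set0 = 0 by rewrite /count big1// => a _; rewrite indic0.
  have -> : (fun w => count (poly w) set0) = cst 0 by exact/funext.
  by split => //; rewrite integral_set0 integral0_eq// => w _; rewrite c0.
have [x12|x12] := leP x2 x1; first by apply: empty; rewrite x12.
have [y12|y12] := leP y2 y1; first by apply: empty; rewrite y12 orbT.
pose F k := rect (inner_lo x1 x2 k) (inner_hi x1 x2 k) (inner_lo y1 y2 k) (inner_hi y1 y2 k).
pose W k w := weight (poly w) (inner_lo x1 x2 k) (inner_hi x1 x2 k) (inner_lo y1 y2 k) (inner_hi y1 y2 k).
have WP k : measurable_fun setT (W k) /\
    (\int[P]_w (W k w)%:E = \int[area]_(u in F k) dens u)%E.
  have [_ lx _] := inner_le k x12; have [_ ly _] := inner_le k y12.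
  exact: (expected_weight n hgauss s0 lx ly).
have Wc w : W k w @[k --> \oo] --> count (poly w) (orect x1 x2 y1 y2).
  exact: weight_inner.
have mc : measurable_fun setT (fun w => count (poly w) (orect x1 x2 y1 y2)).
  apply: (measurable_fun_cvg (fun k => (WP k).1)) => w _; exact: Wc.
split => //; first by apply: measurableX; exact: measurable_itv.
have mF k : measurable (F k) by exact: measurable_rect.
have ndF : nondecreasing_seq F.
  move=> k m km; apply/subsetPset => -[x y] [] /=.
  have [? ?] := inner_nd x12 km; have [? ?] := inner_nd y12 km.
  by rewrite !in_itv/= => /andP[? ?] /andP[? ?]; split; rewrite /= in_itv/=; apply/andP; split; lra.
have := @ge0_nondecreasing_set_cvg_integral _ _ _ F dens area ndF mF
  (fun i => measurable_funTS mdens) (fun i x _ => dens_ge0 x).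
rewrite -orect_inner//; under eq_cvg do rewrite -(WP _).2.
have [|||||_ _ h1] := @dominated_convergence _ _ _ P setT measurableT
    (fun k w => (W k w)%:E) (fun w => (count (poly w) (orect x1 x2 y1 y2))%:E) (cst n%:R%:E).
- by move=> k; apply/measurable_EFinP; case: (WP k).
- exact/measurable_EFinP.
- by apply: aeW => w _; apply: cvg_EFin; [exact: nearW|exact: Wc].
- exact: finite_measure_integrable_cst.
- apply: aeW => w k _; rewrite lee_fin; apply: le_trans (weight_bound _ _ _ _ _) _.
  by rewrite ler_nat size_zeros_gpoly.
by move=> h2; apply: cvg_unique h1 h2.
Qed.

Lemma expected_count (B : set plane) : measurable B ->
  measurable_fun setT (fun w => count (poly w) B) /\
  (\int[P]_w (count (poly w) B)%:E =
   \int[area]_(u in B) (density0 s n (u.1 ^+ 2 + u.2 ^+ 2))%:E)%E.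
Proof.
move=> mB; suff: good B by case.
(* A lambda-system must contain the whole plane, here an increasing union of open squares. *)
have goodT : good setT.
  have -> : [set: plane] = \bigcup_k orect (- k%:R) k%:R (- k%:R) k%:R.
    apply/seteqP; split => // -[x y] _.
    have big (z : R) : `|z| <= `|x| + `|y| -> z \in
        `](- (Num.truncn (`|x| + `|y|)).+1%:R), (Num.truncn (`|x| + `|y|)).+1%:R[%R.
      by move=> zxy; rewrite in_itv/= -ltr_norml; apply: le_lt_trans zxy _; exact: truncnS_gt.
    exists (Num.truncn (`|x| + `|y|)).+1 => //.
    by split; apply: big; rewrite ?lerDl ?lerDr.
  apply: good_bigcup => // k m km; apply/subsetPset => -[x y] [] /=.
  have kmR : k%:R <= m%:R :> R by rewrite ler_nat.
  rewrite !in_itv/= => /andP[? ?] /andP[? ?].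
  by split; rewrite /= in_itv/=; apply/andP; split; lra.
have : <<s orects >> B by rewrite -measurable_orects.
apply: (lambda_system_subset setI_orects) => //.
by move=> _ [x1 [x2 [y1 [y2 ->]]]].
Qed.

End ExpectedCount.

(** * Radial functions *)

Section DiskArea.
Context {R : realType}.
Local Notation mu := (@lebesgue_measure R).
Local Notation plane := (measurableTypeR R * measurableTypeR R)%type.

(** The integrand is the full vertical chord at [x], so the value is the area of the whole disk. *)
Lemma integral_half_disk (r : R) : 0 < r ->
  (\int[mu]_(x in `[(- r)%R, r]) (2 * Num.sqrt (r ^+ 2 - x ^+ 2))%:E)%E = (pi * r ^+ 2)%:E.
Proof.
move=> r0.
pose F (x : R) := r * sin x; pose G (x : R) : R := 2 * Num.sqrt (r ^+ 2 - x ^+ 2).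
have pi2 : 0 < pi / 2 :> R by rewrite divr_gt0 ?pi_gt0.
have dF (x : R) : is_derive x 1 F (r * cos x).
  by apply: is_derive_eq; rewrite /GRing.scale/=; ring.
have F'E : (F^`())%classic = (fun x => r * cos x) by apply/funext => x; rewrite derive1E; exact: derive_val.
have cF' : continuous (fun x : R => r * cos x).
  by move=> x; apply: cvgM; [exact: cvg_cst|exact: continuous_cos].
have cF : continuous F.
  by move=> x; apply: cvgM; [exact: cvg_cst|exact: continuous_sin].
have cG : continuous G.
  move=> x; apply: cvgM; first exact: cvg_cst.
  apply: (@continuous_comp _ _ _ (fun x : R => r ^+ 2 - x ^+ 2) Num.sqrt); last exact: sqrt_continuous.
  by apply: cvgB; [exact: cvg_cst|exact: exprn_continuous].
have FE : F (pi / 2) = r by rewrite /F sin_pihalf mulr1.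
have FNE : F (- (pi / 2)) = - r by rewrite /F sinN sin_pihalf mulrN1.
have := @integration_by_substitution_increasing R F G (- (pi / 2)) (pi / 2).
rewrite FE FNE => -> //.
- rewrite F'E.
  transitivity (\int[mu]_(x in `[(- (pi / 2))%R, (pi / 2)%R]) (2 * r ^+ 2 * cos x ^+ 2)%:E)%E.
    apply: eq_integral => x; rewrite inE/= in_itv/= => /andP[x1 x2]; congr EFin.
    rewrite -[LHS]/(2 * Num.sqrt (r ^+ 2 - (r * sin x) ^+ 2) * (r * cos x)).
    have c0 : 0 <= cos x by apply: cos_ge0_pihalf; rewrite x1 x2.
    have -> : r ^+ 2 - (r * sin x) ^+ 2 = (r * cos x) ^+ 2.
      by rewrite !exprMn sin2cos2; ring.
    by rewrite sqrtr_sqr ger0_norm ?(mulr_ge0 (ltW r0) c0)//; ring.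
  pose H (x : R) := r ^+ 2 * (x + sin x * cos x).
  have dH (x : R) : is_derive x 1 H (2 * r ^+ 2 * cos x ^+ 2).
    apply: is_derive_eq; rewrite /GRing.scale/=.
    transitivity (r ^+ 2 * (1 - sin x ^+ 2 + cos x ^+ 2)); first by ring.
    by rewrite sin2cos2; ring.
  have cH' : continuous (fun x : R => 2 * r ^+ 2 * cos x ^+ 2).
    move=> x; apply: cvgM; first exact: cvg_cst.
    exact: (cvgM (@continuous_cos R x) (@continuous_cos R x)).
  have pipi : - (pi / 2) <= pi / 2 :> R by lra.
  rewrite (@integral_itv_derive R _ _ _ _ pipi cH' dH) /H; congr EFin.
  by rewrite cosN cos_pihalf; field.
- by lra.
- move=> x y; rewrite !in_itv/= => /andP[x1 x2] /andP[y1 y2] xy.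
  by rewrite ltr_pM2l// ltr_sin// in_itv/=; apply/andP.
- by move=> x _; rewrite F'E; exact: cF'.
- by rewrite F'E; apply: cvgP; apply: cvg_at_right_filter; exact: cF'.
- by rewrite F'E; apply: cvgP; apply: cvg_at_left_filter; exact: cF'.
- split; first by move=> x _; exact: ex_derive.
    by apply: cvg_at_right_filter; exact: cF.
  by apply: cvg_at_left_filter; exact: cF.
- exact: continuous_subspaceT.
Qed.

Lemma area_disk (r : R) : 0 < r ->
  area [set u : plane | u.1 ^+ 2 + u.2 ^+ 2 < r ^+ 2] = (pi * r ^+ 2)%:E.
Proof.
move=> r0; rewrite -(integral_half_disk r0) /area /= /product_measure1.
(* [Num.sqrt] is 0 on negative numbers, so the formula also covers the empty sections beyond the
   disk. *)
have sectE x : mu (xsection [set u : plane | u.1 ^+ 2 + u.2 ^+ 2 < r ^+ 2] x) =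
    (2 * Num.sqrt (r ^+ 2 - x ^+ 2))%:E.
  set q := Num.sqrt _; have q0 : 0 <= q by exact: sqrtr_ge0.
  have -> : xsection [set u : plane | u.1 ^+ 2 + u.2 ^+ 2 < r ^+ 2] x = `](- q), q[%classic.
    apply/seteqP; split => y; rewrite /xsection/= inE/= in_itv/= -ltr_norml -ltrBrDl => h.
      by rewrite -sqrtr_sqr ltr_sqrt//; apply: le_lt_trans h; exact: sqr_ge0.
    have qp : 0 < r ^+ 2 - x ^+ 2.
      by rewrite -sqrtr_gt0; apply: le_lt_trans h; exact: normr_ge0.
    by move: h; rewrite -sqrtr_sqr ltr_sqrt.
  rewrite lebesgue_measure_itv/= lte_fin; case: ifPn => [_|].
    by rewrite -EFinB; congr EFin; ring.
  by rewrite -leNgt => h; congr EFin; lra.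
transitivity (\int[mu]_x (2 * Num.sqrt (r ^+ 2 - x ^+ 2))%:E)%E.
  by apply: eq_integral => x _; exact: sectE.
rewrite [RHS]integral_mkcond; apply: eq_integral => x _.
rewrite patchE; case: ifPn => // /negP; rewrite inE/= in_itv/= => /negP xr.
congr EFin; rewrite ler0_sqrtr ?mulr0// subr_le0.
move: xr; rewrite -ler_norml -ltNge => /ltW xr.
by rewrite -(real_normK (num_real x)) ler_sqr ?nnegrE ?normr_ge0// (ltW r0).
Qed.

End DiskArea.

Section Radial.
Context {R : realType}.
Local Notation mu := (@lebesgue_measure R).
Local Notation plane := (measurableTypeR R * measurableTypeR R)%type.

Definition normsq (u : plane) : measurableTypeR R := u.1 ^+ 2 + u.2 ^+ 2.

Lemma normsq_ge0 u : 0 <= normsq u. Proof. by rewrite addr_ge0 ?sqr_ge0. Qed.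

Lemma measurable_normsq : measurable_fun setT normsq.
Proof.
apply: measurable_funD; apply: measurable_funX.
exact: (@measurable_fst _ _ (measurableTypeR R) (measurableTypeR R)).
exact: (@measurable_snd _ _ (measurableTypeR R) (measurableTypeR R)).
Qed.

Let nonneg : set (measurableTypeR R) := `[0, +oo[%classic.
Let mnonneg : measurable nonneg. Proof. exact: measurable_itv. Qed.

Let pi_nng : {nonneg R} := NngNum (pi_ge0 R).

(** Packaging the image of the area as an existential leaves only the two facts used below and keeps
    its construction opaque. *)
Let normsq_pushforward : exists nu : {measure set (measurableTypeR R) -> \bar R},
  (forall B, nu B = area (normsq @^-1` B)) /\
  (forall D (f : measurableTypeR R -> \bar R), measurable D -> measurable_fun D f ->
    (forall x, D x -> 0 <= f x)%E ->
    \int[nu]_(y in D) f y = \int[area]_(x in normsq @^-1` D) f (normsq x))%E.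
Proof.
unshelve eexists (pushforward (@area R) normsq); first exact: measurable_normsq.
split => // D f mD mf f0; rewrite (ge0_integral_pushforward measurable_normsq)//.
by move=> x /set_mem; exact: f0.
Qed.

(** The disk |z|^2 < t has area pi t, so the image of the area under |z|^2 and [pi] times Lebesgue
    measure on the half-line agree on a generating pi-system of half-lines. This plays the part of
    polar coordinates, without a change of variables in the plane. *)
Lemma area_normsq (A : set (measurableTypeR R)) : measurable A ->
  A `<=` `[0, +oo[%classic -> area (normsq @^-1` A) = (pi%:E * mu A)%E.
Proof.
move=> mA A0.
have [m1 [m1E _]] := normsq_pushforward.
rewrite -m1E.
pose m2 : {measure set (measurableTypeR R) -> \bar R} := mscale pi_nng (mrestr mu mnonneg).
have m2E B : m2 B = (pi%:E * mu (B `&` nonneg))%E by [].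
have : m1 A = m2 A; last first.
  by rewrite m2E setIidl.
apply: (@measure_unique _ R (measurableTypeR R) (@RGenInftyO.G R) (fun k => `]-oo, (k%:R : R)[%classic) _ _ _ _ m1 m2) => //.
- exact: (RGenInftyO.measurableE R).
- move=> _ _ [x ->] [y ->]; exists (Num.min x y).
  apply/seteqP; split => z; rewrite /= !in_itv/= lt_min; first by case=> -> ->.
  by move=> /andP[].
- by move=> k; exists k%:R.
- apply/seteqP; split => // x _; exists (Num.truncn `|x|).+1 => //=.
  by rewrite in_itv/=; apply: le_lt_trans (ler_norm x) _; exact: truncnS_gt.
- move=> _ [t ->].
  have [t0|t0] := leP t 0.
    rewrite m1E m2E.
    have -> : normsq @^-1` `]-oo, t[%classic = set0.
      apply/seteqP; split => // u; rewrite /= in_itv/= => ut.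
      by have := normsq_ge0 u; lra.
    rewrite [X in mu X](_ : _ = set0) ?measure0 ?mule0//.
    apply/seteqP; split => // z []; rewrite /nonneg /= !in_itv/= andbT => z1 z2; lra.
  have mE : m2 `]-oo, t[%classic = (pi * t)%:E.
    rewrite m2E [X in mu X](_ : _ = `[0, t[%classic).
      by rewrite lebesgue_measure_itv/= lte_fin t0 oppr0 adde0.
    apply/seteqP; split => z; rewrite /nonneg /= !in_itv/= andbT.
      by move=> [-> ->].
    by move=> /andP[].
  rewrite mE -[in RHS](sqr_sqrtr (ltW t0)) -area_disk ?sqrtr_gt0//.
  rewrite m1E; congr (area _); apply/seteqP; split => u /=.
    by rewrite in_itv/= sqr_sqrtr// ltW.
  by rewrite in_itv/= sqr_sqrtr// ltW.
- move=> k; rewrite m1E.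
  (* [area_disk] asks for a positive radius, so the bound [k], possibly 0, is enlarged to (k +
     1)^2. *)
  apply: (@le_lt_trans _ _ (area [set u : plane | u.1 ^+ 2 + u.2 ^+ 2 < (k.+1%:R : R) ^+ 2])).
    have mk (t : R) : measurable (normsq @^-1` `]-oo, t[%classic).
      by rewrite -[X in measurable X]setTI; apply: measurable_normsq => //; exact: measurable_itv.
    have e : [set u : plane | u.1 ^+ 2 + u.2 ^+ 2 < (k.+1%:R : R) ^+ 2] =
        normsq @^-1` `]-oo, ((k.+1%:R : R) ^+ 2)[%classic.
      by apply/seteqP; split => u /=; rewrite in_itv.
    rewrite e; apply: le_measure; rewrite ?inE//.
    move=> u /=; rewrite !in_itv/= => uk; apply: lt_le_trans uk _.
    by rewrite -natrX ler_nat; apply: leq_trans (leq_pexp2l _ (ltn0Sn 1)) => //; exact: leqnSn.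
  by rewrite area_disk// ltry.
Qed.

Lemma ge0_integral_normsq (f : R -> R) (t : R) : 0 < t ->
  measurable_fun setT f -> (forall x, 0 <= x -> 0 <= f x) ->
  (\int[area]_(u in [set u : plane | (normsq u < t)%R]) (f (normsq u))%:E =
   pi%:E * \int[mu]_(x in `[0%R, t]) (f x)%:E)%E.
Proof.
move=> t0 mf f0.
have mE : measurable_fun setT (fun x : measurableTypeR R => (f x)%:E).
  exact/measurable_EFinP.
have -> : [set u : plane | normsq u < t] = normsq @^-1` `[0, t[%classic.
  by apply/seteqP; split => u /=; rewrite in_itv/= normsq_ge0.
have f0' (x : measurableTypeR R) : `[0, t[%classic x -> (0 <= (f x)%:E)%E.
  by rewrite /= in_itv/= lee_fin => /andP[/f0].
have mt : measurable (`[0, t[%classic : set (measurableTypeR R)) by exact: measurable_itv.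
have [nu [nuE nuI]] := normsq_pushforward.
rewrite -(nuI _ (fun x => (f x)%:E) mt (measurable_funTS mE) f0').
transitivity (\int[mscale pi_nng mu]_(x in `[0%R, t[) (f x)%:E)%E.
  apply: eq_measure_integral => A mA At; rewrite nuE area_normsq//.
  by apply: subset_trans At _ => x; rewrite /= !in_itv/= andbT => /andP[].
rewrite ge0_integral_mscale//; last exact: measurable_funTS.
congr (_ * _)%E; apply: integral_itv_bndo_bndc; exact: measurable_funTS.
Qed.

End Radial.

Section RadialDensity.
Context {R : realType}.
Local Notation mu := (@lebesgue_measure R).
Local Notation plane := (measurableTypeR R * measurableTypeR R)%type.
Variables (s : nat -> R) (n : nat).
Hypothesis s0 : s 0%N != 0.

Lemma integral_density0_disk (t : R) : 0 < t ->
  (\int[area]_(u in [set u : plane | (normsq u < t)%R]) (density0 s n (normsq u))%:E =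
   (t * Kratio s n t)%:E)%E.
Proof.
move=> t0.
have d0 x : 0 <= x -> 0 <= density0 s n x by exact: density0_ge0.
have md := measurable_density0 s n.
rewrite ge0_integral_normsq//.
have pi0 : pi != 0 :> R by rewrite gt_eqF ?pi_gt0.
rewrite -ge0_integralZl//; last 3 first.
- by apply/measurable_EFinP; exact: measurable_funTS.
- by move=> x; rewrite /= in_itv/= lee_fin => /andP[/d0].
- by rewrite lee_fin pi_ge0.
pose F (x : R) := x * Kratio s n x.
have dF (x : R) : 0 <= x -> is_derive x 1 F (pi * density0 s n x).
  move=> x0; have dk := @derive_Kratio R s n s0 x x0.
  rewrite (_ : F = id * Kratio s n)//.
  by apply: is_derive_eq; rewrite /density0 [RHS]mulrC divfK// /GRing.scale/= mulr1 addrC.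
under eq_integral do rewrite -EFinM.
rewrite (@continuous_FTC2 _ _ F)//.
- by rewrite -EFinB /F mul0r subr0.
- apply: continuous_in_subspaceT => x; rewrite inE/= in_itv/= => /andP[x0 _].
  by apply: cvgM; [exact: cvg_cst|exact: continuous_density0].
- have cF (x : R) : 0 <= x -> F y @[y --> x] --> F x.
    move=> x0; have dx := dF _ x0.
    by apply: differentiable_continuous; apply/derivable1_diffP.
  split.
  + by move=> x; rewrite in_itv/= => /andP[/ltW/dF dx _].
  + exact: (cvg_at_right_filter (cF _ _)).
  + exact: (cvg_at_left_filter (cF _ (ltW t0))).
- move=> x; rewrite in_itv/= => /andP[/ltW/dF dx _].
  by rewrite derive1E; exact: derive_val.
Qed.

End RadialDensity.

Section ExpectedZeros.
Context d (T : measurableType d) (R : realType) (P : probability T R).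
Local Notation plane := (measurableTypeR R * measurableTypeR R)%type.
Variables (alpha beta : nat -> {RV P >-> R}) (s : nat -> R) (n : nat).
Hypothesis hgauss : iid_standard_gaussian alpha beta.
Hypothesis s0 : s 0%N != 0.

Lemma cplx_plane_of (z : R[i]) : cplx (plane_of z) = z.
Proof. by case: z. Qed.

Lemma nb_zeros_count (p : {poly R[i]}) (Om : set R[i]) :
  nb_zeros p Om = count p (cplx @^-1` Om).
Proof.
rewrite nb_zerosE; apply: eq_bigr => a _; rewrite !indicE; congr (_%:R).
congr nat_of_bool; apply/idP/idP; rewrite !inE/= cplx_plane_of//.
Qed.

Lemma expected_zeros_integral (Om : set R[i]) : measurable (cplx @^-1` Om) ->
  expected_zeros P (gpoly alpha beta s n) Om =
  (\int[area]_(u in cplx @^-1` Om) (density0 s n (normsq u))%:E)%E.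
Proof.
move=> mOm; rewrite /expected_zeros unlock.
under eq_integral do rewrite nb_zeros_count.
exact: (expected_count n hgauss s0 mOm).2.
Qed.

Lemma expected_zeros_disk (r : R) : 0 < r ->
  expected_zeros P (gpoly alpha beta s n) (disk r) =
  (r ^+ 2 * Kratio s n (r ^+ 2))%:E.
Proof.
move=> r0.
have diskE : cplx @^-1` disk r = [set u : plane | normsq u < r ^+ 2].
  apply/seteqP; split => -[x y]; rewrite /disk /= /normsq /=.
    by rewrite -{2}[_ + _]sqr_sqrtr ?addr_ge0 ?sqr_ge0// ltr_sqr ?nnegrE ?sqrtr_ge0 ?ltW.
  by rewrite -{1}[_ + _]sqr_sqrtr ?addr_ge0 ?sqr_ge0// ltr_sqr ?nnegrE ?sqrtr_ge0 ?ltW.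
have mdisk : measurable (cplx @^-1` disk r).
  rewrite diskE (_ : [set u : plane | _] = normsq @^-1` `]-oo, (r ^+ 2)[%classic).
    by rewrite -[X in measurable X]setTI; apply: measurable_normsq => //; exact: measurable_itv.
  by apply/seteqP; split => u /=; rewrite in_itv.
rewrite expected_zeros_integral// diskE integral_density0_disk// exprn_gt0//.
Qed.

(** The total mass is the expected number of all zeros, at most [n]. Integrability is what the
    almost everywhere uniqueness of the intensity rests on. *)
Lemma integrable_density0 : area.-integrable setT (fun u => (density0 s n (normsq u))%:E).
Proof.
have m := measurable_density0_plane s n.
apply/integrableP; split; first exact/measurable_EFinP.
rewrite (_ : (\int[area]_u _ = \int[area]_u (density0 s n (normsq u))%:E)%E); last first.
  by apply: eq_integral => u _; rewrite /= ger0_norm// density0_ge0// normsq_ge0.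
rewrite -(expected_count n hgauss s0 measurableT).2.
apply: (@le_lt_trans _ _ (\int[P]_w (cst n%:R%:E w))%E).
  apply: ge0_le_integral => //.
  - by move=> w _; rewrite lee_fin count_ge0.
  - by apply/measurable_EFinP; exact: (expected_count n hgauss s0 measurableT).1.
  - by move=> w _; rewrite lee_fin; exact: count_gpoly_le.
rewrite integral_cst// [X in (_ * X)%E](_ : _ = 1%E) ?mule1 ?ltry//.
exact: probability_setT.
Qed.

End ExpectedZeros.

(** * Closed forms and limits *)

Section ClosedForms.
Context {R : realType}.
Variable n : nat.

(** The factor that normalizes z^k in the Bergman space of the unit disk, where |z|^(2k) has
    integral pi / (k + 1). *)
Definition bergman (k : nat) : R := Num.sqrt (k.+1%:R / pi).

Lemma bergman_sqr k : bergman k ^+ 2 = k.+1%:R / pi.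
Proof. by rewrite sqr_sqrtr// divr_ge0 ?pi_ge0. Qed.

Lemma bergman0_neq0 : bergman 0 != 0.
Proof. by rewrite gt_eqF// sqrtr_gt0 divr_gt0 ?pi_gt0. Qed.

Local Notation K := (Kpoly bergman n).
Local Notation a := ((n.+1%:R * n.+2%:R) : R).
Local Notation m := (n%:R : R).

Let pi0 : pi != 0 :> R. Proof. by rewrite gt_eqF ?pi_gt0. Qed.

(** The numerator, over (1 - x)^2, of the derivative of (1 - x^(n+2)) / (1 - x). *)
Definition kernel_num (x : R) : R := 1 + x ^+ n.+1 * (n.+1%:R * x - n.+2%:R).

Lemma Kpoly_bergman (x : R) : pi * K.[x] = \sum_(k < n.+1) k.+1%:R * x ^+ k.
Proof.
rewrite horner_poly mulr_sumr; apply: eq_bigr => k _.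
by rewrite bergman_sqr mulrA [pi * _]mulrC divfK.
Qed.

Lemma Kpoly_closed (x : R) : pi * K.[x] * (1 - x) ^+ 2 = kernel_num x.
Proof.
rewrite Kpoly_bergman /kernel_num; elim: n => [|j IH].
  by rewrite big_ord1 expr0 expr1 -!natr1 mulr0n; ring.
by rewrite big_ord_recr/= mulrDl IH -!natr1 !exprS; ring.
Qed.

(** A linear differential equation for [K] takes the place of the quotient rule. It holds at every
    [x], including 1, and so can be differentiated again. *)
Lemma derivK_bergman (x : R) : (1 - x) * (pi * K^`().[x]) = 2 * (pi * K.[x]) - a * x ^+ n.
Proof.
have -> : pi * K^`().[x] = \sum_(k < n.+1) k.+1%:R * (x ^+ k.-1 *+ k).
  rewrite horner_deriv_Kpoly mulr_sumr; apply: eq_bigr => k _.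
  by rewrite bergman_sqr mulrA [pi * _]mulrC divfK.
rewrite Kpoly_bergman; elim: n => [|j IH].
  by rewrite !big_ord1 mulr0n expr0 -!natr1 mulr0n; ring.
rewrite big_ord_recr/= mulrDr IH [in RHS]big_ord_recr/= -mulr_natr exprS.
by move: (\sum_(_ < _) _) => S; rewrite -!natr1; ring.
Qed.

(** The derivative of [derivK_bergman], multiplied by [x]: this turns n x^(n-1) into n x^n, which is
    correct for [n = 0] too. *)
Lemma deriv2K_bergman (x : R) :
  (1 - x) * (pi * (x * K^`()^`().[x])) = 3 * x * (pi * K^`().[x]) - m * a * x ^+ n.
Proof.
pose p := (1 - 'X) * (pi *: K^`()); pose q := 2 *: (pi *: K) - a *: 'X^n.
have pq : horner p = horner q.
  apply/funext => y; rewrite /p /q !(hornerD, hornerN, hornerM, hornerZ, hornerX, hornerXn, hornerC) /=.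
  exact: derivK_bergman.
have := @derive_val _ _ _ _ _ _ _ (is_derive_horner p x).
rewrite pq (@derive_val _ _ _ _ _ _ _ (is_derive_horner q x)) /p /q.
rewrite !(derivB, derivM, derivZ, derivXn, derivX, derivC, hornerD, hornerN, hornerM, hornerZ, hornerX, hornerXn, hornerC, hornerMn).
rewrite -mulr_natr => e.
have xn : m * x ^+ n = x * (m * x ^+ n.-1).
  by case: (n) => [|j]; rewrite ?mul0r ?mulr0// exprS mulrCA.
rewrite (_ : m * a * x ^+ n = a * (m * x ^+ n)); last by ring.
rewrite xn; move: K^`().[x] K^`()^`().[x] e => b c e.
transitivity (x * ((0 - 1) * (pi * b) + (1 - x) * (pi * c)) + x * (pi * b)); first by ring.
by rewrite -e; ring.
Qed.

Lemma kernel_num_gt0 (x : R) : 0 <= x -> x != 1 -> 0 < kernel_num x.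
Proof.
move=> x0 x1; rewrite -Kpoly_closed; apply: mulr_gt0; last first.
  by rewrite exprn_even_gt0//= subr_eq0 eq_sym.
by rewrite mulr_gt0 ?pi_gt0// Kpoly_gt0// bergman0_neq0.
Qed.

Lemma radial_mass_closed (x : R) : 0 <= x -> x != 1 ->
  x * Kratio bergman n x =
  2 * x / (1 - x) - a * (1 - x) * x ^+ n.+1 / kernel_num x.
Proof.
move=> x0 x1; have N0 : kernel_num x != 0 by rewrite gt_eqF// kernel_num_gt0.
have x10 : 1 - x != 0 by rewrite subr_eq0 eq_sym.
have KE : pi * K.[x] = kernel_num x / (1 - x) ^+ 2.
  by rewrite -Kpoly_closed mulfK// expf_neq0.
have K'E : pi * K^`().[x] = (2 * (kernel_num x / (1 - x) ^+ 2) - a * x ^+ n) / (1 - x).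
  by rewrite -KE -derivK_bergman [RHS]mulrC mulKf.
have -> : Kratio bergman n x = (pi * K^`().[x]) / (pi * K.[x]).
  by rewrite /Kratio invfM mulrACA mulfV// mul1r.
rewrite KE K'E [x ^+ n.+1]exprS; move: (kernel_num x) N0 (x ^+ n) a => N N0 y c.
by field; rewrite N0.
Qed.

Lemma density0_closed (x : R) : 0 <= x -> x != 1 ->
  density0 bergman n x =
  pi^-1 * (2 / (1 - x) ^+ 2 -
    a * x ^+ n * (x ^+ n.+2 - n.+2%:R * x + n.+1%:R) / kernel_num x ^+ 2).
Proof.
move=> x0 x1; have N0 : kernel_num x != 0 by rewrite gt_eqF// kernel_num_gt0.
have x10 : 1 - x != 0 by rewrite subr_eq0 eq_sym.
have KE : pi * K.[x] = kernel_num x / (1 - x) ^+ 2.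
  by rewrite -Kpoly_closed mulfK// expf_neq0.
have K'E : pi * K^`().[x] = (2 * (kernel_num x / (1 - x) ^+ 2) - a * x ^+ n) / (1 - x).
  by rewrite -KE -derivK_bergman [RHS]mulrC mulKf.
have K''E : pi * (x * K^`()^`().[x]) = (3 * x * (pi * K^`().[x]) - m * a * x ^+ n) / (1 - x).
  by rewrite -deriv2K_bergman [RHS]mulrC mulKf.
have K0 : K.[x] != 0 by rewrite gt_eqF// Kpoly_gt0// bergman0_neq0.
(* The density is arranged so that the second derivative occurs only as x K'', the quantity given by
   [deriv2K_bergman]. *)
have -> : density0 bergman n x = pi^-1 * ((pi * K^`().[x]) / (pi * K.[x]) +
    ((pi * (x * K^`()^`().[x])) * (pi * K.[x]) - x * (pi * K^`().[x]) ^+ 2) / (pi * K.[x]) ^+ 2).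
  rewrite /density0 /Kratio /dKratio.
  move: K.[x] K^`().[x] K^`()^`().[x] K0 (pi : R) pi0 => b c e b0 p p0.
  by field; rewrite b0.
congr (_ * _); rewrite K''E K'E KE.
move: N0; rewrite /kernel_num [x ^+ n.+2]exprS [x ^+ n.+1]exprS -!natr1; move: (x ^+ n) m => y k N0.
by field; rewrite x10 N0.
Qed.

(** The closed form is 0 / 0 at 1, so both sums are evaluated directly: pi K(1) = (n+1)(n+2)/2 and
    pi K'(1) = n(n+1)(n+2)/3. *)
Lemma radial_mass_at1 : Kratio bergman n 1 = 2 * m / 3.
Proof.
have s1 : pi * K.[1] = (n.+1%:R * n.+2%:R) / 2 :> R.
  rewrite Kpoly_bergman; elim: n => [|j IH]; first by rewrite big_ord1 expr0 -!natr1; field.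
  by rewrite big_ord_recr/= IH expr1n -!natr1; field.
have s2 : pi * K^`().[1] = m * (n.+1%:R * n.+2%:R) / 3 :> R.
  have -> : pi * K^`().[1] = \sum_(k < n.+1) k.+1%:R * k%:R.
    rewrite horner_deriv_Kpoly mulr_sumr; apply: eq_bigr => k _.
    by rewrite bergman_sqr mulrA [pi * _]mulrC divfK// expr1n.
  elim: n => [|j IH]; first by rewrite big_ord1 !mulr0 !mul0r.
  by rewrite big_ord_recr/= IH -!natr1; field.
have -> : Kratio bergman n 1 = (pi * K^`().[1]) / (pi * K.[1]).
  by rewrite /Kratio invfM mulrACA mulfV// mul1r.
rewrite s1 s2; have h1 : n.+1%:R != 0 :> R by rewrite pnatr_eq0.
have h2 : n.+2%:R != 0 :> R by rewrite pnatr_eq0.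
move: (n.+1%:R : R) (n.+2%:R : R) m h1 h2 => b c e h1 h2.
by field; rewrite h1 h2.
Qed.

End ClosedForms.

Section Limits.
Context {R : realType}.

(** Each term of 1 + p + ... + p^(k-1) = (1 - p^k) / (1 - p) is at least p^k. *)
Lemma mulrn_expr_bound (p : R) (k : nat) : 0 < p < 1 -> k%:R * p ^+ k <= (1 - p)^-1.
Proof.
move=> /andP[p0 p1]; have p10 : 0 < 1 - p by rewrite subr_gt0.
rewrite -div1r ler_pdivlMr//.
suff : k%:R * p ^+ k * (1 - p) <= 1 - p ^+ k.
  by move=> /le_trans; apply; rewrite gerBl exprn_ge0// ltW.
elim: k => [|k IH]; first by rewrite expr0 mul0r mul0r subrr.
have pk : 0 <= p ^+ k.+1 <= 1 by rewrite exprn_ge0 ?exprn_ile1// ltW.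
have {}IH : p * (k%:R * p ^+ k * (1 - p)) <= p * (1 - p ^+ k) by rewrite ler_pM2l.
rewrite -natr1.
rewrite (_ : _ * (1 - p) = p * (k%:R * p ^+ k * (1 - p)) + p ^+ k.+1 * (1 - p)); last first.
  by rewrite exprS; ring.
move: IH; rewrite [leRHS]mulrBr mulr1 -exprS => IH.
move: pk IH; move: (p ^+ k.+1) (k%:R * p ^+ k * (1 - p)) => y z /andP[y0 y1] IH.
have : (1 - p) * (1 - y) >= 0 by rewrite mulr_ge0 ?subr_ge0// ltW.
lra.
Qed.

(** With p = sqrt r, the power r^(2n+2) is (p^(n+2))^2 r^n. The two factors p^(n+2) absorb n + 1 and
    n + 2 up to the constant [C], and r^n is left to tend to 0. *)
Lemma cvg_sqrn_expr (r : R) : 0 < r < 1 ->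
  n.+1%:R * n.+2%:R * r ^+ (2 * n + 2) @[n --> \oo] --> (0 : R).
Proof.
move=> /andP[r0 r1]; pose p := Num.sqrt r.
have p2 : p ^+ 2 = r by rewrite sqr_sqrtr// ltW.
have p0 : 0 < p by rewrite sqrtr_gt0.
have p1 : p < 1 by rewrite -sqrtr1 ltr_sqrt.
pose C := (1 - p)^-1; have C0 : 0 < C by rewrite invr_gt0 subr_gt0.
apply: (@squeeze_cvgr _ _ _ _ (fun=> 0) (fun n => C ^+ 2 * r ^+ n)).
- apply: nearW => n; apply/andP; split.
    by rewrite !mulr_ge0// exprn_ge0// ltW.
  have h : n.+2%:R * p ^+ n.+2 <= C by apply: mulrn_expr_bound; rewrite p0.
  have h0 : 0 <= n.+2%:R * p ^+ n.+2 by rewrite mulr_ge0// exprn_ge0// ltW.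
  have h1 : (n.+2%:R * p ^+ n.+2) ^+ 2 <= C ^+ 2 by rewrite ler_sqr ?nnegrE// ltW.
  rewrite (_ : r ^+ (2 * n + 2) = (p ^+ n.+2) ^+ 2 * r ^+ n); last first.
    rewrite -exprM -p2 -!exprM -exprD; congr (_ ^+ _); lia.
  rewrite mulrA ler_pM2r ?exprn_gt0//; apply: le_trans h1.
  move: (p ^+ n.+2) => z; rewrite exprMn; apply: ler_wpM2r; first exact: sqr_ge0.
  by rewrite expr2; apply: ler_wpM2r => //; rewrite ler_nat.
- exact: cvg_cst.
- rewrite -[X in _ --> X](mulr0 (C ^+ 2)); apply: cvgM; first exact: cvg_cst.
  by apply: cvg_expr; rewrite ger0_norm// ltW.
Qed.

Lemma cvg_kernel_num (r : R) : 0 < r < 1 ->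
  1 + r ^+ (2 * n + 2) * (n.+1%:R * r ^+ 2 - n.+2%:R) @[n --> \oo] --> (1 : R).
Proof.
move=> /[dup] r01 /andP[r0 r1].
apply: (@squeeze_cvgr _ _ _ _ (fun n => 1 - n.+1%:R * n.+2%:R * r ^+ (2 * n + 2)) (fun=> 1)).
- apply: nearW => n; have y0 : 0 <= r ^+ (2 * n + 2) by rewrite exprn_ge0// ltW.
  have r20 : 0 <= r ^+ 2 by rewrite sqr_ge0.
  have r21 : r ^+ 2 <= 1 by rewrite exprn_ile1// ltW.
  have m0 : 0 <= n%:R :> R by [].
  rewrite -!natr1; move: (r ^+ (2 * n + 2)) (r ^+ 2) (n%:R : R) y0 r20 r21 m0 => y q m y0 q0 q1 m0.
  have qm : 0 <= m * q <= m by rewrite mulr_ge0// ler_piMr.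
  apply/andP; split; last first.
    by rewrite gerDl mulr_ge0_le0//; lra.
  rewrite lerD2l -mulNr mulrC; apply: ler_wpM2l => //; nra.
- rewrite -[X in _ --> X]subr0; apply: cvgB; [exact: cvg_cst|exact: cvg_sqrn_expr].
- exact: cvg_cst.
Qed.

Lemma cvg_disk_mass (r : R) : 0 < r < 1 ->
  2 * r ^+ 2 / (1 - r ^+ 2) - n.+1%:R * n.+2%:R * (1 - r ^+ 2) * r ^+ (2 * n + 2)
     / (1 + r ^+ (2 * n + 2) * (n.+1%:R * r ^+ 2 - n.+2%:R)) @[n --> \oo]
  --> 2 * r ^+ 2 / (1 - r ^+ 2).
Proof.
move=> r01; rewrite -[X in _ --> X]subr0; apply: cvgB; first exact: cvg_cst.
rewrite (_ : 0 = (1 - r ^+ 2) * 0 / 1); last by rewrite mulr0 mul0r.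
apply: cvgM; last by apply: cvgV; [exact: oner_neq0|exact: cvg_kernel_num].
under eq_cvg do rewrite mulrAC mulrC.
by apply: cvgM; [exact: cvg_cst|exact: cvg_sqrn_expr].
Qed.

(** The inequality exp y >= 1 + y at y = t/n and y = - t/n squeezes the sequence between t / (1 +
    t/n) and t. *)
Lemma cvg_expanding (t : R) : 0 < t ->
  n%:R * (1 - expR (- t / n%:R)) @[n --> \oo] --> t.
Proof.
move=> t0.
have inv0 : (n%:R^-1 : R) @[n --> \oo] --> (0 : R) by rewrite -cvg_shiftS; exact: cvg_harmonic.
apply: (@squeeze_cvgr _ _ _ _ (fun n => t / (1 + t / n%:R)) (fun=> t)).
- near=> n; have n0 : 0 < n%:R :> R by rewrite ltr0n; near: n; exact: nbhs_infty_gt.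
  have y0 : 0 < t / n%:R by rewrite divr_gt0.
  have e1 := expR_ge1Dx (- t / n%:R); have e2 := expR_ge1Dx (t / n%:R).
  rewrite mulNr in e1 *.
  have ee : expR (- (t / n%:R)) = (expR (t / n%:R))^-1 by rewrite expRN.
  have tE : t = n%:R * (t / n%:R) by rewrite mulrC divfK// gt_eqF.
  move: (t / n%:R) y0 e1 e2 ee tE => y y0 e1 e2 ee tE.
  apply/andP; split.
    rewrite {1}tE -mulrA ler_pM2l// ee.
    have i : (expR y)^-1 <= (1 + y)^-1 by rewrite lef_pV2 ?posrE ?expR_gt0//; lra.
    have : y / (1 + y) = 1 - (1 + y)^-1 by field; lra.
    lra.
  rewrite [leRHS]tE ler_pM2l//; lra.
- rewrite -[X in _ --> X](divr1 t) -[in X in _ --> X](addr0 1); apply: cvgM; first exact: cvg_cst.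
  apply: cvgV; first by rewrite addr0 oner_neq0.
  apply: cvgD; first exact: cvg_cst.
  by rewrite -(mulr0 t); apply: cvgM; [exact: cvg_cst|exact: inv0].
- exact: cvg_cst.
Unshelve. all: by end_near. Qed.

End Limits.

Section Expanding.
Context {R : realType}.

Definition disk_mass (n : nat) (r : R) : R :=
  2 * r ^+ 2 / (1 - r ^+ 2) - n.+1%:R * n.+2%:R * (1 - r ^+ 2) * r ^+ (2 * n + 2)
     / (1 + r ^+ (2 * n + 2) * (n.+1%:R * r ^+ 2 - n.+2%:R)).

(** With r^2 = x_n and r^(2n+2) = x_n exp (-t), the quotient by [n] is a rational function of 1/n,
    x_n and u_n = n (1 - x_n), which tend to 0, 1 and t. The limit of its denominator is (exp t - 1
    - t) / exp t, nonzero since exp t > 1 + t. *)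
Lemma cvg_expanding_mass (t : R) : 0 < t ->
  disk_mass n (expR (- t / (2 * n%:R))) / n%:R @[n --> \oo] -->
  2 / t + t / (1 - expR t + t).
Proof.
move=> t0; pose e := expR (- t); pose x n := expR (- t / n%:R).
pose u n := n%:R * (1 - x n).
have cu : u n @[n --> \oo] --> t by exact: cvg_expanding.
have ci : (n%:R^-1 : R) @[n --> \oo] --> (0 : R) by rewrite -cvg_shiftS; exact: cvg_harmonic.
have cx : x n @[n --> \oo] --> (1 : R).
  have cy : - t / n%:R @[n --> \oo] --> (0 : R).
    by rewrite -(mulr0 (- t)); apply: cvgM; [exact: cvg_cst|exact: ci].
  by rewrite -expR0; apply: (continuous_cvg _ _ cy); exact: continuous_expR.
have et : expR t != 0 by rewrite gt_eqF ?expR_gt0.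
have gt1 : 1 + t < expR t by apply: expR_gt1Dx; rewrite gt_eqF.
have eE : e = (expR t)^-1 by rewrite /e expRN.
pose den n := 1 + e * x n * (- u n - (1 - x n) - 1).
have cden : den n @[n --> \oo] --> 1 + e * 1 * (- t - (1 - 1) - 1).
  apply: cvgD; first exact: cvg_cst.
  apply: cvgM; first by apply: cvgM; [exact: cvg_cst|exact: cx].
  apply: cvgB; last exact: cvg_cst.
  by apply: cvgB; [exact: cvgN|apply: cvgB; [exact: cvg_cst|exact: cx]].
have den0 : 1 + e * 1 * (- t - (1 - 1) - 1) != 0.
  have -> : 1 + e * 1 * (- t - (1 - 1) - 1) = (expR t - 1 - t) / expR t.
    by rewrite eE; move: (expR t) et => z z0; field.
  by rewrite mulf_neq0 ?invr_eq0//; apply: lt0r_neq0; lra.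
pose g n := 2 * x n / u n - (1 + n%:R^-1) * (1 + 2 * n%:R^-1) * u n * x n * e / den n.
have cg : g n @[n --> \oo] --> 2 * 1 / t - (1 + 0) * (1 + 2 * 0) * t * 1 * e / (1 + e * 1 * (- t - (1 - 1) - 1)).
  apply: cvgB.
    apply: cvgM; first by apply: cvgM; [exact: cvg_cst|exact: cx].
    by apply: cvgV; [rewrite gt_eqF|exact: cu].
  apply: cvgM; last by apply: cvgV.
  apply: cvgM; last exact: cvg_cst.
  apply: cvgM; last exact: cx.
  apply: cvgM; last exact: cu.
  apply: cvgM; apply: cvgD; try exact: cvg_cst; first exact: ci.
  by apply: cvgM; [exact: cvg_cst|exact: ci].
have -> : 2 / t + t / (1 - expR t + t) =
    2 * 1 / t - (1 + 0) * (1 + 2 * 0) * t * 1 * e / (1 + e * 1 * (- t - (1 - 1) - 1)).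
  rewrite eE; move: (expR t) et gt1 => z z0 z1.
  have [z2 z3] : z + (- t - 1) != 0 /\ 1 - z + t != 0 by split; [rewrite gt_eqF|rewrite lt_eqF]; lra.
  by field; rewrite z0 z2 z3 gt_eqF.
apply: cvg_trans cg; apply: near_eq_cvg; near=> n.
have n0 : 0 < n%:R :> R by rewrite ltr0n; near: n; exact: nbhs_infty_gt.
have nn0 : n%:R != 0 :> R by rewrite gt_eqF.
have rx : expR (- t / (2 * n%:R)) ^+ 2 = x n.
  by rewrite /x -expRM_natl; congr expR; rewrite -mulr_natl; field.
have rn : expR (- t / (2 * n%:R)) ^+ (2 * n + 2) = x n * e.
  rewrite exprD rx mulrC exprM rx /x -expRM_natl /e; congr (_ * expR _).
  by rewrite -mulr_natl; field.
have x1 : x n < 1 by rewrite /x expR_lt1 mulNr oppr_lt0 divr_gt0.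
rewrite /disk_mass rx rn /g /den /u.
have dE : 1 + x n * e * (n.+1%:R * x n - n.+2%:R) = 1 + e * x n * (- (n%:R * (1 - x n)) - (1 - x n) - 1).
  by rewrite -!natr1; ring.
rewrite dE -!natr1.
move: (1 + e * x n * _) => D.
have x10 : 1 - x n != 0 by apply: lt0r_neq0; lra.
(* If the denominator vanishes, both second terms are 0 by x / 0 = 0, so the identity holds for
   every n > 0. *)
have [->|D0] := eqVneq D 0.
  rewrite !invr0 !mulr0 !subr0; move: (x n) (n%:R : R) x10 nn0 => y m y0 m0.
  by field; rewrite y0 m0.
move: (x n) (n%:R : R) x10 nn0 => y m y0 m0.
by field; rewrite D0 y0 m0.
Unshelve. all: by end_near. Qed.

End Expanding.

(** * The intensity: closed form and uniqueness *)

Section Intensity.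
Context d (T : measurableType d) (R : realType) (P : probability T R).
Local Notation mu := (@lebesgue_measure R).
Local Notation plane := (measurableTypeR R * measurableTypeR R)%type.
Variables (alpha beta : nat -> {RV P >-> R}).
Hypothesis hgauss : iid_standard_gaussian alpha beta.
Variable n : nat.

Definition intensity (z : R[i]) : R :=
  pi^-1 * (2 / (1 - normc z ^+ 2) ^+ 2
      - n.+1%:R * n.+2%:R * normc z ^+ (2 * n)
          * (normc z ^+ (2 * n + 4) - n.+2%:R * normc z ^+ 2 + n.+1%:R)
        / (1 + normc z ^+ (2 * n + 2)
                 * (n.+1%:R * normc z ^+ 2 - n.+2%:R)) ^+ 2).

Definition radial_intensity (t : R) : R :=
  pi^-1 * (2 / (1 - t) ^+ 2 -
    n.+1%:R * n.+2%:R * t ^+ n * (t ^+ n.+2 - n.+2%:R * t + n.+1%:R) / kernel_num n t ^+ 2).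

Lemma intensity_radial (z : R[i]) : intensity z = radial_intensity (normc z ^+ 2).
Proof.
rewrite /intensity /radial_intensity /kernel_num; move: (normc z) => r.
have e1 : (r ^+ 2) ^+ n.+1 = r ^+ (2 * n + 2) by rewrite -exprM; congr (_ ^+ _); lia.
have e2 : (r ^+ 2) ^+ n.+2 = r ^+ (2 * n + 4) by rewrite -exprM; congr (_ ^+ _); lia.
by rewrite e1 e2 -exprM.
Qed.

Lemma normc_cplx_sqr (u : plane) : normc (cplx u) ^+ 2 = normsq u.
Proof. by rewrite /= sqr_sqrtr// addr_ge0 ?sqr_ge0. Qed.

(* At [t = 1] both quotients have denominator 0, hence are 0. *)
Lemma radial_intensity1 : radial_intensity 1 = 0.
Proof.
have k1 : kernel_num n 1 = 0 :> R by rewrite /kernel_num expr1n mul1r mulr1 -!natr1; ring.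
by rewrite /radial_intensity k1 subrr !expr0n /= !invr0 !mulr0 subr0 mulr0.
Qed.

Lemma radial_intensityE (t : R) : 0 <= t -> t != 1 ->
  radial_intensity t = density0 (@bergman R) n t.
Proof. by move=> t0 t1; rewrite density0_closed. Qed.

Lemma radial_intensity_ge0 (t : R) : 0 <= t -> 0 <= radial_intensity t.
Proof.
move=> t0; have [->|t1] := eqVneq t 1; first by rewrite radial_intensity1.
by rewrite radial_intensityE// density0_ge0// bergman0_neq0.
Qed.

Lemma measurable_radial_intensity : measurable_fun setT radial_intensity.
Proof.
have mX k : measurable_fun setT (fun t : R => t ^+ k) by exact: measurable_funX.
apply: measurable_funM => //; apply: measurable_funB.
  apply: measurable_funM => //; apply: measurable_funV; apply: measurable_funX.
  exact: measurable_funB.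
apply: measurable_funM.
  apply: measurable_funM; first by apply: measurable_funM.
  by apply: measurable_funD => //; apply: measurable_funB => //; apply: measurable_funM.
apply: measurable_funV; apply: measurable_funX; apply: measurable_funD => //.
by apply: measurable_funM => //; apply: measurable_funB => //; apply: measurable_funM.
Qed.

Lemma measurable_intensity : measurable_fun setT (intensity \o cplx).
Proof.
rewrite (_ : _ \o _ = radial_intensity \o normsq).
  exact: (measurableT_comp measurable_radial_intensity measurable_normsq).
by apply/funext => u; rewrite /comp intensity_radial normc_cplx_sqr.
Qed.

(** The closed form can differ from the smooth density only on the unit circle, where its quotients
    read as divisions by 0. The circle is null, being the preimage of a point under |z|^2. *)
Lemma ae_intensity : {ae area, forall u : plane,
  density0 (@bergman R) n (normsq u) = intensity (cplx u)}.
Proof.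
exists (normsq @^-1` [set 1]); split.
- by rewrite -[X in measurable X]setTI; apply: measurable_normsq => //; exact: measurable_set1.
- have m1 : measurable ([set 1] : set (measurableTypeR R)) by exact: measurable_set1.
  rewrite area_normsq//.
    by rewrite lebesgue_measure_set1 mule0.
  by move=> _ ->; rewrite /= in_itv/= ler01.
- move=> u /= h; apply: contrapT => u1; apply: h.
  rewrite intensity_radial normc_cplx_sqr radial_intensityE ?normsq_ge0//.
  exact/eqP.
Qed.

Lemma intensity_is_intensity : is_intensity P (random_poly alpha beta n) intensity.
Proof.
split; first exact: measurable_intensity.
  by move=> z; rewrite intensity_radial radial_intensity_ge0// sqr_ge0.
move=> Om mOm; have s0 := @bergman0_neq0 R.
rewrite -[random_poly _ _ _]/(gpoly alpha beta (@bergman R) n) expected_zeros_integral//.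
apply: ae_eq_integral => //.
- by apply/measurable_EFinP; apply: measurable_funTS; exact: measurable_density0_plane.
- by apply/measurable_EFinP; apply: measurable_funTS; exact: measurable_intensity.
- have [N [mN N0 hN]] := ae_intensity; exists N; split => // u /= h; apply: hN => /= uE.
  by apply: h => _; rewrite uE.
Qed.

(** Two densities with equal integrals over all Borel sets agree almost everywhere. The comparison
    is made with [density0], whose integrability is known. *)
Lemma intensity_unique (rho' : R[i] -> R) :
  is_intensity P (random_poly alpha beta n) rho' ->
  {ae area, forall u, rho' (cplx u) = intensity (cplx u)}.
Proof.
case=> mrho rho0 rhoE; have s0 := @bergman0_neq0 R.
have := @integral_ae_eq _ _ _ area setT measurableT (fun u => (rho' (cplx u))%:E)
  (fun u => (density0 (@bergman R) n (normsq u))%:E) (integrable_density0 n hgauss s0).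
case=> [||N1 [mN1 N10 h1]].
- exact/measurable_EFinP.
- move=> E _ mE; pose Om : set R[i] := [set z | E (plane_of z)].
  have OmE : cplx @^-1` Om = E by apply/seteqP; split => -[x y].
  have mOm : measurable (cplx @^-1` Om) by rewrite OmE.
  have := rhoE Om mOm; rewrite OmE => <-.
  rewrite -[random_poly _ _ _]/(gpoly alpha beta (@bergman R) n) expected_zeros_integral//.
  by rewrite OmE.
have [N2 [mN2 N20 h2]] := ae_intensity.
exists (N1 `|` N2); split; first exact: measurableU.
  by rewrite measureU0.
move=> u /= h; apply: contrapT => /not_orP[n1 n2]; apply: h.
have e2 : density0 (@bergman R) n (normsq u) = intensity (cplx u).
  by apply: contrapT => /h2.
have : (density0 (@bergman R) n (normsq u))%:E = (rho' (cplx u))%:E.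
  by apply: contrapT => h; apply: n1; apply: h1 => /= /(_ Logic.I).
by rewrite -e2 => -[].
Qed.

Lemma expected_zeros_disk_mass (r : R) : 0 < r < 1 ->
  expected_zeros P (random_poly alpha beta n) (disk r) = (disk_mass n r)%:E.
Proof.
move=> /andP[r0 r1]; have s0 := @bergman0_neq0 R.
rewrite -[random_poly _ _ _]/(gpoly alpha beta (@bergman R) n) (expected_zeros_disk n hgauss s0 r0).
have r21 : r ^+ 2 < 1 by rewrite exprn_ilt1// ltW.
rewrite radial_mass_closed ?sqr_ge0 ?lt_eqF//; congr EFin.
have e1 : (r ^+ 2) ^+ n.+1 = r ^+ (2 * n + 2) by rewrite -exprM; congr (_ ^+ _); lia.
by rewrite /disk_mass /kernel_num e1.
Qed.

Lemma expected_zeros_unit_disk :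
  expected_zeros P (random_poly alpha beta n) (disk 1) = (2 * n%:R / 3)%:E.
Proof.
have s0 := @bergman0_neq0 R.
rewrite -[random_poly _ _ _]/(gpoly alpha beta (@bergman R) n).
by rewrite (expected_zeros_disk n hgauss s0 ltr01) expr1n mul1r radial_mass_at1.
Qed.

End Intensity.

Unset Implicit Arguments.

Theorem theorem1 (R : realType) (d : measure_display) (T : measurableType d)
    (P : probability T R) (alpha beta : nat -> {RV P >-> R})
    (hgauss : iid_standard_gaussian alpha beta) :
  let EN := fun n : nat => expected_zeros P (random_poly alpha beta n) in
  let rho := fun (n : nat) (z : R[i]) =>
    pi^-1 * (2 / (1 - normc z ^+ 2) ^+ 2
      - n.+1%:R * n.+2%:R * normc z ^+ (2 * n)
          * (normc z ^+ (2 * n + 4) - n.+2%:R * normc z ^+ 2 + n.+1%:R)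
        / (1 + normc z ^+ (2 * n + 2)
                 * (n.+1%:R * normc z ^+ 2 - n.+2%:R)) ^+ 2) in
  [/\
      forall n : nat,
        is_intensity P (random_poly alpha beta n) (rho n) /\
        (forall rho' : R[i] -> R,
          is_intensity P (random_poly alpha beta n) rho' ->
          {ae area, forall u, rho' (cplx u) = rho n (cplx u)}),
      forall (n : nat) (r : R), 0 < r < 1 ->
        EN n (disk r) =
          (2 * r ^+ 2 / (1 - r ^+ 2)
           - n.+1%:R * n.+2%:R * (1 - r ^+ 2) * r ^+ (2 * n + 2)
             / (1 + r ^+ (2 * n + 2) * (n.+1%:R * r ^+ 2 - n.+2%:R)))%:E,
      forall r : R, 0 < r < 1 ->
        EN n (disk r) @[n --> \oo] --> (2 * r ^+ 2 / (1 - r ^+ 2))%:E,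
      forall t : R, 0 < t ->
        (EN n (disk (expR (- t / (2 * n%:R)))) * (n%:R^-1)%:E)%E @[n --> \oo]
          --> (2 / t + t / (1 - expR t + t))%:E
    & forall n : nat, EN n (disk 1) = (2 * n%:R / 3)%:E ].
Proof.
move=> EN rho; split.
- move=> n; split; first exact: intensity_is_intensity.
  by move=> rho' /(intensity_unique hgauss).
- by move=> n r r01; exact: expected_zeros_disk_mass.
- move=> r r01; rewrite /EN; under eq_cvg do rewrite (expected_zeros_disk_mass hgauss _ r01).
  by apply: cvg_EFin; [exact: nearW|exact: cvg_disk_mass].
- move=> t t0; apply: (@cvg_trans _ ((disk_mass n (expR (- t / (2 * n%:R))) / n%:R)%:E @[n --> \oo])).
    (* At [n = 0] the convention x / 0 = 0 makes the radius exp 0 = 1, outside the range of the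
       closed form; the limit concerns n > 0. *)
    apply: near_eq_cvg; near=> n.
    have n0 : 0 < n%:R :> R by rewrite ltr0n; near: n; exact: nbhs_infty_gt.
    rewrite /EN expected_zeros_disk_mass// expR_gt0 expR_lt1 mulNr oppr_lt0.
    by rewrite divr_gt0// mulr_gt0.
  by apply: cvg_EFin; [exact: nearW|exact: cvg_expanding_mass].
- by move=> n; exact: expected_zeros_unit_disk.
Unshelve. all: by end_near. Qed.
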